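(* Let $\bar A\in\{0,1\}^{n\times n}$ be such that the state bipartite graph $\mathcal B(\bar A)$ has a perfect matching, and let $k$ be the maximum number of actuator-sensor-communication failures. Let $\mathcal I_B^*=\{\iota_1,\dots,\iota_{(k+1)p}\}$ and $\mathcal I_C^*=\{\gamma_1,\dots,\gamma_{(k+1)m}\}$ be minimum collections of state-variable indices of dedicated actuators $\bar B(\mathcal I_B^* )$ and dedicated sensors $\bar C(\mathcal I_C^* )$ ensuring structural controllability, respectively structural observability, under at most $k$ failures, ordered so that for each $i=1,\dots,k+1$ the pairs $(\bar A,\bar B(\{\iota_{(i-1)p+1},\dots,\iota_{ip}\}))$ and $(\bar A,\bar C(\{\gamma_{(i-1)m+1},\dots,\gamma_{im}\}))$ are structurally controllable and structurally observable, respectively. Let $\mathcal I_B^{(i)}$ and $\mathcal I_C^{(i)}$ be the sets of labels of the actuators and sensors in the $i$-th of these sub-collections, and let $\mathcal K^{(i)}$ be the sparsest information pattern determined with Procedure 1 when the two collections $(\mathcal I_B^{(i)},\mathcal I_C^{(i)})$ are considered. Then $(\mathcal I_B^*,\mathcal I_C^*,\mathcal K^* )$, where $\mathcal K^*=\bigcup_{j=1}^{k+1}\mathcal K^{(j)}$, is a solution to the problem $\mathcal P_2$. Furthermore, a solution to $\mathcal P_2$ can be determined in polynomial time, more precisely in $\mathcal O\big(k\max\{|\mathcal V|+|\mathcal E|,(|\mathcal I_B^*|+|\mathcal I_C^*|)^{5/2}\}\big)$, where $|\mathcal V|$ and $|\mathcal E|$ are the numbers of vertices and edges of $\mathcal D(\bar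 A,\bar B(\mathcal I_B^* ),\bar C(\mathcal I_C^* ))$.
   Context: Dedicated actuators and sensors: for a finite collection $\mathcal I_B$ of indices in $\{1,\dots,n\}$ (repetitions allowed, $|\cdot|$ counts multiplicity), $\bar B(\mathcal I_B)$ has one column $e_\iota$ (canonical vector) per element $\iota$; $\bar C(\mathcal I_C)$ has one row $e_\iota^\top$ per element $\iota$ of $\mathcal I_C$. $\mathcal K$ is a set of pairs (sensor, actuator); $(j,i)\in\mathcal K$ means sensor $j$ communicates to actuator $i$; $\bar K(\mathcal K)_{i,j}=1$ if $(j,i)\in\mathcal K$, else $0$. Structural notions: $[\bar M]$ is the set of real matrices vanishing wherever $\bar M$ is zero; ''almost all'' is with respect to Lebesgue measure on the free parameters. $(\bar A,\bar B)$ is structurally controllable if $(A,B)$ is controllable for almost all $A\in[\bar A],B\in[\bar B]$; structural observability of $(\bar A,\bar C)$ is defined dually. ''Ensuring structural controllability under at most $k$ failures'' means $(\bar A,\bar B(\mathcal I_B\setminus\mathcal J_B))$ is structurally controllable for all $\mathcal J_B\subset\mathcal I_B$ with $|\mathcal J_B|\le k$; dually for sensors. $p$ and $m$ are the minimum numbers of dedicated actuators and sensors ensuring structural controllability and observability without failures. Structurally resilient fixed modes: for $\mathcal J\subset\mathcal K$, $[\bar K(\mathcal K)]^{\mathcal J}$ is the set of real gains $K$ (rows indexed by actuators, columns by sensors) with $K_{l,s}=0$ if $(s,l)\notin\mathcal K$ or $(s,l)\in\mathcal J$. $(\bar A,\bar B,\bar C;\mathcal K,\mathcal J)$ has structurally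 resilient fixed modes if $\bigcap_{K\in[\bar K(\mathcal K)]^{\mathcal J}}\sigma(A+BKC)\ne\emptyset$ for almost all $A\in[\bar A],B\in[\bar B],C\in[\bar C]$. Problem $\mathcal P_2$: given $\bar A$ and $k$, minimize $|\mathcal I_B|+|\mathcal I_C|+|\mathcal K|$ over $\mathcal I_B,\mathcal I_C,\mathcal K$ subject to: $(\bar A,\bar B(\mathcal I_B\setminus\mathcal J_B),\bar C(\mathcal I_C\setminus\mathcal J_C);\mathcal K,\mathcal J)$ has no structurally resilient fixed modes for all $\mathcal J\subset\mathcal K$, $\mathcal J_B\subset\mathcal I_B$, $\mathcal J_C\subset\mathcal I_C$ with $|\mathcal J|+|\mathcal J_B|+|\mathcal J_C|\le k$ (links attached to removed actuators or sensors are discarded). Graphs: the system digraph $\mathcal D(\bar A,\bar B,\bar C)$ has vertices $x_1,\dots,x_n$, one $u_i$ per actuator, one $y_j$ per sensor, and edges $(x_i,x_j)$ if $\bar A_{ji}\ne0$, $(u_j,x_i)$ if $\bar B_{ij}\neq0$, $(x_i,y_j)$ if $\bar C_{ji}\ne0$. The state bipartite graph $\mathcal B(\bar A)$ has two copies of $\{x_1,\dots,x_n\}$ as its parts, with an edge from $x_i$ (left) to $x_j$ (right) if $\bar A_{ji}\neq0$; a perfect matching covers all vertices. Sequential-pairing: if $M=\{(i_1,j_1),\dots,(i_q,j_q)\}$ is a matching of actuators $i_l$ with sensors $j_l$, the sequential-pairing induced by $M$ is the set of feedback links from sensor $j_{l-1}$ to actuator $i_l$ for $l=2,\dots,q$,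 together with the link from sensor $j_q$ to actuator $i_1$, i.e. $\{(j_{l-1},i_l)\}_{l=2}^q\cup\{(j_q,i_1)\}$ in (sensor, actuator) notation. Procedure 1: Given minimum collections of dedicated actuators and sensors ensuring structural controllability and observability, with actuator label set $\mathcal I_B$ and sensor label set $\mathcal I_C$, assume without loss of generality $|\mathcal I_B|\le|\mathcal I_C|$ (otherwise the roles of actuators and sensors are exchanged). (1) Form the bipartite graph with parts $\mathcal I_B,\mathcal I_C$ and an edge $(i,j)$ whenever there is a directed path from actuator $i$ to sensor $j$ in the system digraph. (2) Take a maximum matching $M^*$. (3) Let $\mathcal K$ be the sequential-pairing induced by $M^*$. (4) Let $\mathcal K'$ consist of the additional feedback links (counted as $|\mathcal I_C|-|\mathcal I_B|$) corresponding to the sensors of $\mathcal I_C$ not present in the edges of $M^*$, each starting in such a sensor and ending in only one of the dedicated actuators. (5) Output $\mathcal K\cup\mathcal K'$.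
   Formalization: In step 4 of Procedure 1 the additional links must also reach every unmatched actuator (or, with roles exchanged, start at every unmatched sensor), as the claim fails otherwise; in the time bound the factor k is read as k+1 and n ≥ 1 is assumed. *)

(* Defs.v *)
From HB Require Import structures.
From mathcomp Require Export all_boot all_order all_algebra.
From mathcomp Require Export complex.
From mathcomp Require Export all_classical all_reals all_analysis.

Set Implicit Arguments.
Unset Strict Implicit.
Unset Printing Implicit Defensive.

Export Order.TTheory GRing.Theory Num.Theory.

Local Open Scope classical_set_scope.
Local Open Scope ring_scope.

(** * Almost all parameters *)

(* [I] indexes the free parameters, so that the parameter space is R^I. A set
   is Lebesgue-null when it has countable covers by closed boxes of arbitrarily
   small total volume. The predicate [D] selects the boxes that are used, so
   that finite and empty covers are allowed (this matters when [I] is empty,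
   where every box has volume 1). *)
Definition lebesgue_null (R : realType) (I : finType) (N : set (I -> R)) : Prop :=
  forall e : R, 0 < e ->
    exists (D : pred nat) (a b : nat -> I -> R),
      [/\ forall q i, a q i <= b q i,
          forall x, N x -> exists2 q, D q & forall i, a q i <= x i <= b q i
        & (\sum_(0 <= q <oo | D q) (\prod_i (b q i - a q i))%:E <= e%:E)%E].

Definition almost_all (R : realType) (I : finType) (P : (I -> R) -> Prop) : Prop :=
  lebesgue_null [set x | ~ P x].

Definition free_entry (m n : nat) (M : 'M[bool]_(m, n)) : finType :=
  {e : 'I_m * 'I_n | M e.1 e.2}.

(* [fill M] is the bijection from R^(free entries of M) onto the set of real
   matrices that vanish wherever [M] does. *)
Definition fill (R : realType) (m n : nat) (M : 'M[bool]_(m, n))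
    (x : free_entry M -> R) : 'M[R]_(m, n) :=
  \matrix_(i, j) if (insub (i, j) : option (free_entry M)) is Some e
                 then x e else 0.

(** * Structural controllability and observability *)

(* State transfer is taken for x(t+1) = A x(t) + B u(t). For a pair of real
   matrices this agrees with controllability of x' = A x + B u. *)
Fixpoint trajectory (R : realType) (n b : nat) (A : 'M[R]_n) (B : 'M[R]_(n, b))
    (u : nat -> 'cV[R]_b) (x0 : 'cV[R]_n) (t : nat) : 'cV[R]_n :=
  if t is s.+1 then A *m trajectory A B u x0 s + B *m u s else x0.

Definition controllable (R : realType) (n b : nat)
    (A : 'M[R]_n) (B : 'M[R]_(n, b)) : Prop :=
  forall x0 x1 : 'cV[R]_n, exists (t : nat) (u : nat -> 'cV[R]_b),
    trajectory A B u x0 t = x1.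

Definition observable (R : realType) (n c : nat)
    (A : 'M[R]_n) (C : 'M[R]_(c, n)) : Prop :=
  forall x0 x1 : 'cV[R]_n,
    (forall t : nat, C *m iter t (mulmx A) x0 = C *m iter t (mulmx A) x1) ->
    x0 = x1.

Definition structurally_controllable (R : realType) (n b : nat)
    (A : 'M[bool]_n) (B : 'M[bool]_(n, b)) : Prop :=
  almost_all (fun x : free_entry A + free_entry B -> R =>
    controllable (fill (x \o inl)) (fill (x \o inr))).

Definition structurally_observable (R : realType) (n c : nat)
    (A : 'M[bool]_n) (C : 'M[bool]_(c, n)) : Prop :=
  almost_all (fun x : free_entry A + free_entry C -> R =>
    observable (fill (x \o inl)) (fill (x \o inr))).

(** * Dedicated actuators and sensors *)

(* A collection of [b] indices in {1..n}, with repetitions, is a function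
   ['I_b -> 'I_n]; the elements of ['I_b] are the labels of its members, and
   cardinalities of sets of labels count multiplicities. *)
Definition actuator_matrix (n b : nat) (iota : 'I_b -> 'I_n) : 'M[bool]_(n, b) :=
  \matrix_(i, l) (i == iota l).

Definition sensor_matrix (n c : nat) (gamma : 'I_c -> 'I_n) : 'M[bool]_(c, n) :=
  \matrix_(s, i) (i == gamma s).

Definition subcollection (n b : nat) (iota : 'I_b -> 'I_n) (S : {set 'I_b}) :
  'I_#|S| -> 'I_n := fun l => iota (enum_val l).
Arguments subcollection {n b} iota S _.

Definition ctrl_dedicated (R : realType) (n b : nat)
    (A : 'M[bool]_n) (iota : 'I_b -> 'I_n) : Prop :=
  structurally_controllable R A (actuator_matrix iota).

Definition obs_dedicated (R : realType) (n c : nat)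
    (A : 'M[bool]_n) (gamma : 'I_c -> 'I_n) : Prop :=
  structurally_observable R A (sensor_matrix gamma).

Definition ctrl_resilient (R : realType) (n : nat) (A : 'M[bool]_n) (k b : nat)
    (iota : 'I_b -> 'I_n) : Prop :=
  forall J : {set 'I_b}, (#|J| <= k)%N ->
    ctrl_dedicated R A (subcollection iota (~: J)%SET).

Definition obs_resilient (R : realType) (n : nat) (A : 'M[bool]_n) (k c : nat)
    (gamma : 'I_c -> 'I_n) : Prop :=
  forall J : {set 'I_c}, (#|J| <= k)%N ->
    obs_dedicated R A (subcollection gamma (~: J)%SET).

Definition minimum_collection (n : nat) (P : forall q, ('I_q -> 'I_n) -> Prop)
    (q : nat) (f : 'I_q -> 'I_n) : Prop :=
  P q f /\ forall (r : nat) (g : 'I_r -> 'I_n), P r g -> (q <= r)%N.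

(* The labels [i * p, ..., i * p + p - 1] of the [i]-th of [q] consecutive
   sub-collections of size [p], counting from 0. *)
Definition block (q p i : nat) : {set 'I_(q * p)} :=
  [set l : 'I_(q * p) | i * p <= l < i.+1 * p]%N%SET.

(** * Structurally resilient fixed modes and the design problem *)

Definition spectrum (R : realType) (n : nat) (M : 'M[R]_n) : set R[i] :=
  [set z | eigenvalue (map_mx (real_complex R : R -> R[i]) M) z].

(* Feedback links are pairs (sensor, actuator), whereas gains have their rows
   indexed by actuators and their columns by sensors. *)
Definition gains (R : realType) (b c : nat) (K J : {set 'I_c * 'I_b}) :
    set 'M[R]_(b, c) :=
  [set G : 'M[R]_(b, c) | forall l s, (s, l) \notin K \/ (s, l) \in J -> G l s = 0].

Definition resilient_fixed_modes (R : realType) (n b c : nat)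
    (A : 'M[bool]_n) (B : 'M[bool]_(n, b)) (C : 'M[bool]_(c, n))
    (K J : {set 'I_c * 'I_b}) : Prop :=
  almost_all (fun x : free_entry A + free_entry B + free_entry C -> R =>
    \bigcap_(G in gains K J)
      spectrum (fill (x \o inl \o inl) + fill (x \o inl \o inr) *m G *m fill (x \o inr))
    !=set0).

Definition sublinks (b c : nat) (SC : {set 'I_c}) (SB : {set 'I_b})
    (K : {set 'I_c * 'I_b}) : {set 'I_#|SC| * 'I_#|SB|} :=
  [set e | (enum_val e.1, enum_val e.2) \in K]%SET.

Definition P2_feasible (R : realType) (n : nat) (A : 'M[bool]_n) (k b c : nat)
    (iota : 'I_b -> 'I_n) (gamma : 'I_c -> 'I_n) (K : {set 'I_c * 'I_b}) : Prop :=
  forall (J : {set 'I_c * 'I_b}) (JB : {set 'I_b}) (JC : {set 'I_c}),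
    J \subset K -> (#|J| + #|JB| + #|JC| <= k)%N ->
    ~ resilient_fixed_modes R A
        (actuator_matrix (subcollection iota (~: JB)%SET))
        (sensor_matrix (subcollection gamma (~: JC)%SET))
        (sublinks (~: JC)%SET (~: JB)%SET K) (sublinks (~: JC)%SET (~: JB)%SET J).

Definition P2_solution (R : realType) (n : nat) (A : 'M[bool]_n) (k b c : nat)
    (iota : 'I_b -> 'I_n) (gamma : 'I_c -> 'I_n) (K : {set 'I_c * 'I_b}) : Prop :=
  P2_feasible R A k iota gamma K /\
  forall (b' c' : nat) (iota' : 'I_b' -> 'I_n) (gamma' : 'I_c' -> 'I_n)
         (K' : {set 'I_c' * 'I_b'}),
    P2_feasible R A k iota' gamma' K' ->
    (b + c + #|K| <= b' + c' + #|K'|)%N.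

(** * Graphs *)

(* A set of edges of a bipartite graph is given by a list, because sequential
   pairing depends on the order in which the edges of a matching are listed. *)
Definition matching (T1 T2 : eqType) (E : T1 -> T2 -> bool) (M : seq (T1 * T2)) : bool :=
  [&& all (fun e => E e.1 e.2) M, uniq (unzip1 M) & uniq (unzip2 M)].

Definition maximum_matching (T1 T2 : eqType) (E : T1 -> T2 -> bool)
    (M : seq (T1 * T2)) : Prop :=
  matching E M /\ forall M', matching E M' -> (size M' <= size M)%N.

Definition state_bipartite (n : nat) (A : 'M[bool]_n) (i j : 'I_n) : bool := A j i.

Definition has_perfect_matching (n : nat) (E : 'I_n -> 'I_n -> bool) : Prop :=
  exists M, [/\ matching E M, forall i, i \in unzip1 M & forall j, j \in unzip2 M].

Definition vertex (n b c : nat) : finType := ('I_n + 'I_b + 'I_c)%type.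
Definition state_vertex {n b c : nat} (i : 'I_n) : vertex n b c := inl (inl i).
Definition actuator_vertex {n b c : nat} (l : 'I_b) : vertex n b c := inl (inr l).
Definition sensor_vertex {n b c : nat} (s : 'I_c) : vertex n b c := inr s.

Definition system_digraph (n b c : nat) (A : 'M[bool]_n) (B : 'M[bool]_(n, b))
    (C : 'M[bool]_(c, n)) : rel (vertex n b c) :=
  fun v w => match v, w with
  | inl (inl i), inl (inl j) => A j i
  | inl (inr l), inl (inl i) => B i l
  | inl (inl i), inr s => C s i
  | _, _ => false
  end.

Definition num_edges (T : finType) (e : rel T) : nat := #|[set x : T * T | e x.1 x.2]%SET|.

(** * Procedure 1 *)

Definition pairing_graph (n b c : nat) (D : rel (vertex n b c))
    (SB : {set 'I_b}) (SC : {set 'I_c}) (i : 'I_b) (j : 'I_c) : bool :=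
  [&& i \in SB, j \in SC & connect D (actuator_vertex i) (sensor_vertex j)].

Definition sequential_pairing (b c : nat) (M : seq ('I_b * 'I_c)) : {set 'I_c * 'I_b} :=
  [set e in zip (unzip2 M) (rot 1 (unzip1 M))]%SET.

(* One end in [S2] for each member of [U1], in such a way that each member of
   [U2] is the end of at least one. With [U1], [U2] the labels left unmatched
   by a maximum matching, the second condition is void if the matching covers
   [S2]; without it, an unmatched actuator (or sensor) could remain without any
   feedback link. *)
Definition completing_ends (T1 T2 : finType) (U1 : {set T1}) (U2 S2 : {set T2})
    (f : T1 -> T2) : Prop :=
  (forall x, x \in U1 -> f x \in S2) /\ U2 \subset (f @: U1)%SET.

Definition additional_links (b c : nat) (SB : {set 'I_b}) (SC : {set 'I_c})
    (M : seq ('I_b * 'I_c)) (K' : {set 'I_c * 'I_b}) : Prop :=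
  let UB := [set i in SB | i \notin unzip1 M]%SET in
  let UC := [set j in SC | j \notin unzip2 M]%SET in
  if (#|SB| <= #|SC|)%N
  then exists2 f : 'I_c -> 'I_b,
         completing_ends UC UB SB f & K' = [set (j, f j) | j in UC]%SET
  else exists2 g : 'I_b -> 'I_c,
         completing_ends UB UC SC g & K' = [set (g i, i) | i in UB]%SET.

(* The procedure is nondeterministic: [procedure1 D SB SC K] says that [K] is
   one of its outputs. *)
Definition procedure1 (n b c : nat) (D : rel (vertex n b c))
    (SB : {set 'I_b}) (SC : {set 'I_c}) (K : {set 'I_c * 'I_b}) : Prop :=
  exists (M : seq ('I_b * 'I_c)) (K' : {set 'I_c * 'I_b}),
    [/\ maximum_matching (pairing_graph D SB SC) M,
        additional_links SB SC M K'
      & K = (sequential_pairing M :|: K')%SET].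

(** * Random access machines *)

(* Unit-cost programs over registers and arrays of natural numbers, with
   addition and truncated subtraction as the only arithmetic. Register and
   array names are constants of the program, so a program uses finitely many
   arrays (which could be interleaved in a single memory). *)
Inductive program : Type :=
| Skip
| Const (x v : nat)               (* x := v *)
| Add (x y z : nat)               (* x := y + z *)
| Monus (x y z : nat)             (* x := y - z *)
| Get (x a y : nat)               (* x := a[y] *)
| Put (a x y : nat)               (* a[x] := y *)
| Seq (p q : program)
| If (x : nat) (p q : program)    (* if x <> 0 then p else q *)
| While (x : nat) (p : program).  (* while x <> 0 do p *)

Record state : Type := State { reg : nat -> nat; arr : nat -> nat -> nat }.

Definition set_reg (s : state) (x v : nat) : state :=
  State (fun y => if y == x then v else reg s y) (arr s).

Definition set_arr (s : state) (a i v : nat) : state :=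
  State (reg s) (fun a' i' => if (a' == a) && (i' == i) then v else arr s a' i').

(* [exec p s t s']: started in [s], [p] halts in [s'] after [t] steps. *)
Inductive exec : program -> state -> nat -> state -> Prop :=
| ExecSkip s : exec Skip s 1 s
| ExecConst x v s : exec (Const x v) s 1 (set_reg s x v)
| ExecAdd x y z s : exec (Add x y z) s 1 (set_reg s x (reg s y + reg s z)%N)
| ExecMonus x y z s : exec (Monus x y z) s 1 (set_reg s x (reg s y - reg s z)%N)
| ExecGet x a y s : exec (Get x a y) s 1 (set_reg s x (arr s a (reg s y)))
| ExecPut a x y s : exec (Put a x y) s 1 (set_arr s a (reg s x) (reg s y))
| ExecSeq p q s1 t1 s2 t2 s3 :
    exec p s1 t1 s2 -> exec q s2 t2 s3 -> exec (Seq p q) s1 (t1 + t2)%N s3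
| ExecIfTrue x p q s t s' :
    reg s x != 0%N -> exec p s t s' -> exec (If x p q) s t.+1 s'
| ExecIfFalse x p q s t s' :
    reg s x = 0%N -> exec q s t s' -> exec (If x p q) s t.+1 s'
| ExecWhileTrue x p s1 t1 s2 t2 s3 :
    reg s1 x != 0%N -> exec p s1 t1 s2 -> exec (While x p) s2 t2 s3 ->
    exec (While x p) s1 (t1 + t2).+1 s3
| ExecWhileFalse x p s : reg s x = 0%N -> exec (While x p) s 1 s.

(* Compressed sparse column format, that is, the adjacency lists of the digraph
   of [A]: the [j]-th list contains the [i] with [A i j] nonzero. *)
Definition columns (n : nat) (A : 'M[bool]_n) : seq (seq nat) :=
  [seq [seq val i | i <- enum 'I_n & A i j] | j <- enum 'I_n].

Definition column_starts (n : nat) (A : 'M[bool]_n) : seq nat :=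
  [seq sumn (take j (shape (columns A))) | j <- seq.iota 0 n.+1].

Definition input_state (n : nat) (A : 'M[bool]_n) (k : nat) : state :=
  State (nth 0%N [:: n; k])
        (fun a => nth 0%N (nth [::] [:: column_starts A; flatten (columns A)] a)).

(* The numbers of actuators, sensors and links are left in registers 0, 1 and
   2, the two collections in arrays 2 and 3, and the links, in any order and
   without repetition, in arrays 4 (sensors) and 5 (actuators). *)
Definition output_state (n b c : nat) (iota : 'I_b -> 'I_n) (gamma : 'I_c -> 'I_n)
    (K : {set 'I_c * 'I_b}) (s : state) : Prop :=
  [/\ [/\ reg s 0 = b, reg s 1 = c & reg s 2 = #|K|],
      forall l : 'I_b, arr s 2 l = iota l,
      forall j : 'I_c, arr s 3 j = gamma j
    & perm_eq [seq (arr s 4 q, arr s 5 q) | q <- seq.iota 0 #|K|]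
              [seq (val e.1, val e.2) | e <- enum K]].

(* Main.v *)
(* A perfect matching of [B(A)] is a permutation of the states along edges.
   Giving its cycles distinct moduli produces a matrix in [A] whose modes are
   all excited once every state is reached from an actuator. As zero sets of
   nonzero polynomials are null, structural controllability is therefore
   reachability. For the same reason a design has no resilient fixed modes if
   its links make the digraph strongly connected: a mode common to [A] and to
   its perturbation along one link is not excited or not seen by that link.

   Conversely, a source component without incoming links yields fixed modes, so
   each of the [p] source components needs [k+1] actuators and [k+1] incoming
   links, and dually for the [m] sink components. A design thus has at least
   [(k+1)p] actuators, [(k+1)m] sensors and [(k+1)max(p,m)] links. Procedure 1
   attains these numbers, because each block makes the digraph strongly
   connected on its own and [k] failures leave some block intact.

   A linear-time program finds one state in each source component with two
   passes of depth-first search, does the same for the sinks, and matches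
   greedily: it is enough that each unmatched source (sink) reaches (is reached
   from) a matched sink (source). *)

Require Import Defs.
From mathcomp Require Import all_boot all_order all_algebra.
From mathcomp Require Import fingroup perm.
From mathcomp Require Import all_classical all_reals all_analysis.
From mathcomp Require Import measurable_realfun.
From mathcomp Require Import ring lra zify.
Import Order.TTheory GRing.Theory Num.Theory.

Set Implicit Arguments.
Unset Strict Implicit.
Unset Printing Implicit Defensive.

Local Open Scope classical_set_scope.
Local Open Scope ring_scope.

(** * Null sets and polynomials *)

(** Genericity is reduced to the nonvanishing of one polynomial function. The determinant of the
    Gramian [gram A B] is one for any number of inputs, and [pbh] translates its nonvanishing into a
    statement about complex left eigenvectors; a single good matrix then settles almost all of them.
    As null sets are defined by box covers, two facts carry the measure theory: zero sets can be
    covered cheaply, and boxes cannot.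

    The good matrix grows by one cycle at a time. Distinct moduli prevent resonance: a mode of the
    cycle just attached is not a mode of the part already built, so that part must respond to it,
    and the response shows at a root.

    For fixed modes the obstacle is that the common mode may depend on the parameters. Hence a gain
    [K0] is chosen once, for one good closed-loop matrix, and only [A], [B], [C] vary afterwards.
    Excitation by an actuator and visibility at a sensor come from different matrices; multiplying
    the two determinants merges them.

    Running times are proved with credits, so that one invariant yields both the termination and the
    cost of a loop. *)

Section NonNull.
Context {R : realType} {I : finType}.

(** Induction on the coordinates. The boxes whose [i]-th side contains [t] cover the slice at [t];
    integrating the resulting bound over [t] gives the product, and series and integral may be
    exchanged because all terms are nonnegative. *)
Lemma box_cover_volume (u v : I -> R) (s : seq I) (D : pred nat) (a b : nat -> I -> R) :
  (forall i, u i < v i) -> (forall q i, a q i <= b q i) -> uniq s ->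
  (forall x : I -> R, (forall i, i \in s -> u i <= x i <= v i) ->
    exists2 q, D q & forall i, i \in s -> a q i <= x i <= b q i) ->
  ((\prod_(i <- s) (v i - u i))%:E <=
   \sum_(0 <= q <oo | D q) (\prod_(i <- s) (b q i - a q i))%:E)%E.
Proof.
move=> uv ab; elim: s D => [|i s IH] D /=.
  (* With no coordinate left every volume is the empty product 1, and the cover contains at least
     one box. *)
  move=> _ /(_ u) [] // q Dq _; rewrite big_nil.
  under eq_eseriesr do rewrite big_nil.
  apply: (le_trans _ (nneseries_lim_ge q.+1 _)) => //.
  rewrite big_mkcond big_nat_recr //= Dq leeDr //.
  by apply: sume_ge0 => j _; case: ifP.
move=> /andP[is_s us] cov.
have vol0 (q : nat) : 0 <= \prod_(j <- s) (b q j - a q j).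
  by apply: prodr_ge0 => j _; rewrite subr_ge0.
(* The volume of the slice of box [q] at [t], or 0 if the slice is empty or the box is not
   selected. *)
pose f (q : nat) (t : R) : \bar R := if D q then
  ((\prod_(j <- s) (b q j - a q j))%:E * (\1_(`[a q i, b q i]%classic) t)%:E)%E else 0%E.
have f0 q t : (0 <= f q t)%E.
  by rewrite /f; case: ifP => // _; rewrite mule_ge0// lee_fin // indicE.
have mf q : measurable_fun [set: R] (f q).
  rewrite /f; case: (D q) => //; apply: measurable_funeM.
  by apply/measurable_EFinP; apply: measurable_indic.
have key t : t \in `[u i, v i] ->
    ((\prod_(j <- s) (v j - u j))%:E <= \sum_(0 <= q <oo) f q t)%E.
  move=> tuv; rewrite (_ : (\sum_(0 <= q <oo) f q t)%E =
      \sum_(0 <= q <oo | D q && (a q i <= t <= b q i)%R) (\prod_(j <- s) (b q j - a q j))%:E)%E.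
    apply: IH => // x xs.
    have [|q Dq xq] := cov (fun j => if j == i then t else x j).
      move=> j; rewrite inE; case: (eqVneq j i) => [-> _|_ /=]; first by rewrite in_itv in tuv.
      exact: xs.
    exists q.
      by rewrite Dq /=; have := xq i; rewrite mem_head eqxx; apply.
    move=> j js; have := xq j; rewrite inE js orbT.
    case: eqVneq => [ji|_]; last by apply.
    by move: is_s; rewrite -ji js.
  rewrite [RHS]eseries_mkcond; apply: eq_eseriesr => q _.
  rewrite /f; case: (D q) => //=; rewrite indicE mem_setE in_itv /=.
  by case: (_ && _) => /=; rewrite ?mule1 ?mule0.
have mS : measurable_fun [set: R] (fun t => \sum_(0 <= q <oo) f q t)%E.
  exact: (@ge0_emeasurable_sum _ _ _ _ f xpredT (fun k x _ _ => f0 k x) (fun k _ => mf k)).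
have H : (\int[@lebesgue_measure R]_(t in `[u i, v i]) (cst (\prod_(j <- s) (v j - u j))%:E) t <=
    \int[@lebesgue_measure R]_(t in `[u i, v i]) \sum_(0 <= q <oo) f q t)%E.
  apply: ge0_le_integral => //.
  - by move=> t _; rewrite lee_fin; apply: prodr_ge0 => j _; rewrite subr_ge0 ltW.
  - exact: measurable_funTS mS.
rewrite integral_cst//= lebesgue_measure_itv /= lte_fin uv -EFinD -EFinM in H.
rewrite integral_nneseries// in H; last first.
  by move=> q; apply: measurable_funTS; exact: mf.
rewrite big_cons mulrC; apply: (le_trans H).
rewrite [leRHS]eseries_mkcond; apply: lee_nneseries => // q _.
  by move=> _; apply: integral_ge0.
rewrite /f; case: (D q); last by rewrite integral0.
rewrite ge0_integralZl//; last by rewrite lee_fin.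
- rewrite integral_indic// big_cons mulrC EFinM; apply: lee_pmul => //.
    by rewrite lee_fin.
  apply: (@le_trans _ _ (lebesgue_measure (`[a q i, b q i]%classic : set R))).
    apply: le_measure; rewrite ?inE//.
    by have := @measurableI _ (measurableTypeR R) _ _ (measurable_itv `[a q i, b q i]) (measurable_itv `[u i, v i]).
  rewrite lebesgue_measure_itv /= lte_fin; case: ifP => _ //.
  by rewrite lee_fin subr_ge0.
- by apply: measurable_funTS; apply/measurable_EFinP; apply: measurable_indic.
Qed.

Lemma box_not_null (u v : I -> R) (N : set (I -> R)) :
  (forall i, u i < v i) -> (forall x, (forall i, u i <= x i <= v i) -> N x) ->
  ~ lebesgue_null N.
Proof.
move=> uv sub nul.
have vol0 : 0 < \prod_i (v i - u i) by apply: prodr_gt0 => i _; rewrite subr_gt0.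
have [|D [a [b [ab cov le]]]] := nul ((\prod_i (v i - u i)) / 2); first by rewrite divr_gt0.
have := @box_cover_volume u v (index_enum I) D a b uv ab (index_enum_uniq _) _.
move=> /(_ _)/le_trans/(_ le); rewrite lee_fin => H; suff : false by [].
have : \prod_i (v i - u i) <= (\prod_i (v i - u i)) / 2.
  apply: H => x xs; have [|q Dq xq] := cov x; last by exists q.
  by apply: sub => i; apply: xs; rewrite mem_index_enum.
by lra.
Qed.

Lemma null_empty (N : set (I -> R)) : (forall x, ~ N x) -> lebesgue_null N.
Proof.
move=> N0 e e0; exists pred0, (fun _ _ => 0), (fun _ _ => 0); split=> //.
- by move=> x /N0.
- by rewrite eseries0 // lee_fin ltW.
Qed.

Lemma null_subset (N N' : set (I -> R)) : N `<=` N' -> lebesgue_null N' -> lebesgue_null N.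
Proof.
move=> NN nul e /nul[D [a [b [ab cov le]]]]; exists D, a, b; split=> // x /NN; exact: cov.
Qed.

End NonNull.

(** A supremum argument: the points [t] with [P a t] accumulate at their supremum, and the local
    property there carries them past it unless it is [b]. This takes the place of compactness, with
    a radius [d] that may depend on the point. *)
Lemma cousin (R : realType) (P : R -> R -> Prop) (a b : R) :
  a <= b ->
  (forall u v w, u <= v <= w -> P u v -> P v w -> P u w) ->
  (forall y, a <= y <= b -> exists2 d, 0 < d &
     forall u v, a <= u <= y -> y <= v <= b -> v - u < d -> P u v) ->
  P a b.
Proof.
move=> ab Padd Ploc.
pose E := [set t | a <= t <= b /\ P a t].
have Ea : E a.
  split; first by rewrite lexx.
  by have [|d d0 H] := Ploc a; [rewrite lexx|apply: H; rewrite ?lexx// subrr].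
have ubE : ubound E b by move=> t [/andP[]].
have supE : has_sup E by split; [exists a|exists b].
have as_ : a <= sup E by apply: ub_le_sup => //; exists b.
have sb : sup E <= b by apply: sup_le_ub => //; exists a.
have [|d d0 H] := Ploc (sup E); first by rewrite as_ sb.
have [t Et ts] := sup_adherent d0 supE.
have tle : t <= sup E by apply: ub_le_sup => //; exists b.
case: (Et) => /andP[at_ tb] Pat.
have [bd|bd] := leP b (sup E + (d - (sup E - t)) / 2).
  apply: (Padd a t b); rewrite ?at_ ?tb//; apply: H; rewrite ?at_ ?tle ?lexx ?sb//.
  by move: ts bd; lra.
exfalso; have : E (sup E + (d - (sup E - t)) / 2).
  have le1 : sup E <= sup E + (d - (sup E - t)) / 2 by move: ts; lra.
  split; first by rewrite (le_trans as_ le1) ltW.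
  apply: (Padd a t); rewrite ?at_ ?(le_trans tle le1)//.
  by apply: H; rewrite ?at_ ?tle ?le1 ?(ltW bd)//; move: ts; lra.
move=> /(ub_le_sup (ex_intro _ b ubE)).
by move: ts; lra.
Qed.

(** Polynomial functions are given as a closure: what is needed of them, restrictions to lines and
    Lipschitz bounds on cubes, follows by induction on this predicate. *)
Inductive pfun (R : realType) (I : Type) : ((I -> R) -> R) -> Prop :=
| pfun_cst c : pfun (fun=> c)
| pfun_var i : pfun (fun x => x i)
| pfun_add F G : pfun F -> pfun G -> pfun (fun x => F x + G x)
| pfun_mul F G : pfun F -> pfun G -> pfun (fun x => F x * G x).

Section PFun.
Context {R : realType} {I : Type}.
Implicit Types (F G : (I -> R) -> R).

Lemma pfun_sum (J : Type) (s : seq J) (P : pred J) (F : J -> (I -> R) -> R) :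
  (forall j, pfun (F j)) -> pfun (fun x => \sum_(j <- s | P j) F j x).
Proof.
move=> pF; elim: s => [|j s IH].
  by under eq_fun do rewrite big_nil; exact: pfun_cst.
under eq_fun do rewrite big_cons.
by case: (P j) => //; exact: pfun_add.
Qed.

Lemma pfun_prod (J : Type) (s : seq J) (P : pred J) (F : J -> (I -> R) -> R) :
  (forall j, pfun (F j)) -> pfun (fun x => \prod_(j <- s | P j) F j x).
Proof.
move=> pF; elim: s => [|j s IH].
  by under eq_fun do rewrite big_nil; exact: pfun_cst.
under eq_fun do rewrite big_cons.
by case: (P j) => //; exact: pfun_mul.
Qed.

Lemma pfun_line F : pfun F -> forall x v : I -> R, exists p : {poly R},
  forall t, F (fun i => x i + t * v i) = p.[t].
Proof.
elim=> [c|i|F1 F2 _ IH1 _ IH2|F1 F2 _ IH1 _ IH2] x v.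
- by exists c%:P => t; rewrite hornerC.
- by exists ((x i)%:P + 'X * (v i)%:P) => t; rewrite !hornerE.
- have [p Hp] := IH1 x v; have [q Hq] := IH2 x v.
  by exists (p + q) => t; rewrite hornerD Hp Hq.
- have [p Hp] := IH1 x v; have [q Hq] := IH2 x v.
  by exists (p * q) => t; rewrite hornerM Hp Hq.
Qed.

(* Restrict both to the line through the two witnesses. *)
Lemma pfun_mul_neq0 F G : pfun F -> pfun G -> forall x y : I -> R,
  F x != 0 -> G y != 0 -> exists z, F z * G z != 0.
Proof.
move=> pF pG x y Fx Gy.
have [p Hp] := pfun_line (pfun_mul pF (pfun_cst _ 1)) x (fun i => y i - x i).
have [q Hq] := pfun_line pG x (fun i => y i - x i).
have p0 : p != 0.
  apply: contra Fx => /eqP p0; have := Hp 0; rewrite p0 horner0 mulr1.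
  by under eq_fun do rewrite mul0r addr0; move=> ->.
have q0 : q != 0.
  apply: contra Gy => /eqP q0; have := Hq 1; rewrite q0 horner0.
  by under eq_fun do rewrite mul1r subrKC; move=> ->.
(* A nonzero polynomial has fewer roots than its size, so one of the natural numbers below that size
   is not a root. *)
have [t Ht] : exists t, (p * q).[t] != 0.
  apply: contrapT => H.
  have := @max_poly_roots _ (p * q) [seq n%:R | n <- iota 0 (size (p * q))].
  rewrite mulf_neq0// size_map size_iota ltnn => /(_ isT); apply: contraPP => _ H'.
  suff : false by [].
  apply: H' => //.
    apply/allP => t _; apply/rootP; apply: contrapT => /eqP Ht; apply: H; by exists t.
  by rewrite map_inj_uniq ?iota_uniq//; exact: (mulrIn (oner_neq0 R)).
exists (fun i => x i + t * (y i - x i)).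
by have := Hp t; rewrite mulr1 => ->; rewrite Hq -hornerM.
Qed.

(** The bound [M] on values is carried along for products, where the difference splits into a
    difference of each factor times a value of the other. *)
Lemma pfun_lipschitz F (N : R) : pfun F -> exists L M : R, [/\ 0 <= L, 0 <= M,
  forall x, (forall i, `|x i| <= N) -> `|F x| <= M &
  forall x y d, (forall i, `|x i| <= N) -> (forall i, `|y i| <= N) ->
    0 <= d -> (forall i, `|x i - y i| <= d) -> `|F x - F y| <= L * d].
Proof.
elim=> [c|i|F1 F2 _ [L1 [M1 [L10 M10 B1 D1]]] _ [L2 [M2 [L20 M20 B2 D2]]]
  |F1 F2 _ [L1 [M1 [L10 M10 B1 D1]]] _ [L2 [M2 [L20 M20 B2 D2]]]].
- by exists 0, `|c|; split=> // x y d _ _ _ _; rewrite subrr normr0 mul0r.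
- exists 1, `|N|; split=> //.
    by move=> x /(_ i) H; exact: le_trans H (ler_norm _).
  by move=> x y d _ _ _ /(_ i); rewrite mul1r.
- exists (L1 + L2), (M1 + M2); split; rewrite ?addr_ge0//.
    by move=> x xN; rewrite (le_trans (ler_normD _ _))// lerD ?B1 ?B2.
  move=> x y d xN yN d0 xy; rewrite opprD addrACA mulrDl (le_trans (ler_normD _ _))// lerD ?D1 ?D2//.
- exists (M1 * L2 + M2 * L1), (M1 * M2); split.
  + by rewrite addr_ge0 ?mulr_ge0.
  + by rewrite mulr_ge0.
  + by move=> x xN; rewrite normrM ler_pM ?B1 ?B2.
  + move=> x y d xN yN d0 xy.
    rewrite (_ : _ - _ = F1 x * (F2 x - F2 y) + F2 y * (F1 x - F1 y)); last by ring.
    rewrite (le_trans (ler_normD _ _))// mulrDl -!mulrA !normrM lerD//.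
      by rewrite ler_pM ?B1 ?D2.
    by rewrite ler_pM ?B2 ?D1.
Qed.

End PFun.

Lemma poly_zeros_finite (R : idomainType) (p : {poly R}) :
  p != 0 -> exists s : seq R, forall t, p.[t] = 0 -> t \in s.
Proof.
have [n] := ubnP (size p); elim: n p => // n IH p /ltnSE sp p0.
have [[t pt]|H] := pselect (exists t, root p t); last first.
  by exists [::] => t /rootP pt; case: H; exists t.
have /factor_theorem[q pq] := pt.
have q0 : q != 0 by apply: contra p0 => /eqP q0; rewrite pq q0 mul0r.
have [|s Hs] := IH q _ q0.
  by rewrite (leq_trans _ sp)// pq size_Mmonic ?monicXsubC// size_XsubC addn2.
exists (t :: s) => r; rewrite pq hornerM hornerXsubC inE => /eqP.
by rewrite mulf_eq0 subr_eq0 => /orP[/eqP/Hs->|->]; rewrite ?orbT.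
Qed.

Lemma count_strict (T : eqType) (s : seq T) (P Q : pred T) (y : T) :
  (forall x, P x -> Q x) -> y \in s -> Q y -> ~~ P y -> (count P s < count Q s)%N.
Proof.
move=> PQ; elim: s => //= x s IH; rewrite inE => /orP[/eqP <-|ys] Qy Py.
  by rewrite Qy (negbTE Py) add0n add1n ltnS; apply: sub_count.
have := IH ys Qy Py; have := PQ x.
by case: (P x) => [->|_]//; rewrite ?ltn_add2l// => H; rewrite ltn_addl.
Qed.

(** * Zero sets of polynomial functions are null *)

Section Null.
Context {R : realType} {I : finType}.
Implicit Types (F : (I -> R) -> R) (s : seq I).

Definition in_box s (B : (I -> R) * (I -> R)) (y : I -> R) : Prop :=
  forall i, i \in s -> B.1 i <= y i <= B.2 i.

Definition box_volume s (B : (I -> R) * (I -> R)) : R :=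
  \prod_(i <- s) (B.2 i - B.1 i).

Definition proper_box (B : (I -> R) * (I -> R)) : Prop := forall i, B.1 i <= B.2 i.

Lemma box_volume_ge0 s B : proper_box B -> 0 <= box_volume s B.
Proof. by move=> pB; apply: prodr_ge0 => i _; rewrite subr_ge0. Qed.

Definition upd (x : I -> R) (i : I) (t : R) : I -> R :=
  fun j => if j == i then t else x j.

Lemma upd_line (x : I -> R) i t :
  upd x i t = (fun j => upd x i 0 j + t * (j == i)%:R).
Proof.
by apply/funext => j; rewrite /upd; case: eqP => _; rewrite ?mulr1 ?add0r ?mulr0 ?addr0.
Qed.

Lemma box_volume_upd s B i u v : i \notin s ->
  box_volume s (upd B.1 i u, upd B.2 i v) = box_volume s B.
Proof.
move=> si; apply: eq_big_seq => j js; rewrite /= /upd.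
by case: eqP => // ji; rewrite -ji js in si.
Qed.

(* Sublevel sets, unlike zero sets, are controlled uniformly near each value of
   the last coordinate, which is what Cousin's lemma needs. *)
Lemma sublevel_cover F (N : R) s : pfun F -> 0 <= N -> uniq s ->
  forall x z : I -> R, (forall i, i \notin s -> z i = x i) -> F z != 0 ->
  (forall i, `|x i| <= N) -> forall e : R, 0 < e ->
  exists (h : R) (Bs : seq ((I -> R) * (I -> R))),
  [/\ 0 < h, forall B, B \in Bs -> proper_box B,
    forall y, (forall i, i \notin s -> y i = x i) -> (forall i, `|y i| <= N) ->
      `|F y| <= h -> exists2 B, B \in Bs & in_box s B y
  & \sum_(B <- Bs) box_volume s B <= e].
Proof.
move=> pF N0; elim: s => [_|i s IH /= /andP[is_s us]] x z zx Fz xN e e0.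
  exists (`|F x| / 2), [::]; have zx' : z = x by apply/funext => i; exact: zx.
  rewrite zx' in Fz; have Fx : 0 < `|F x| by rewrite normr_gt0.
  split=> //; first by rewrite divr_gt0.
    move=> y yx _; rewrite (_ : y = x); first by move: Fx; lra.
    by apply/funext => i; exact: yx.
  by rewrite big_nil ltW.
have [L [M [L0 _ _ lip]]] := pfun_lipschitz N pF.
have [p Hp] := pfun_line pF (upd z i 0) (fun j => (j == i)%:R).
have {}Hp t : F (upd z i t) = p.[t] by rewrite upd_line.
have p0 : p != 0.
  apply: contra Fz => /eqP p0; have := Hp (z i); rewrite p0 horner0 => <-.
  by apply/eqP; congr F; apply/funext => j; rewrite /upd; case: eqP => // ->.
(* The values of coordinate [i] at which [F] vanishes on the line through [z]. At any other value
   the induction hypothesis applies, with [z] moved into the slice. *)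
have [bad badP] := poly_zeros_finite p0.
(* Half of [e] is spent evenly, at rate [e1], along an interval of length [2 * N], and half on the
   bad values, with at most two units [e2] for each. The added 1 avoids division by 0. *)
pose e1 := e / (2 * (2 * N + 1)); pose e2 := e / (2 * (2 * (size bad)%:R + 1)).
have e10 : 0 < e1 by rewrite divr_gt0 ?mulr_gt0// ltr_pwDr// mulr_ge0.
have e20 : 0 < e2 by rewrite divr_gt0 ?mulr_gt0// ltr_pwDr// mulr_ge0.
(* Each bad value raises [w] twice, on arrival and on departure, so that an interval which merely
   has it as an endpoint still gains 1. This is [wjump]. *)
pose w t : R := (count [pred r | r < t] bad + count [pred r | r <= t] bad)%:R.
have wmono u v : u <= v -> w u <= w v.
  move=> uv; rewrite ler_nat leq_add//; apply: sub_count => r /=.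
    by move=> /lt_le_trans; apply.
  by move=> /le_trans; apply.
have wjump u v y : u <= y -> y <= v -> u < v -> y \in bad -> w u + 1 <= w v.
  move=> uy yv uv yb; rewrite natr1 ler_nat.
  have [uy'|yu] := ltP u y.
    rewrite -addnS leq_add//; first by apply: sub_count => r /= /lt_trans; apply.
    apply: (@count_strict _ _ _ _ y) => //=; last by rewrite -ltNge.
    by move=> r /le_trans; apply; exact: ltW.
  rewrite -addSn leq_add//; last by apply: sub_count => r /= /le_trans; apply; exact: ltW.
  apply: (@count_strict _ _ _ _ y) => //=; last by rewrite -leNgt.
    by move=> r /lt_trans; apply.
  exact: le_lt_trans yu uv.
pose G t : R := e1 * t + e2 * w t.
(* The slab between [u] and [v] is to be covered within the budget [G v - G u], which is additive as
   [cousin] requires. *)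
pose P u v := exists (h : R) (Bs : seq ((I -> R) * (I -> R))),
  [/\ 0 < h, forall B, B \in Bs -> proper_box B,
    forall y, (forall j, j \notin i :: s -> y j = x j) -> (forall j, `|y j| <= N) ->
      u <= y i <= v -> `|F y| <= h -> exists2 B, B \in Bs & in_box (i :: s) B y
  & \sum_(B <- Bs) box_volume (i :: s) B <= G v - G u].
have : P (- N) N.
  apply: cousin.
  - by rewrite ge0_cp.
  - move=> u v t /andP[uv vt] [h1 [B1 [h10 pB1 cov1 le1]]] [h2 [B2 [h20 pB2 cov2 le2]]].
    exists (Num.min h1 h2), (B1 ++ B2); split.
    + by rewrite lt_min h10.
    + by move=> B; rewrite mem_cat => /orP[/pB1|/pB2].
    + move=> y yx yN /andP[uy yt]; rewrite le_min => /andP[F1 F2].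
      have [yv|vy] := leP (y i) v.
        by have [|B BB inB] := cov1 y yx yN _ F1; [rewrite uy|exists B; rewrite ?mem_cat ?BB].
      by have [|B BB inB] := cov2 y yx yN _ F2; [rewrite ltW|exists B; rewrite ?mem_cat ?BB ?orbT].
    + by rewrite big_cat /=; move: le1 le2; lra.
  - move=> y0 /andP[y0N y0N'].
    have y0N'' : `|y0| <= N by rewrite ler_norml y0N.
    have [badp|good] := eqVneq p.[y0] 0; last first.
      have [|||h0 [Bs0 [h00 pB0 cov0 le0]]] :=
          IH us (upd x i y0) (upd z i y0) _ _ _ e1 e10.
      + move=> j js; rewrite /upd; case: eqP => // /eqP ji; apply: zx.
        by rewrite inE negb_or ji.
      + by rewrite Hp.
      + by move=> j; rewrite /upd; case: eqP.
      (* Thickening a good slice: moving coordinate [i] by less than this changes [F] by at most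
         [h0 / 2], so a point with [|F| <= h0 / 2] projects into the cover of the slice. *)
      exists (h0 / (2 * (L + 1))); first by rewrite divr_gt0// mulr_gt0// ltr_pwDr.
      move=> u v /andP[uN uy0] /andP[y0v vN] uvd.
      have uv : u <= v by exact: le_trans uy0 y0v.
      exists (h0 / 2), [seq (upd B.1 i u, upd B.2 i v) | B <- Bs0]; split.
      + by rewrite divr_gt0.
      + move=> _ /mapP[B BB ->] j /=; rewrite /upd; case: eqP => // _; exact: pB0.
      + move=> y yx yN /andP[uy yv] Fy.
        have dF : `|F (upd y i y0) - F y| <= L * (v - u).
          apply: lip => //; rewrite ?subr_ge0// => j; rewrite /upd.
            by case: eqP.
          case: eqP => [->|_]; last by rewrite subrr normr0 subr_ge0.
          by rewrite ler_norml; apply/andP; split; lra.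
        have LL : L * (v - u) <= h0 / 2.
          rewrite (@le_trans _ _ ((L + 1) * (h0 / (2 * (L + 1)))))//.
            by rewrite ler_pM ?subr_ge0// ?ltW// ltrDl.
          have L1 : L + 1 != 0 by rewrite gt_eqF// ltr_pwDr.
          by rewrite le_eqVlt; apply/orP; left; apply/eqP; field.
        have Fy' : `|F (upd y i y0)| <= h0.
          have := ler_normD (F (upd y i y0) - F y) (F y); rewrite subrK.
          by move: dF LL Fy; lra.
        have [||B BB inB] := cov0 (upd y i y0) _ _ Fy'.
        * move=> j js; rewrite /upd; case: eqP => // /eqP ji; apply: yx.
          by rewrite inE negb_or ji.
        * by move=> j; rewrite /upd; case: eqP.
        exists (upd B.1 i u, upd B.2 i v); first by apply/mapP; exists B.
        move=> j; rewrite inE /= /upd; case: eqP => [-> _|_ /= js]; first by rewrite uy.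
        by have := inB j js; rewrite /upd; case: eqP => // ji; rewrite -ji js in is_s.
      + rewrite big_map (eq_bigr (fun B => (v - u) * box_volume s B)); last first.
          move=> B _; rewrite {1}/box_volume big_cons /= /upd eqxx; congr (_ * _).
          exact: box_volume_upd.
        rewrite -mulr_sumr /G.
        have := wmono _ _ uv; rewrite -(ler_pM2l e20).
        have : (v - u) * (\sum_(B <- Bs0) box_volume s B) <= (v - u) * e1.
          by rewrite ler_wpM2l// subr_ge0.
        by lra.
    (* At a bad value the whole slab over the cube is taken as one box. Once the slab is thin its
       volume is at most [e2], and the jump of [w] pays for it. *)
    have V0 : 0 <= (2 * N) ^+ size s by rewrite exprn_ge0// mulr_ge0.
    exists (e2 / ((2 * N) ^+ size s + 1)); first by rewrite divr_gt0// ltr_pwDr.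
    move=> u v /andP[uN uy0] /andP[y0v vN] uvd.
    have uv : u <= v by exact: le_trans uy0 y0v.
    exists 1, [:: (upd (fun=> - N) i u, upd (fun=> N) i v)]; split=> //.
    + move=> B; rewrite inE => /eqP -> j /=; rewrite /upd; case: eqP => // _.
      by rewrite ge0_cp.
    + move=> y yx yN uyv _; exists (upd (fun=> - N) i u, upd (fun=> N) i v); rewrite ?inE//.
      move=> j _ /=; rewrite /upd; case: eqP => [->//|_].
      by rewrite -ler_norml.
    + rewrite big_seq1 {1}/box_volume big_cons /= {1 2}/upd eqxx.
      rewrite [X in _ * X](_ : _ = (2 * N) ^+ size s); last first.
        rewrite (eq_big_seq (fun=> 2 * N)) ?big_const_seq ?count_predT; last first.
          move=> j js; rewrite /upd; case: eqP => [ji|_]; first by rewrite -ji js in is_s.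
          by rewrite opprK mulr2n mulrDl mul1r.
        by elim: (size s) => //= m ->; rewrite exprS.
      move: uv; rewrite le_eqVlt => /orP[/eqP uv|uv]; first by rewrite uv !subrr mul0r.
      have := wjump _ _ _ uy0 y0v uv (badP _ badp).
      rewrite -(ler_pM2l e20) mulrDr mulr1 /G.
      have : (v - u) * (2 * N) ^+ size s <= e2.
        rewrite (@le_trans _ _ (e2 / ((2 * N) ^+ size s + 1) * ((2 * N) ^+ size s + 1)))//.
          by rewrite ler_pM ?subr_ge0// ?ltW// ltrDl.
        by rewrite divfK// gt_eqF// ltr_pwDr.
      have : e1 * u <= e1 * v by rewrite ler_pM2l// ltW.
      by lra.
move=> [h [Bs [h0 pB cov le1]]]; exists h, Bs; split=> //.
  move=> y yx yN Fy; apply: cov => //.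
  by rewrite -ler_norml.
rewrite (le_trans le1)// /G.
have w0 : 0 <= w (- N) by rewrite ler0n.
have wN : w N <= 2 * (size bad)%:R.
  by rewrite -natrM ler_nat mul2n -addnn leq_add// count_size.
have : e2 * w N <= e2 * (2 * (size bad)%:R) by rewrite ler_pM2l.
have : 0 <= e2 * w (- N) by rewrite mulr_ge0// ltW.
have : e1 * (2 * N) <= e / 2.
  have N1 : 2 * N + 1 != 0 by rewrite gt_eqF// ltr_pwDr// mulr_ge0.
  have -> : e / 2 = e1 * (2 * N + 1) by rewrite /e1; field.
  by rewrite ler_pM2l// lerDl.
have : e2 * (2 * (size bad)%:R) <= e / 2.
  have N1 : 2 * (size bad)%:R + 1 != 0 :> R by rewrite gt_eqF// ltr_pwDr// mulr_ge0.
  have -> : e / 2 = e2 * (2 * (size bad)%:R + 1) by rewrite /e2; field.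
  by rewrite ler_pM2l// lerDl.
by lra.
Qed.

End Null.

Section PFunNull.
Context {R : realType} {I : finType}.
Implicit Types (F : (I -> R) -> R).

Lemma pfun_zeros_null F (z : I -> R) : pfun F -> F z != 0 ->
  lebesgue_null [set x | F x = 0].
Proof.
move=> pF Fz e e0.
(* The cube of half-side [N] receives the share [e / 2 ^+ N.+1] of the volume, and the cubes exhaust
   the space. *)
have [Bs HBs] : exists Bs : nat -> seq ((I -> R) * (I -> R)), forall N,
    [/\ forall B, B \in Bs N -> proper_box B,
      forall y, (forall i, `|y i| <= N%:R) -> F y = 0 ->
        exists2 B, B \in Bs N & in_box (index_enum I) B y
      & \sum_(B <- Bs N) box_volume (index_enum I) B <= e / 2 ^+ N.+1].
  suff /choice[Bs HBs] : forall N, exists s : seq ((I -> R) * (I -> R)),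
    [/\ forall B, B \in s -> proper_box B,
      forall y, (forall i, `|y i| <= N%:R) -> F y = 0 ->
        exists2 B, B \in s & in_box (index_enum I) B y
      & \sum_(B <- s) box_volume (index_enum I) B <= e / 2 ^+ N.+1] by exists Bs.
  move=> N.
  have [||||h [s [h0 ps cov le]]] := @sublevel_cover _ _ F N%:R (index_enum I) pF _
      (index_enum_uniq _) (fun=> 0) z _ Fz _ (e / 2 ^+ N.+1).
  - by [].
  - by move=> i; rewrite mem_index_enum.
  - by move=> i; rewrite normr0.
  - by rewrite divr_gt0// exprn_gt0.
  exists s; split=> // y yN Fy; apply: cov => //.
    by move=> i; rewrite mem_index_enum.
  by rewrite Fy normr0 ltW.
(* The leading [None] makes the lists nonempty, so that concatenating the first
   [q.+1] of them always reaches position [q]. *)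
pose L N := None :: map Some (Bs N).
pose C n := flatten [seq L N | N <- iota 0 n].
have CS n : C n.+1 = C n ++ L n by rewrite /C -addn1 iotaD map_cat flatten_cat /= cats0.
have sizeC n : (n <= size (C n))%N.
  elim: n => // n IH; rewrite CS size_cat /=.
  by rewrite (leq_trans _ (leq_add IH (leqnn _)))// addnS ltnS leq_addr.
have prefC m n : (m <= n)%N -> exists t, C n = C m ++ t.
  move=> /subnK <-; elim: (n - m)%N => [|d [t IH]]; first by exists [::]; rewrite cats0.
  by exists (t ++ L (d + m)%N); rewrite addSn CS IH catA.
have nthC m n q : (q < size (C m))%N -> (m <= n)%N -> nth None (C n) q = nth None (C m) q.
  by move=> qm /prefC[t ->]; rewrite nth_cat qm.
pose bx q := nth None (C q.+1) q.
pose bo q := odflt (fun=> 0, fun=> 0) (bx q).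
have bxB q B : bx q = Some B -> exists N, B \in Bs N.
  move=> E; have : Some B \in C q.+1 by rewrite -E mem_nth// sizeC.
  move=> /flatten_mapP[N _]; rewrite inE => /orP[//|/mapP[B' BB [->]]].
  by exists N.
exists (fun q => isSome (bx q)), (fun q => (bo q).1), (fun q => (bo q).2); split.
- move=> q i; rewrite /bo; case E : (bx q) => [B|] //=.
  by have [N /((let: And3 h _ _ := HBs N in h) B)] := bxB _ _ E; apply.
- move=> x /= Fx.
  pose N := (\max_(i : I) Num.bound (x i))%N.
  have [_ cov _] := HBs N; have [i|B BB inB] := cov x _ Fx.
    rewrite (le_trans (ltW (unstable.ltr_norm_bound _)))// ler_nat.
    exact: leq_bigmax.
  have BC : Some B \in C N.+1.
    apply/flatten_mapP; exists N; first by rewrite mem_iota leq0n add0n ltnSn.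
    by rewrite in_cons; apply/orP; right; exact: map_f.
  pose q := index (Some B) (C N.+1).
  have qs : (q < size (C N.+1))%N by rewrite index_mem.
  have bq : bx q = Some B.
    rewrite /bx -(nthC _ (maxn q.+1 N.+1)) ?sizeC ?leq_maxl//.
    by rewrite (nthC N.+1) ?leq_maxr// nth_index.
  exists q; rewrite ?bq// /bo bq /= => i.
  by apply: inB; rewrite mem_index_enum.
- have bo_ge0 q : 0 <= \prod_i ((bo q).2 i - (bo q).1 i).
    apply: prodr_ge0 => i _; rewrite subr_ge0 /bo.
    case E : (bx q) => [B|] //=.
    by have [N /((let: And3 h _ _ := HBs N in h) B)] := bxB _ _ E; apply.
  apply: lime_le; first by apply: is_cvg_nneseries => q _ _; rewrite lee_fin.
  apply: nearW => n; rewrite sumEFin lee_fin.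
  pose g (o : option ((I -> R) * (I -> R))) := oapp (box_volume (index_enum I)) 0 o.
  have g0 k o : o \in C k -> 0 <= g o.
    move=> /flatten_mapP[N _]; rewrite inE => /orP[/eqP->//|/mapP[B BB ->]] /=.
    by apply: box_volume_ge0; have [h _ _] := HBs N; exact: h.
  have le1 : \sum_(o <- C n) g o <= e - e / 2 ^+ n.
    elim: n => [|n IHn]; first by rewrite big_nil expr0 divr1 subrr.
    rewrite CS big_cat /= big_cons add0r big_map.
    have [_ _ le2] := HBs n; rewrite (le_trans (lerD IHn le2))// exprS.
    have p2 : 2 ^+ n != 0 :> R by rewrite expf_neq0.
    by rewrite le_eqVlt; apply/orP; left; apply/eqP; field.
  have -> : \sum_(0 <= i < n | bx i) \prod_j ((bo i).2 j - (bo i).1 j) =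
     \sum_(o <- take n (C n)) g o.
    have -> : take n (C n) = map bx (iota 0 n).
      apply: (@eq_from_nth _ None); first by rewrite size_map size_iota size_takel.
      move=> q; rewrite size_takel// => qn.
      rewrite nth_take// (nth_map 0%N) ?size_iota// nth_iota// add0n /bx.
      by rewrite (nthC q.+1).
    rewrite big_map /index_iota subn0 big_mkcond /=; apply: eq_bigr => q _.
    by rewrite /bo; case: (bx q).
  have : \sum_(o <- take n (C n)) g o <= \sum_(o <- C n) g o.
    rewrite -{2}(cat_take_drop n (C n)) big_cat /= lerDl big_seq_cond sumr_ge0// => o.
    by rewrite andbT => /mem_drop; exact: g0.
  have : 0 <= e / 2 ^+ n by rewrite divr_ge0 ?exprn_ge0 ?ltW.
  by move: le1; lra.
Qed.

(** By continuity [F] is nonzero on a box around [z]. This is how an [almost_all] statement gets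
    refuted. *)
Lemma pfun_neq0_not_null F (z : I -> R) (N : set (I -> R)) : pfun F -> F z != 0 ->
  (forall x, F x != 0 -> N x) -> ~ lebesgue_null N.
Proof.
move=> pF Fz FN.
pose M := \sum_i `|z i| + 1.
have zM i : `|z i| + 1 <= M by rewrite lerD2r (bigD1 i)//= lerDl sumr_ge0.
have [L [_ [L0 _ _ lip]]] := pfun_lipschitz M pF.
have Fz0 : 0 < `|F z| by rewrite normr_gt0.
(* The cap 1 keeps the box inside the cube where [L] is a Lipschitz constant; the other bound lets
   [F] vary by at most half of [|F z|]. *)
pose d := Num.min 1 (`|F z| / (2 * (L + 1))).
have L1 : 0 < L + 1 by rewrite ltr_pwDr.
have d0 : 0 < d by rewrite lt_min ltr01 divr_gt0// mulr_gt0.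
apply: (@box_not_null _ _ (fun i => z i - d) (fun i => z i + d)).
  by move=> i; move: d0; lra.
move=> x xz; apply: FN; apply/eqP => Fx.
have zx i : `|z i - x i| <= d by have := xz i; rewrite ler_norml; lra.
have d1 : d <= 1 by rewrite ge_min lexx.
have := lip z x d _ _ (ltW d0) zx; rewrite Fx subr0.
have zM' : forall i, `|z i| <= M by move=> i; have := zM i; lra.
have xM i : `|x i| <= M.
  have := ler_normD (x i - z i) (z i); rewrite subrK.
  by have := zM i; have := zx i; rewrite distrC; lra.
move=> /(_ zM' xM) H.
have : L * d <= `|F z| / 2.
  rewrite (@le_trans _ _ ((L + 1) * (`|F z| / (2 * (L + 1)))))//.
    by rewrite ler_pM ?(ltW d0)// ?lerDl// ge_min lexx orbT.
  have L1' : L + 1 != 0 by rewrite gt_eqF.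
  by rewrite le_eqVlt; apply/orP; left; apply/eqP; field.
by lra.
Qed.


End PFunNull.

(** * Controllability and the Popov-Belevitch-Hautus test *)

Section Gram.
Context {R : realType}.

Definition mxpfun (I : Type) (m n : nat) (M : (I -> R) -> 'M[R]_(m, n)) : Prop :=
  forall i j, pfun (fun x => M x i j).

Lemma mxpfun_cst (I : Type) m n (M : 'M[R]_(m, n)) : mxpfun (fun _ : I -> R => M).
Proof. by move=> i j; exact: pfun_cst. Qed.

Lemma mxpfun_add (I : Type) m n (M N : (I -> R) -> 'M[R]_(m, n)) :
  mxpfun M -> mxpfun N -> mxpfun (fun x => M x + N x).
Proof. by move=> pM pN i j; under eq_fun do rewrite mxE; exact: pfun_add. Qed.

Lemma mxpfun_mul (I : Type) m n p (M : (I -> R) -> 'M[R]_(m, n))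
    (N : (I -> R) -> 'M[R]_(n, p)) :
  mxpfun M -> mxpfun N -> mxpfun (fun x => M x *m N x).
Proof.
move=> pM pN i j; under eq_fun do rewrite mxE.
by apply: pfun_sum => k; exact: pfun_mul.
Qed.

Lemma mxpfun_tr (I : Type) m n (M : (I -> R) -> 'M[R]_(m, n)) :
  mxpfun M -> mxpfun (fun x => (M x)^T).
Proof. by move=> pM i j; under eq_fun do rewrite mxE; exact: pM. Qed.

Lemma mxpfun_det (I : Type) n (M : (I -> R) -> 'M[R]_n) :
  mxpfun M -> pfun (fun x => \det (M x)).
Proof.
move=> pM; apply: pfun_sum => s; apply: pfun_mul; first exact: pfun_cst.
by apply: pfun_prod => i; exact: pM.
Qed.

Lemma mxpfun_fill (J : Type) m n (M : 'M[bool]_(m, n)) (f : free_entry M -> J) :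
  mxpfun (fun x : J -> R => fill (x \o f)).
Proof.
move=> i j; under eq_fun do rewrite mxE.
by case: insubP => [e _ _|_] /=; [exact: pfun_var|exact: pfun_cst].
Qed.

Definition krylov n b (A : 'M[R]_n) (B : 'M[R]_(n, b)) (t : nat) : 'M[R]_(n, b) :=
  iter t (mulmx A) B.

(** The controllability Gramian over [n] steps. It is square for every number of inputs, which turns
    a rank condition into one determinant. *)
Definition gram n b (A : 'M[R]_n) (B : 'M[R]_(n, b)) : 'M[R]_n :=
  \sum_(t < n) krylov A B t *m (krylov A B t)^T.

Lemma pfun_gram (I : Type) n b (A : (I -> R) -> 'M[R]_n) (B : (I -> R) -> 'M[R]_(n, b)) :
  mxpfun A -> mxpfun B -> pfun (fun x => \det (gram (A x) (B x))).
Proof.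
move=> pA pB.
have pK t : mxpfun (fun x => krylov (A x) (B x) t).
  by elim: t => //= t IH; exact: mxpfun_mul.
apply: mxpfun_det => i j; under eq_fun do rewrite /gram summxE.
by apply: pfun_sum => t; apply: mxpfun_mul => //; exact: mxpfun_tr.
Qed.

Local Notation toC := (map_mx (real_complex R : R -> R[i])).

Definition pbh n b (A : 'M[R]_n) (B : 'M[R]_(n, b)) : Prop :=
  forall (z : R[i]) (v : 'rV[R[i]]_n),
    v *m toC A = z *: v -> v *m toC B = 0 -> v = 0.

(** A left eigenvector of [A] killed by [B] is killed by every [A^t B], hence by the Gramian. *)
Lemma gram_unit_pbh n b (A : 'M[R]_n) (B : 'M[R]_(n, b)) : gram A B \in unitmx -> pbh A B.
Proof.
move=> uG z v vA vB.
have vK t : v *m toC (krylov A B t) = 0.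
  elim: t => [|t IH] //; rewrite /krylov iterS map_mxM mulmxA vA -scalemxAl.
  by rewrite [X in _ *: X]IH scaler0.
have : v *m toC (gram A B) = 0.
  rewrite /gram map_mx_sum mulmx_sumr big1// => t _.
  by rewrite map_mxM mulmxA vK mul0mx.
move=> /(congr1 (fun w => w *m invmx (toC (gram A B)))).
by rewrite mul0mx mulmxK// map_unitmx.
Qed.

(** In a row basis of [U] the action of [A] is a square matrix of positive size, which has an
    eigenvalue over an algebraically closed field. *)
Lemma stable_eigenvector (C : numClosedFieldType) m n (U : 'M[C]_(m, n)) (A : 'M[C]_n) :
  U != 0 -> (U *m A <= U)%MS ->
  exists (v : 'rV[C]_n) (z : C), [/\ v != 0, (v <= U)%MS & v *m A = z *: v].
Proof.
move=> U0 UA; have r0 : (0 < \rank U)%N by rewrite lt0n mxrank_eq0.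
have [a /eigenvalueP[w wa w0]] :=
  eigenvalue_closed (row_base U *m A *m pinvmx (row_base U)) r0.
exists (w *m row_base U), a; split.
- by rewrite mulmx_free_eq0// row_base_free.
- by rewrite (submx_trans (submxMl _ _))// eq_row_base.
- rewrite -[LHS]mulmxA scalemxAl -wa -[RHS]mulmxA; congr (_ *m _).
  rewrite mulmxKpV// eq_row_base (submx_trans _ UA)//.
  by rewrite submxMr// eq_row_base.
Qed.

Lemma row_sqr_eq0 n (u : 'rV[R]_n) : u *m u^T = 0 -> u = 0.
Proof.
move=> /matrixP/(_ 0 0); rewrite !mxE => /eqP.
under eq_bigr do rewrite mxE -expr2.
rewrite psumr_eq0 => [/allP H|i _]; last exact: sqr_ge0.
apply/rowP => i; rewrite mxE; apply/eqP.
by have := H i; rewrite mem_index_enum sqrf_eq0; apply.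
Qed.

(** Over the reals [w G w^T] is a sum of squares, so it vanishes only if each [w A^t B] with [t < n]
    does. Higher powers reduce to these by Cayley-Hamilton. *)
Lemma gram_kernel n b (A : 'M[R]_n) (B : 'M[R]_(n, b)) (w : 'rV[R]_n) :
  w *m gram A B = 0 -> forall t, w *m krylov A B t = 0.
Proof.
move=> wG.
have w_lt t : (t < n)%N -> w *m krylov A B t = 0.
  move=> tn; apply: row_sqr_eq0.
  have : \sum_(s < n) ((w *m krylov A B s) *m (w *m krylov A B s)^T) 0 0 = 0.
    have : (w *m gram A B *m w^T) 0 0 = 0 by rewrite wG mul0mx mxE.
    rewrite /gram mulmx_sumr mulmx_suml summxE => H; rewrite -[RHS]H.
    apply: eq_bigr => s _.
    by rewrite trmx_mul !mulmxA.
  move=> /eqP; rewrite psumr_eq0 => [/allP/(_ (Ordinal tn))|s _].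
    rewrite mem_index_enum => /(_ isT)/eqP H; apply/matrixP => i j.
    by rewrite !ord1 H mxE.
  by rewrite mxE sumr_ge0// => j _; rewrite [X in _ * X]mxE -expr2 sqr_ge0.
(* [horner_mx] asks for a positive size, whence the separate case of dimension 0. *)
case: n A B w wG w_lt => [|n] A B w _ w_lt t.
  by apply/matrixP => i j; rewrite mxE big_ord0 mxE.
have krE s : krylov A B s = A ^+ s *m B.
  by elim: s => [|s IH]; rewrite /krylov /= ?mul1mx// -/(krylov A B s) IH exprS mulmxA.
have AtE : A ^+ t = horner_mx A ('X^t %% char_poly A).
  rewrite -[in LHS](horner_mx_X A) -rmorphXn [in LHS](divp_eq 'X^t (char_poly A)).
  by rewrite rmorphD rmorphM /= Cayley_Hamilton mulr0 add0r.
rewrite krE AtE; set p := _ %% _.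
have sp : (size p <= n.+1)%N.
  rewrite -ltnS -(size_char_poly A) ltn_modp.
  by rewrite monic_neq0// char_poly_monic.
rewrite -[p]coefK poly_def rmorph_sum /= mulmx_suml mulmx_sumr big1// => i _.
rewrite linearZ /= rmorphXn /= horner_mx_X -scalemxAl -scalemxAr -krE w_lt ?scaler0//.
exact: leq_trans (ltn_ord i) sp.
Qed.

(** Were the Gramian singular, its left kernel, stable under [A] and killed by [B], would contain a
    complex eigenvector of [A] that contradicts [pbh]. *)
Lemma pbh_gram_unit n b (A : 'M[R]_n) (B : 'M[R]_(n, b)) : pbh A B -> gram A B \in unitmx.
Proof.
move=> AB; rewrite -row_free_unit -kermx_eq0; apply/negPn/negP => K0.
have KG : kermx (gram A B) *m gram A B = 0 by exact: mulmx_ker.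
have rowK i t : row i (kermx (gram A B)) *m krylov A B t = 0.
  by apply: gram_kernel; rewrite -row_mul KG row0.
have KA : (kermx (gram A B) *m A <= kermx (gram A B))%MS.
  apply/sub_kermxP/row_matrixP => i; move: (kermx _) rowK => K rowK.
  rewrite row0 -mulmxA row_mul /gram !mulmx_sumr big1// => t _; rewrite !mulmxA.
  by rewrite -(mulmxA _ A) -[A *m _]/(krylov A B t.+1) rowK mul0mx.
have [||v [z [v0 vK vA]]] := @stable_eigenvector _ _ _ (toC (kermx (gram A B))) (toC A).
- by rewrite map_mx_eq0.
- by rewrite -map_mxM map_submx.
case/eqP: v0; apply: AB vA _.
have KB : kermx (gram A B) *m B = 0.
  by apply/row_matrixP => i; rewrite row_mul row0; exact: rowK i 0%N.
by move: vK => /submxP[D ->]; rewrite -mulmxA -map_mxM KB map_mx0 mulmx0.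
Qed.

Lemma trajectoryE n b (A : 'M[R]_n) (B : 'M[R]_(n, b)) (u : nat -> 'cV[R]_b) x0 t :
  trajectory A B u x0 t =
  iter t (mulmx A) x0 + \sum_(s < t) krylov A B (t - s.+1) *m u s.
Proof.
elim: t => [|t IH] /=; first by rewrite big_ord0 addr0.
rewrite IH mulmxDr -addrA; congr (_ + _); rewrite big_ord_recr /= subnn mulmx_sumr.
congr (_ + _); apply: eq_bigr => s _.
by rewrite mulmxA subSS -[A *m _]/(krylov A B (t - s.+1).+1) subnSK.
Qed.

Lemma gram_unit_controllable n b (A : 'M[R]_n) (B : 'M[R]_(n, b)) :
  gram A B \in unitmx -> controllable A B.
Proof.
move=> uG x0 x1; pose y := invmx (gram A B) *m (x1 - iter n (mulmx A) x0).
(* The minimum-energy input: its total effect is the Gramian applied to [y], which is exactly the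
   missing displacement. *)
exists n, (fun s => (krylov A B (n - s.+1))^T *m y).
rewrite trajectoryE.
rewrite (_ : \sum_(s < n) _ = gram A B *m y); first by rewrite mulKVmx// subrKC.
rewrite /gram mulmx_suml (reindex_inj rev_ord_inj) /=; apply: eq_bigr => s _.
by rewrite subnSK// subKn ?mulmxA// ltnW.
Qed.

Lemma gram_unit_observable n c (A : 'M[R]_n) (C : 'M[R]_(c, n)) :
  gram A^T C^T \in unitmx -> observable A C.
Proof.
move=> uG x0 x1 H; apply/eqP; rewrite -subr_eq0; apply/eqP.
have iterB t : iter t (mulmx A) (x0 - x1) = iter t (mulmx A) x0 - iter t (mulmx A) x1.
  by elim: t => //= t ->; rewrite mulmxBr.
have kT t x : (krylov A^T C^T t)^T *m x = C *m iter t (mulmx A) x.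
  elim: t x => [|t IH] x /=; first by rewrite trmxK.
  by rewrite trmx_mul trmxK -mulmxA IH -iterSr.
have : gram A^T C^T *m (x0 - x1) = 0.
  rewrite /gram mulmx_suml big1// => t _.
  by rewrite -mulmxA kT iterB mulmxBr H subrr mulmx0.
by move=> /(congr1 (mulmx (invmx (gram A^T C^T)))); rewrite mulKmx// mulmx0.
Qed.

End Gram.

(** * A matrix with visible modes *)

Lemma connect_exit (T : finType) (e : rel T) (S : {set T}) x y :
  connect e x y -> x \in S -> y \notin S ->
  exists u w, [/\ u \in S, w \notin S & e u w].
Proof.
move=> /connectP[p]; elim: p x => [|w p IH] x /=; first by move=> _ -> ->.
move=> /andP[xw pw] yl xS yS; have [wS|wS] := boolP (w \in S); last by exists x, w.
exact: IH pw yl wS yS.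
Qed.

Section Orbit.
Context {T : finType} (s : {perm T}).

Lemma porbit_mem x y : x \in porbit s y -> porbit s x = porbit s y.
Proof. by rewrite -eq_porbit_mem => /eqP. Qed.

Lemma porbit_expg x y k : x \in porbit s y -> (s ^+ k)%g x \in porbit s y.
Proof. by move=> /porbit_mem <-; exact: mem_porbit. Qed.

Lemma porbit_step x y : x \in porbit s y -> s x \in porbit s y.
Proof. by move=> /(@porbit_expg _ _ 1); rewrite expg1. Qed.

(** The walk from a point of the cycle to its first visit of [y0] never leaves [y0], so it uses only
    steps along which [P] is kept. *)
Lemma porbit_const (P : pred T) x0 y0 : y0 \in porbit s x0 ->
  (forall x, x \in porbit s x0 -> x != y0 -> P (s x) = P x) ->
  forall x, x \in porbit s x0 -> P x = P y0.
Proof.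
move=> y0O H x xO.
have : y0 \in porbit s x by rewrite (porbit_mem xO).
case/porbitP => k0 k0P.
have ex : exists k, (s ^+ k)%g x == y0 by exists k0; rewrite k0P.
have [k /eqP kP kmin] := ex_minnP ex; rewrite -kP.
have : forall m, (m <= k)%N -> P ((s ^+ m)%g x) = P x.
  elim=> [|m IH] mk; first by rewrite expg0 perm1.
  rewrite expgSr permM H ?IH ?(ltnW mk)//.
    exact: porbit_expg.
  by apply: contraTneq mk => E; rewrite -leqNgt kmin// E.
by move=> /(_ k) ->.
Qed.

End Orbit.

Section Witness.
Local Open Scope set_scope.
Context {R : realType} {n : nat} (A : 'M[bool]_n) (s : {perm 'I_n}).
Hypothesis sA : forall j, A (s j) j.
Implicit Types (S O : {set 'I_n}) (v : 'I_n -> R[i]) (z c : R[i]).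

Local Notation C := (R[i]).
Local Notation inC := (real_complex R).

(* The modes of the cycle through [j] have modulus [rho j]. *)
Definition rho (j : 'I_n) : R := (enum_rank (porbit s j)).+1%:R.

Lemma rho_eq i j : (rho i == rho j) = (i \in porbit s j).
Proof.
by rewrite /rho eqr_nat eqSS (inj_eq val_inj) (inj_eq enum_rank_inj) eq_porbit_mem.
Qed.

Lemma inC_rho_neq0 j : inC (rho j) != 0.
Proof. by rewrite fmorph_eq0 pnatr_eq0. Qed.

Lemma norm_inC_rho j : `|inC (rho j)| = inC (rho j).
Proof. by rewrite /rho rmorph_nat normr_nat. Qed.

(** Each step along the cycle multiplies [v] by [z / rho x0]. After a full turn the factor is 1, so
    this quotient has modulus 1 and in particular is not 0. *)
Lemma cycle_eigen v z x0 :
  (forall j, j \in porbit s x0 -> inC (rho j) * v (s j) = z * v j) ->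
  (exists2 j, j \in porbit s x0 & v j != 0) ->
  `|z| = inC (rho x0) /\ forall j, j \in porbit s x0 -> v j != 0.
Proof.
move=> H [j jO vj].
have rhoO i : i \in porbit s x0 -> rho i = rho x0 by move=> iO; apply/eqP; rewrite rho_eq.
have r0 := inC_rho_neq0 x0.
have vs i : i \in porbit s x0 -> v (s i) = z / inC (rho x0) * v i.
  by move=> iO; rewrite mulrAC -H// rhoO// mulrAC divff// mul1r.
have vk i k : i \in porbit s x0 -> v ((s ^+ k)%g i) = (z / inC (rho x0)) ^+ k * v i.
  move=> iO; elim: k => [|k IH]; first by rewrite expg0 perm1 mul1r.
  by rewrite expgSr permM vs ?porbit_expg// IH mulrA -exprS.
have pos : (0 < #|porbit s j|)%N by apply/card_gt0P; exists j; exact: porbit_id.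
have zr1 : (z / inC (rho x0)) ^+ #|porbit s j| = 1.
  have := vk j #|porbit s j| jO; rewrite permX iter_porbit => /esym/eqP.
  by rewrite -subr_eq0 -{2}[v j]mul1r -mulrBl mulf_eq0 (negbTE vj) orbF subr_eq0 => /eqP.
have zr : `|z / inC (rho x0)| = 1.
  by apply/eqP; rewrite -(pexpr_eq1 pos)// -normrX zr1 normr1.
have zrho : `|z| = inC (rho x0).
  move: zr; rewrite normrM normfV norm_inC_rho => /(congr1 (fun t => t * inC (rho x0))).
  by rewrite divfK// mul1r.
split=> // i iO; have : i \in porbit s j.
  by rewrite (porbit_mem jO).
case/porbitP => k ->; rewrite vk// mulf_neq0// expf_neq0//.
by apply/eqP => z0; move: zr; rewrite z0 normr0 => /eqP; rewrite eq_sym oner_eq0.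
Qed.

(** Zeros of [v] spread along the cycle, except possibly across [j0], so a single zero forces zeros
    everywhere; the equation at [j0] would then give [c = 0]. *)
Lemma cycle_defect v z c x0 j0 : j0 \in porbit s x0 -> c != 0 -> z != 0 ->
  (forall j, j \in porbit s x0 ->
     inC (rho j) * v (s j) + c * (j == j0)%:R = z * v j) ->
  forall j, j \in porbit s x0 -> v j != 0.
Proof.
move=> j0O c0 z0 H.
have V x : x \in porbit s x0 -> x != j0 -> (v (s x) == 0) = (v x == 0).
  move=> xO xj; have := H x xO; rewrite (negbTE xj) mulr0 addr0 => E.
  have := congr1 (fun t => t == 0) E.
  by rewrite !mulf_eq0 (negbTE z0) (negbTE (inC_rho_neq0 x)).
have {}V := porbit_const j0O V.
move=> j jO; rewrite V//; apply/eqP => vj0.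
have : v (s j0) == 0.
  by rewrite V ?vj0// porbit_step.
move=> /eqP vs0; have := H j0 j0O; rewrite eqxx vs0 vj0 !mulr0 add0r mulr1.
by move/eqP; rewrite (negbTE c0).
Qed.

(** Functions replace row vectors because the eigenvector equations are imposed only on subsets of
    the states. *)
Definition act (M : 'M[R]_n) v (j : 'I_n) : C := \sum_i v i * inC (M i j).

Definition cycle_mx O : 'M[R]_n := \matrix_(i, j) if (j \in O) && (i == s j) then rho j else 0.

Lemma act_add M M' v j : act (M + M') v j = act M v j + act M' v j.
Proof.
by rewrite /act -big_split; apply: eq_bigr => i _ /=; rewrite mxE rmorphD mulrDr.
Qed.

Lemma act_cycle O v j : act (cycle_mx O) v j = (j \in O)%:R * (inC (rho j) * v (s j)).
Proof.
rewrite /act (bigD1 (s j))//= big1 ?addr0 => [|i ij].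
  by rewrite mxE eqxx andbT; case: ifP => _; rewrite ?mul1r ?mul0r ?rmorph0 ?mulr0// mulrC.
by rewrite mxE (negbTE ij) andbF rmorph0 mulr0.
Qed.

Lemma act_delta d i1 j1 v j : act (d *: delta_mx i1 j1) v j = inC d * v i1 * (j == j1)%:R.
Proof.
rewrite /act (bigD1 i1)//= big1 ?addr0 => [|i ij].
  by rewrite !mxE eqxx rmorphM rmorph_nat mulrCA mulrA.
by rewrite !mxE (negbTE ij) mulr0 rmorph0 mulr0.
Qed.

Variable roots : {set 'I_n}.

(* The last clause says that a mode of a cycle outside [S], fed into [S] at
   [j0], can be seen at a root of [S]. *)
Definition visible S : Prop := exists M : 'M[R]_n,
  [/\ forall i j, ~~ A i j -> M i j = 0,
      forall i j, M i j != 0 -> (i \in S) && (j \in S),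
      forall v z, (forall j, j \in S -> act M v j = z * v j) ->
        (forall r, r \in roots -> r \in S -> v r = 0) -> forall j, j \in S -> v j = 0
    & forall v z c j0, j0 \in S -> c != 0 -> z != 0 ->
        (forall j, j \in S -> `|z| != inC (rho j)) ->
        (forall j, j \in S -> act M v j + c * (j == j0)%:R = z * v j) ->
        exists r, [/\ r \in roots, r \in S & v r != 0]].

Lemma visible_set0 : visible finset.set0.
Proof.
exists 0; split=> [i j _|i j|v z _ _ j|v z c j0]; rewrite ?inE ?mxE ?eqxx//.
Qed.

(** A mode of the new cycle is nowhere zero on it, and its modulus differs from those of [S]. It
    shows at a root on the cycle, or else the edge from [j1] to [i1] feeds it into [S] at [j1],
    where the last clause of [visible] applies: left eigenvectors travel against the edges. *)
Lemma visible_grow S i1 j1 (d : R) : (forall j, j \in S -> s j \in S) ->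
  visible S -> i1 \notin S ->
  (d = 0 /\ exists2 r, r \in roots & r \in porbit s i1) \/
  [/\ d = 1, j1 \in S & A i1 j1] ->
  visible (S :|: porbit s i1).
Proof.
move=> stS [M [MA MS Mv Md]] i1S H; set O := porbit s i1.
have OS j : j \in O -> j \notin S.
  move=> jO; apply: contra i1S => jS; move: jO; rewrite porbit_sym => /porbitP[k ->].
  by elim: k => [|k IH]; rewrite ?expg0 ?perm1// expgSr permM stS.
have SO j : j \in S -> (j \in O) = false by move=> jS; apply/negP => /OS; rewrite jS.
have M0 v j : j \in O -> act M v j = 0.
  move=> jO; rewrite /act big1// => i _; case: (eqVneq (M i j) 0) => [->|/MS].
    by rewrite rmorph0 mulr0.
  by rewrite (negbTE (OS _ jO)) andbF.
have rhoS j : j \in S -> rho j != rho i1 by move=> jS; rewrite rho_eq SO.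
have rhoO j : j \in O -> rho j = rho i1 by move=> jO; apply/eqP; rewrite rho_eq.
pose M1 := M + cycle_mx O + d *: delta_mx i1 j1.
have actO v j : j \in O -> act M1 v j = inC (rho j) * v (s j).
  move=> jO; rewrite !act_add act_cycle act_delta jO M0// add0r mul1r.
  case: H => [[-> _]|[_ j1S _]]; first by rewrite rmorph0 !mul0r addr0.
  by case: eqP => [E|_]; [move: j1S; rewrite -E (negbTE (OS _ jO))|rewrite mulr0 addr0].
have actS v j : j \in S -> act M1 v j = act M v j + inC d * v i1 * (j == j1)%:R.
  by move=> jS; rewrite !act_add act_cycle act_delta SO// mul0r addr0.
have fed v z : (forall j, j \in O -> v j != 0) -> z != 0 ->
    (forall j, j \in S -> `|z| != inC (rho j)) ->
    (forall j, j \in S -> act M1 v j = z * v j) ->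
    exists r, [/\ r \in roots, r \in S :|: O & v r != 0].
  move=> vO z0 zS vS; case: H => [[_ [r rr rO]]|[d1 j1S _]].
    by exists r; rewrite inE rO orbT vO.
  have [||r [rr rS vr]] := Md v z (v i1) j1 j1S _ z0 zS.
  - exact/vO/porbit_id.
  - by move=> j jS; rewrite -vS// actS// d1 rmorph1 mul1r.
  by exists r; rewrite inE rS.
exists M1; split.
- move=> i j Aij; rewrite !mxE MA// add0r.
  case: andP => [[_ /eqP E]|_]; first by move: Aij; rewrite E sA.
  rewrite add0r; case: H => [[-> _]|[_ _ A1]]; first by rewrite mul0r.
  by case: eqP => [E|_]; case: eqP => [E'|_]; rewrite ?mulr0// E E' A1 in Aij *.
- move=> i j; rewrite !mxE !inE; case: (eqVneq (M i j) 0) => [->|/MS/andP[-> ->]//].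
  rewrite add0r; case: andP => [[jO /eqP ->] _|_].
    by rewrite porbit_step ?jO ?orbT.
  rewrite add0r mulf_eq0 negb_or; case: H => [[-> _]|[_ j1S _]]; first by rewrite eqxx.
  case: (eqVneq i i1) => [->|]; case: (eqVneq j j1) => [->|]; rewrite ?eqxx ?andbF//.
  by rewrite porbit_id j1S orbT.
- move=> v z E V j.
  have EO i : i \in O -> inC (rho i) * v (s i) = z * v i.
    by move=> iO; rewrite -actO// E// inE iO orbT.
  have ES i : i \in S -> act M1 v i = z * v i by move=> iS; rewrite E// inE iS.
  have [nzO|/forall_inPn zO] := boolP [forall (i | i \in O), v i == 0]; last first.
    have [i iO vi] := zO; have [zr nz] := cycle_eigen EO (ex_intro2 _ _ i iO vi).
    have z0 : z != 0 by rewrite -normr_eq0 zr inC_rho_neq0.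
    have [|r [rr rS]] := fed v z nz z0 _ ES.
      by move=> k kS; rewrite zr (inj_eq (fmorph_inj _)) eq_sym rhoS.
    by rewrite V ?eqxx.
  have {}nzO i : i \in O -> v i = 0 by move=> iO; apply/eqP/(forall_inP nzO).
  rewrite inE => /orP[jS|]; last exact: nzO.
  apply: (Mv v z) => // [i iS|r rr rS]; last by rewrite V// inE rS.
  by rewrite -ES// actS// nzO ?porbit_id// mulr0 mul0r addr0.
- move=> v z c j0 j0SO c0 z0 zSO E.
  have zS j : j \in S -> `|z| != inC (rho j) by move=> jS; apply: zSO; rewrite inE jS.
  have [j0O|j0O] := boolP (j0 \in O).
    apply: (fed v z) => //.
      apply: (@cycle_defect v z c i1 j0) => // j jO.
      by rewrite -actO// E// inE jO orbT.
    move=> j jS; rewrite -E ?inE ?jS//; case: eqP => [E'|_]; last by rewrite mulr0 addr0.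
    by move: (OS _ j0O); rewrite -E' jS.
  have j0S : j0 \in S by move: j0SO; rewrite inE (negbTE j0O) orbF.
  (* The defect lies in [S], so on the cycle [v] satisfies the plain eigenvector equation; a nonzero
     value there would give [z] the modulus of this cycle, which is excluded. *)
  have vO j : j \in O -> v j = 0.
    move=> jO; apply/eqP/negPn/negP => vj.
    have [|zr _] := @cycle_eigen v z i1 _ (ex_intro2 _ _ j jO vj).
      move=> i iO; rewrite -actO// -E ?inE ?iO ?orbT//.
      by case: eqP => [E'|_]; [move: j0O; rewrite -E' iO|rewrite mulr0 addr0].
    have := zSO i1; rewrite inE porbit_id orbT zr eqxx => /(_ isT).
    by [].
  have [|r [rr rS vr]] := Md v z c j0 j0S c0 z0 zS; last by exists r; rewrite inE rS.
  by move=> j jS; rewrite -E ?inE ?jS// actS// vO ?porbit_id// mulr0 mul0r addr0.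
Qed.

(** While [S] misses a state [x], take a root that reaches [x]. If it is outside [S], its cycle can
    be added with [d = 0]; otherwise a path from it leaves [S] by an edge into a cycle that can be
    added with [d = 1]. *)
Lemma visible_setT : (forall x, exists2 r, r \in roots & connect (fun j i => A i j) r x) ->
  visible [set: 'I_n]%SET.
Proof.
move=> reach.
suff H k : exists S, [/\ forall j, j \in S -> s j \in S, visible S & (#|~: S| <= n - k)%N].
  have [S [_ VS]] := H n; rewrite subnn leqn0 cards_eq0 => /eqP E.
  by rewrite -finset.setC0 -E finset.setCK.
elim: k => [|k [S [stS VS cS]]].
  exists finset.set0; split=> [j||]; rewrite ?inE//; first exact: visible_set0.
  by rewrite subn0 (leq_trans (max_card _))// card_ord.
have [ST|] := eqVneq S [set: 'I_n]%SET; first by exists S; split=> //; rewrite ST finset.setCT cards0.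
rewrite finset.eqEsubset finset.subsetT /= => /subsetPn[x _ xS].
suff [i1 [j1 [d [i1S H]]]] : exists i1 j1 d, i1 \notin S /\
    ((d = 0 :> R /\ exists2 r, r \in roots & r \in porbit s i1) \/
     [/\ d = 1, j1 \in S & A i1 j1]).
  exists (S :|: porbit s i1); split.
  - by move=> j; rewrite !inE => /orP[/stS->//|/porbit_step->]; rewrite orbT.
  - exact: visible_grow H.
  - have : (#|~: (S :|: porbit s i1)| < #|~: S|)%N.
      apply/proper_card/properP; split; first by rewrite finset.setCS finset.subsetUl.
      by exists i1; rewrite !inE ?porbit_id ?orbT.
    by move=> lt; rewrite -ltnS (leq_trans lt)// (leq_trans cS)// subnS leqSpred.
have [r rr rx] := reach x.
have [rS|rS] := boolP (r \in S); last first.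
  by exists r, r, 0; split=> //; left; split=> //; exists r => //; exact: porbit_id.
by have [j1 [i1 [? ? ?]]] := connect_exit rx rS xS; exists i1, j1, 1; split=> //; right.
Qed.

End Witness.

Definition edge n (A : 'M[bool]_n) : rel 'I_n := fun j i => A i j.

Lemma edge_tr n (A : 'M[bool]_n) x y : connect (edge A^T) x y = connect (edge A) y x.
Proof.
rewrite -[RHS](connect_rev (edge A)) /=; apply: eq_connect => i j.
by rewrite /edge mxE.
Qed.

Lemma perfect_matching_perm n (A : 'M[bool]_n) : has_perfect_matching (state_bipartite A) ->
  exists s : {perm 'I_n}, forall j, A (s j) j.
Proof.
move=> [M [/and3P[/allP MA u1 u2] M1 M2]].
have H (i : 'I_n) : {j | (i, j) \in M}.
  by apply: sigW; have /mapP[[i' j] ij /= ->] := M1 i; exists j.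
have inj : injective (fun i => sval (H i)).
  move=> i i' /=; case: (H i) => j ij; case: (H i') => j' ij' /= E; subst j'.
  have := ij'; have := ij.
  move=> /(nthP (i, j))[q qs Eq] /(nthP (i, j))[q' qs' Eq'].
  have : nth j (unzip2 M) q = nth j (unzip2 M) q'.
    by rewrite !(nth_map (i, j))// Eq Eq'.
  move/eqP; rewrite nth_uniq ?size_map// => /eqP qq'; move: Eq'; rewrite -qq' Eq.
  by case.
exists (perm inj) => j; rewrite permE; case: (H j) => i /= ji.
exact: (MA _ ji).
Qed.

(** * From one good matrix to almost all matrices *)

Section Generic.
Context {R : realType}.
Local Notation toC := (map_mx (real_complex R : R -> R[i])).

Lemma fill_id m n (P : 'M[bool]_(m, n)) (M : 'M[R]_(m, n)) :
  (forall i j, ~~ P i j -> M i j = 0) ->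
  fill (fun e : free_entry P => M (val e).1 (val e).2) = M.
Proof.
move=> PM; apply/matrixP => i j; rewrite mxE.
by case: insubP => [e _ ->//|/= /PM].
Qed.

Lemma fill_out m n (P : 'M[bool]_(m, n)) (x : free_entry P -> R) i j :
  ~~ P i j -> fill x i j = 0.
Proof. by move=> Pij; rewrite mxE insubN. Qed.

Definition unit_actuators n b (f : 'I_b -> 'I_n) : 'M[R]_(n, b) :=
  \matrix_(i, l) (i == f l)%:R.

Lemma pbh_witness n (A : 'M[bool]_n) (s : {perm 'I_n}) b (f : 'I_b -> 'I_n) :
  (forall j, A (s j) j) -> (forall x, exists l, connect (edge A) (f l) x) ->
  exists M : 'M[R]_n, (forall i j, ~~ A i j -> M i j = 0) /\ pbh M (unit_actuators f).
Proof.
move=> sA reach.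
have [|M [MA _ Mv _]] := @visible_setT R n A s sA [set f l | l : 'I_b]%SET.
  by move=> x; have [l lx] := reach x; exists (f l) => //; apply/imsetP; exists l.
exists M; split=> // z v vM vB; apply/rowP => j; rewrite mxE.
apply: (Mv (fun i => v 0 i) z); rewrite ?finset.in_setT//.
  move=> i _; have := congr1 (fun w : 'rV_n => w 0 i) vM; rewrite !mxE => <-.
  by apply: eq_bigr => k _; rewrite mxE.
move=> r /imsetP[l _ ->] _; have := congr1 (fun w : 'rV_b => w 0 l) vB; rewrite !mxE (bigD1 (f l))//= big1.
  by rewrite !mxE eqxx rmorph1 mulr1 addr0.
by move=> i il; rewrite !mxE (negbTE il) rmorph0 mulr0.
Qed.

Lemma ctrl_dedicated_reach n (A : 'M[bool]_n) b (f : 'I_b -> 'I_n) :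
  has_perfect_matching (state_bipartite A) ->
  (forall x, exists l, connect (edge A) (f l) x) -> ctrl_dedicated R A f.
Proof.
move=> /perfect_matching_perm[s sA] reach.
have [M [MA /pbh_gram_unit uM]] := pbh_witness sA reach.
have pF : pfun (fun x : free_entry A + free_entry (actuator_matrix f) -> R =>
    \det (gram (fill (x \o inl)) (fill (x \o inr)))).
  by apply: pfun_gram; exact: mxpfun_fill.
pose x0 (e : free_entry A + free_entry (actuator_matrix f)) : R := match e with
  | inl e => M (val e).1 (val e).2
  | inr e => unit_actuators f (val e).1 (val e).2 end.
apply: (null_subset _ (pfun_zeros_null (z := x0) pF _)) => [x /= nc|].
  apply: contrapT => /eqP; rewrite -unitfE -unitmxE => /gram_unit_controllable; exact: nc.
rewrite (_ : x0 \o inl = fun e => M (val e).1 (val e).2)// fill_id//.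
rewrite (_ : x0 \o inr = fun e => unit_actuators f (val e).1 (val e).2)// fill_id.
  by rewrite -unitfE -unitmxE.
by move=> i l; rewrite !mxE => /negbTE ->.
Qed.

Lemma perfect_matching_tr n (A : 'M[bool]_n) (s : {perm 'I_n}) :
  (forall j, A (s j) j) -> forall j, A^T ((s^-1)%g j) j.
Proof. by move=> sA j; rewrite mxE -{1}[j](permKV s). Qed.

Lemma obs_dedicated_reach n (A : 'M[bool]_n) c (g : 'I_c -> 'I_n) :
  has_perfect_matching (state_bipartite A) ->
  (forall x, exists j, connect (edge A) x (g j)) -> obs_dedicated R A g.
Proof.
move=> /perfect_matching_perm[s sA] reach.
have [|M [MA /pbh_gram_unit uM]] := @pbh_witness _ _ _ _ g (perfect_matching_tr sA).
  by move=> x; have [j xj] := reach x; exists j; rewrite edge_tr.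
have pF : pfun (fun x : free_entry A + free_entry (sensor_matrix g) -> R =>
    \det (gram (fill (x \o inl))^T (fill (x \o inr))^T)).
  by apply: pfun_gram; apply: mxpfun_tr; exact: mxpfun_fill.
pose x0 (e : free_entry A + free_entry (sensor_matrix g)) : R := match e with
  | inl e => M^T (val e).1 (val e).2
  | inr e => (unit_actuators g)^T (val e).1 (val e).2 end.
apply: (null_subset _ (pfun_zeros_null (z := x0) pF _)) => [x /= nc|].
  apply: contrapT => /eqP; rewrite -unitfE -unitmxE => /gram_unit_observable; exact: nc.
rewrite (_ : x0 \o inl = fun e => M^T (val e).1 (val e).2)// fill_id; last first.
  by move=> i j Aij; rewrite mxE MA// mxE.
rewrite (_ : x0 \o inr = fun e => (unit_actuators g)^T (val e).1 (val e).2)// fill_id.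
  by rewrite !trmxK -unitfE -unitmxE.
by move=> i l; rewrite !mxE => /negbTE ->.
Qed.

End Generic.

(** * Fixed modes *)

Lemma eigenvalue_tr (F : fieldType) n (M : 'M[F]_n) z : eigenvalue M^T z = eigenvalue M z.
Proof.
rewrite !eigenvalue_root_char /char_poly -[in RHS]det_tr /char_poly_mx.
by rewrite [in RHS]linearB /= tr_scalar_mx map_trmx.
Qed.

Definition closed_loop n b c (A : 'M[bool]_n) (f : 'I_b -> 'I_n) (g : 'I_c -> 'I_n)
    (K : {set 'I_c * 'I_b}) : rel 'I_n :=
  fun j i => A i j || [exists e in K, (g e.1 == j) && (f e.2 == i)].

Section FixedModes.
Context {R : realType}.
Local Notation toC := (map_mx (real_complex R : R -> R[i])).

Lemma mul_delta_link n b c (f : 'I_b -> 'I_n) (g : 'I_c -> 'I_n)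
    (B : 'M[R]_(n, b)) (C : 'M[R]_(c, n)) l s :
  (forall i l, i != f l -> B i l = 0) -> (forall s j, j != g s -> C s j = 0) ->
  B *m delta_mx l s *m C = (B (f l) l * C s (g s)) *: delta_mx (f l) (g s).
Proof.
move=> Bf Cg; apply/matrixP => i j; rewrite !mxE (bigD1 s)//= big1 => [|s' ss].
  rewrite mxE (bigD1 l)//= big1 => [|l' ll]; last by rewrite mxE (negbTE ll) mulr0.
  rewrite !mxE !eqxx mulr1 !addr0.
  have [->|il] := eqVneq i (f l); last by rewrite Bf// mul0r mulr0.
  have [->|js] := eqVneq j (g s); first by rewrite mulr1.
  by rewrite Cg// !mulr0.
by rewrite mxE big1 ?mul0r// => l' _; rewrite mxE (negbTE ss) andbF mulr0.
Qed.

(* A mode common to [M] and to its perturbation along one link is not seen by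
   that sensor or not reached from that actuator. *)
Lemma pbh_no_common_eigenvalue n (M : 'M[R]_n) (i j : 'I_n) (d : R) (z : R[i]) :
  d != 0 -> pbh M (unit_actuators (fun _ : 'I_1 => i)) ->
  pbh M^T (unit_actuators (fun _ : 'I_1 => j)) ->
  eigenvalue (toC M) z -> eigenvalue (toC (M + d *: delta_mx i j)) z -> False.
Proof.
move=> d0 pM pMT; rewrite -eigenvalue_tr => /eigenvalueP[u uM u0] /eigenvalueP[v vM v0].
have colE (w : 'rV[R[i]]_n) k : w *m toC (unit_actuators (fun _ : 'I_1 => k)) = (w 0 k)%:M.
  apply/matrixP => a b; rewrite !ord1 !mxE (bigD1 k)//= big1.
    by rewrite !mxE eqxx rmorph1 mulr1 addr0 mulr1n.
  by move=> k' kk; rewrite !mxE (negbTE kk) rmorph0 mulr0.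
have vD : v *m toC (d *: delta_mx i j) = (real_complex R d * v 0 i) *: delta_mx 0 j.
  apply/matrixP => a b; rewrite !ord1 !mxE (bigD1 i)//= big1 => [|k ki].
    by rewrite !mxE !eqxx /= rmorphM rmorph_nat addr0 mulrCA mulrA.
  by rewrite !mxE (negbTE ki) mulr0 rmorph0 mulr0.
have uj : u 0 j != 0.
  apply: contra u0 => /eqP uj; apply/eqP; apply: (pMT z).
    by rewrite -map_trmx.
  by rewrite colE uj raddf0.
rewrite map_mxD mulmxDr vD in vM.
have MuT : toC M *m u^T = z *: u^T by rewrite -[toC M]trmxK -trmx_mul uM linearZ.
(* Multiplying by the right eigenvector [u^T] cancels the two terms in [z] and leaves
   [d * v 0 i * u 0 j = 0]. *)
have vi : v 0 i = 0.
  have := congr1 (fun w => (w *m u^T) 0 0) vM.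
  rewrite mulmxDl -mulmxA MuT -scalemxAl -scalemxAr -scalemxAl mxE.
  move=> /eqP; rewrite -subr_eq0 addrAC subrr add0r mxE.
  rewrite (_ : (delta_mx 0 j *m u^T) 0 0 = u 0 j); last first.
    rewrite mxE (bigD1 j)//= big1 ?addr0 => [|k kj]; last by rewrite mxE (negbTE kj) andbF mul0r.
    by rewrite !mxE !eqxx mul1r.
  by rewrite !mulf_eq0 fmorph_eq0 (negbTE d0) (negbTE uj) orbF /= => /eqP.
case/eqP: v0; apply: (pM z).
  by rewrite -vM vi mulr0 scale0r addr0.
by rewrite colE vi raddf0.
Qed.

(** The gain [K0] is fixed before the parameters. Outside the zeros of the polynomial function [F],
    the closed loop under [K0] is excited from the actuator of one link and seen at its sensor, so
    [K0] and [K0] plus that link share no mode; and that set of parameters is not null. *)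
Lemma no_resilient_fixed_modes n (A : 'M[bool]_n) b c (f : 'I_b -> 'I_n)
    (g : 'I_c -> 'I_n) (K J : {set 'I_c * 'I_b}) :
  has_perfect_matching (state_bipartite A) ->
  (forall x y, connect (closed_loop A f g (K :\: J)%SET) x y) ->
  ((0 < n)%N -> exists e, e \in (K :\: J)%SET) ->
  ~ resilient_fixed_modes R A (actuator_matrix f) (sensor_matrix g) K J.
Proof.
move=> /perfect_matching_perm[s sA] conn link.
pose sp := (free_entry A + free_entry (actuator_matrix f) + free_entry (sensor_matrix g))%type.
case: (posnP n) => [n0|/link[[s0 l0] e0] {link}].
  (* In dimension 0 the spectrum is empty, so there is no common mode. *)
  subst n => /(@pfun_neq0_not_null _ _ (fun=> 1) (fun=> 0) _ (pfun_cst _ 1) (oner_neq0 _)).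
  apply=> x _ [z zx].
  have /eigenvalueP[v _ v0] := zx 0 (fun l t _ => mxE _ _ l t).
  by case/eqP: v0; apply/rowP; case.
pose P : 'M[bool]_n := \matrix_(i, j) closed_loop A f g (K :\: J)%SET j i.
have sP j : P (s j) j by rewrite mxE /closed_loop sA.
have connP x y : connect (edge P) x y.
  by rewrite (@eq_connect _ _ (closed_loop A f g (K :\: J)%SET)) // => i j; rewrite /edge mxE.
pose b0 := @unit_actuators R n 1 (fun=> f l0).
pose c0 := @unit_actuators R n 1 (fun=> g s0).
have [|M1 [M1P /pbh_gram_unit u1]] := @pbh_witness R _ P s 1 (fun=> f l0) sP.
  by move=> x; exists 0; exact: connP.
have [|M2 [M2P /pbh_gram_unit u2]] := @pbh_witness R _ P^T _ 1 (fun=> g s0) (perfect_matching_tr sP).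
  by move=> x; exists 0; rewrite edge_tr; exact: connP.
(* [M1] is excited from [f l0] and [M2^T] is seen at [g s0]. One matrix does both, because a product
   of two nonzero polynomial functions is nonzero somewhere. *)
have [x0 Hx0] : exists x0 : free_entry P -> R,
    \det (gram (fill x0) b0) * \det (gram (fill x0)^T c0) != 0.
  have pfill : mxpfun (fun x : free_entry P -> R => fill x) := mxpfun_fill id.
  apply: (@pfun_mul_neq0 _ _ _ _ _ _ (fun e => M1 (val e).1 (val e).2)
      (fun e => M2^T (val e).1 (val e).2)).
  - by apply: pfun_gram => //; exact: mxpfun_cst.
  - by apply: pfun_gram => //; [exact: mxpfun_tr|exact: mxpfun_cst].
  - by rewrite fill_id// -unitfE -unitmxE.
  - rewrite fill_id ?trmxK -?unitfE -?unitmxE// => i j Pij.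
    by rewrite mxE M2P// mxE.
have [M0 [M0P dM0]] : exists M0 : 'M[R]_n, (forall i j, ~~ P i j -> M0 i j = 0) /\
    \det (gram M0 b0) * \det (gram M0^T c0) != 0.
  by exists (fill x0); split=> // i j; exact: fill_out.
(* One link is chosen for each entry that only feedback can provide, so that with unit actuators and
   sensors [K0] supplies exactly the entries of [M0] outside the pattern of [A]. *)
pose L i j := odflt (s0, l0)
   [pick e in (K :\: J)%SET | (g e.1 == j) && (f e.2 == i)].
have LKJ i j : L i j \in (K :\: J)%SET by rewrite /L; case: pickP => [e /andP[]|].
have LP i j : P i j -> ~~ A i j -> g (L i j).1 = j /\ f (L i j).2 = i.
  rewrite mxE /closed_loop => /orP[->//|/existsP[e /and3P[eK ge fe]]] _.
  rewrite /L; case: pickP => [e' /andP[_ /andP[/eqP ? /eqP ?]]//|/(_ e)].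
  by rewrite eK ge fe.
pose K0 : 'M[R]_(b, c) := \sum_(q : 'I_n * 'I_n | ~~ A q.1 q.2)
   M0 q.1 q.2 *: delta_mx (L q.1 q.2).2 (L q.1 q.2).1.
have K0gain : gains K J K0.
  move=> l t H; rewrite /K0 summxE big1// => q _; rewrite !mxE.
  case: eqP => [E1|_]; case: eqP => [E2|_]; rewrite ?mulr0//.
  have := LKJ q.1 q.2; rewrite (surjective_pairing (L _ _)) -E1 -E2 inE.
  by case: H => [/negbTE ->|->]; rewrite ?andbF.
pose K1 := K0 + delta_mx l0 s0.
have K1gain : gains K J K1.
  move=> l t H; rewrite /K1 mxE K0gain// add0r mxE.
  case: eqP => [E1|//]; case: eqP => [E2|//].
  by move: e0; rewrite -E1 -E2 inE; case: H => [/negbTE ->|->]; rewrite ?andbF.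
pose Ax (x : sp -> R) := fill (x \o inl \o inl).
pose Bx (x : sp -> R) := fill (x \o inl \o inr).
pose Cx (x : sp -> R) := fill (x \o inr).
pose Mx x := Ax x + Bx x *m K0 *m Cx x.
have BxP x i l : i != f l -> Bx x i l = 0.
  by move=> il; apply: fill_out; rewrite mxE.
have CxP x t j : j != g t -> Cx x t j = 0.
  by move=> jt; apply: fill_out; rewrite mxE.
(* The last factor is the size of the perturbation along the link, which has to be nonzero. *)
pose F x := \det (gram (Mx x) b0) * \det (gram (Mx x)^T c0) *
   (Bx x (f l0) l0 * Cx x s0 (g s0)).
have pMx : mxpfun Mx.
  apply: mxpfun_add; first exact: (mxpfun_fill (inl \o inl)).
  apply: mxpfun_mul; last exact: mxpfun_fill.
  by apply: mxpfun_mul; [exact: (mxpfun_fill (inl \o inr))|exact: mxpfun_cst].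
have pF : pfun F.
  apply: pfun_mul; first apply: pfun_mul.
  - by apply: pfun_gram => //; exact: mxpfun_cst.
  - by apply: pfun_gram; [exact: mxpfun_tr|exact: mxpfun_cst].
  - apply: pfun_mul; first exact: (mxpfun_fill (inl \o inr)).
    exact: (mxpfun_fill inr).
pose A0 : 'M[R]_n := \matrix_(i, j) if A i j then M0 i j else 0.
pose y (e : sp) : R := match e with
  | inl (inl e) => A0 (val e).1 (val e).2
  | inl (inr e) => unit_actuators f (val e).1 (val e).2
  | inr e => (unit_actuators g)^T (val e).1 (val e).2 end.
have Ay : Ax y = A0.
  rewrite /Ax (_ : y \o inl \o inl = fun e => A0 (val e).1 (val e).2)// fill_id//.
  by move=> i j /negbTE Aij; rewrite mxE Aij.
have By : Bx y = unit_actuators f.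
  rewrite /Bx (_ : y \o inl \o inr = fun e => unit_actuators f (val e).1 (val e).2)// fill_id//.
  by move=> i j; rewrite !mxE => /negbTE ->.
have Cy : Cx y = (unit_actuators g)^T.
  rewrite /Cx (_ : y \o inr = fun e => (unit_actuators g)^T (val e).1 (val e).2)// fill_id//.
  by move=> i j; rewrite !mxE => /negbTE ->.
have My : Mx y = M0.
  have B1 i l : i != f l -> unit_actuators f i l = 0 :> R by rewrite mxE => /negbTE ->.
  have C1 t j : j != g t -> (unit_actuators g)^T t j = 0 :> R by rewrite !mxE => /negbTE ->.
  rewrite /Mx Ay By Cy /K0 mulmx_sumr mulmx_suml.
  rewrite (eq_bigr (fun q => M0 q.1 q.2 *: delta_mx q.1 q.2)); last first.
    move=> q nA; rewrite -scalemxAr -scalemxAl.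
    have [Pq|Pq] := boolP (P q.1 q.2); last by rewrite M0P// !scale0r.
    rewrite (mul_delta_link _ _ B1 C1); have [E1 E2] := LP _ _ Pq nA.
    by rewrite !mxE !eqxx mulr1 scale1r E1 E2.
  apply/matrixP => i j; rewrite mxE summxE !mxE.
  rewrite (eq_bigr (fun q => M0 q.1 q.2 * (q == (i, j))%:R)); last first.
    by move=> [q1 q2] _; rewrite !mxE xpair_eqE (eq_sym i) (eq_sym j).
  case: ifP => Aij.
    rewrite big1 ?addr0// => q nA; case: eqP => [E|_]; last by rewrite mulr0.
    by rewrite E Aij in nA.
  rewrite (bigD1 (i, j)) ?Aij//= eqxx mulr1 big1 ?addr0 ?add0r// => q /andP[_ /negbTE ->].
  by rewrite mulr0.
have Fy : F y != 0 by rewrite /F My By Cy !mxE !eqxx !mulr1.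
move=> /(pfun_neq0_not_null pF Fy); apply=> x Fx [z zx].
move: Fx; rewrite /F !mulf_eq0 !negb_or => /andP[/andP[d1 d2] /andP[bx cx]].
have := zx K0 K0gain; have := zx K1 K1gain.
rewrite /spectrum /= /K1 mulmxDr mulmxDl addrA.
rewrite (mul_delta_link _ _ (BxP x) (CxP x)) => E1 E0.
apply: (pbh_no_common_eigenvalue (mulf_neq0 bx cx) _ _ E0 E1).
  by apply: gram_unit_pbh; rewrite unitmxE unitfE.
by apply: gram_unit_pbh; rewrite unitmxE unitfE.
Qed.

End FixedModes.

(** * Lower bounds for feasible designs *)

Section Necessity.
Context {R : realType}.
Local Open Scope set_scope.
Local Notation toC := (map_mx (real_complex R : R -> R[i])).

(** Row vectors supported in [S] form a subspace stable under [M], which contains an eigenvector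
    [v]. As the rows of [N] in [S] are zero, [v N = 0] and the eigenvalue is kept. *)
Lemma common_left_eigenvalue n (M : 'M[R]_n) (S : {set 'I_n}) x : x \in S ->
  (forall i j, i \in S -> j \notin S -> M i j = 0) ->
  exists z, forall N : 'M[R]_n, (forall i j, i \in S -> N i j = 0) ->
    eigenvalue (toC (M + N)) z.
Proof.
move=> xS MS; pose U : 'M[R[i]]_n := \matrix_(i, j) ((i == j) && (i \in S))%:R.
have US m (w : 'M[R[i]]_(m, n)) i j : (w *m U) i j = w i j * (j \in S)%:R.
  rewrite mxE (bigD1 j)//= big1 ?addr0 => [|k kj]; first by rewrite mxE eqxx.
  by rewrite mxE (negbTE kj) mulr0.
have U0 : U != 0.
  by apply/eqP => /matrixP/(_ x x)/eqP; rewrite !mxE eqxx xS oner_eq0.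
have UM : (U *m toC M <= U)%MS.
  apply/submxP; exists (U *m toC M); apply/matrixP => i j; rewrite US.
  have [jS|jS] := boolP (j \in S); first by rewrite mulr1.
  rewrite mulr0 mxE big1// => k _; rewrite !mxE.
  have [<-|] := eqVneq i k; last by rewrite mul0r.
  by case: (boolP (i \in S)) => iS; rewrite ?mul0r// MS// rmorph0 mulr0.
have [v [z [v0 /submxP[D vD] vM]]] := stable_eigenvector U0 UM.
have vS j : j \notin S -> v 0 j = 0 by move=> jS; rewrite vD US (negbTE jS) mulr0.
exists z => N NS; apply/eigenvalueP; exists v => //.
rewrite map_mxD mulmxDr vM (_ : v *m toC N = 0) ?addr0//.
apply/rowP => j; rewrite !mxE big1// => i _; rewrite mxE.
by have [iS|/vS ->] := boolP (i \in S); rewrite ?mul0r// NS// rmorph0 mulr0.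
Qed.

Lemma almost_all_true (I : finType) (P : (I -> R) -> Prop) : (forall x, P x) -> almost_all P.
Proof. by move=> H; apply: null_empty => x /=; apply; exact: H. Qed.

Lemma almost_all_exists (I : finType) (P : (I -> R) -> Prop) : almost_all P -> exists x, P x.
Proof.
move=> H; apply: contrapT => nP; move: H.
apply: (pfun_neq0_not_null (F := fun=> 1) (z := fun=> 0) (pfun_cst _ 1) (oner_neq0 _)).
by move=> x _ Px; apply: nP; exists x.
Qed.

Lemma unactuated_fixed_modes n (A : 'M[bool]_n) b c (f : 'I_b -> 'I_n) (g : 'I_c -> 'I_n)
    (K J : {set 'I_c * 'I_b}) (S : {set 'I_n}) x : x \in S ->
  (forall i j, i \in S -> A i j -> j \in S) ->
  (forall e, e \in K -> e \notin J -> f e.2 \notin S) ->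
  resilient_fixed_modes R A (actuator_matrix f) (sensor_matrix g) K J.
Proof.
move=> xS AS KS; apply: almost_all_true => y.
have [|z zP] := @common_left_eigenvalue _ (fill (y \o inl \o inl)) S x xS.
  by move=> i j iS jS; rewrite fill_out//; apply: contra jS; exact: AS.
exists z => G GKJ; rewrite /spectrum /=; apply: zP => i j iS.
rewrite -mulmxA mxE big1// => l _.
have [il|il] := eqVneq i (f l); last by rewrite fill_out ?mul0r// mxE.
rewrite [X in _ * X]mxE big1 ?mulr0// => t _; rewrite GKJ ?mul0r//.
have [tK|] := boolP ((t, l) \in K); last by left.
right; apply: contraLR iS => tJ; rewrite il; exact: (KS _ tK tJ).
Qed.

Lemma unsensed_fixed_modes n (A : 'M[bool]_n) b c (f : 'I_b -> 'I_n) (g : 'I_c -> 'I_n)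
    (K J : {set 'I_c * 'I_b}) (S : {set 'I_n}) x : x \in S ->
  (forall i j, j \in S -> A i j -> i \in S) ->
  (forall e, e \in K -> e \notin J -> g e.1 \notin S) ->
  resilient_fixed_modes R A (actuator_matrix f) (sensor_matrix g) K J.
Proof.
move=> xS AS KS; apply: almost_all_true => y.
have [|z zP] := @common_left_eigenvalue _ (fill (y \o inl \o inl))^T S x xS.
  by move=> i j iS jS; rewrite mxE fill_out//; apply: contra jS; exact: AS.
exists z => G GKJ; rewrite /spectrum /= -eigenvalue_tr map_trmx linearD /=.
apply: zP => i j iS; rewrite mxE mxE big1// => t _.
have [it|it] := eqVneq i (g t); last by rewrite [X in _ * X]fill_out ?mulr0// mxE.
rewrite mxE big1 ?mul0r// => l _; rewrite GKJ ?mulr0//.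
have [tK|] := boolP ((t, l) \in K); last by left.
right; apply: contraLR iS => tJ; rewrite it; exact: (KS _ tK tJ).
Qed.

(** Starting from 0, the ancestors of a state that no actuator reaches stay at 0, so the vector of
    ones is never attained. *)
Lemma ctrl_dedicated_cover n (A : 'M[bool]_n) b (f : 'I_b -> 'I_n) :
  ctrl_dedicated R A f -> forall x, exists l, connect (edge A) (f l) x.
Proof.
move=> /almost_all_exists[y ctrl] x; apply: contrapT => nl.
have [t [u /matrixP/(_ x 0)/eqP]] := ctrl 0 (const_mx 1).
rewrite mxE; suff H : forall i, connect (edge A) i x ->
    trajectory (fill (y \o inl)) (fill (y \o inr)) u 0 t i 0 = 0.
  by rewrite H// eq_sym oner_eq0.
elim: t => [|t IH] i ix /=; first by rewrite mxE.
rewrite mxE [X in X + _]mxE [X in _ + X]mxE !big1 ?addr0// => j _.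
  rewrite fill_out ?mul0r// mxE; apply/eqP => E; apply: nl; exists j.
  by rewrite -E.
have [Aij|Aij] := boolP (A i j); last by rewrite fill_out ?mul0r.
by rewrite IH ?mulr0// (connect_trans _ ix)// connect1.
Qed.

(** The unit vector at [x] spreads only to descendants of [x]; if none of them is sensed, it cannot
    be told from 0. *)
Lemma obs_dedicated_cover n (A : 'M[bool]_n) c (g : 'I_c -> 'I_n) :
  obs_dedicated R A g -> forall x, exists s, connect (edge A) x (g s).
Proof.
move=> /almost_all_exists[y obs] x; apply: contrapT => ns.
have suppx t : forall i, ~~ connect (edge A) x i ->
    iter t (mulmx (fill (y \o inl))) (delta_mx x 0 : 'cV[R]_n) i 0 = 0.
  elim: t => [|t IH] i xi /=.
    by rewrite mxE; case: eqP => // E; rewrite E connect0 in xi.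
  rewrite mxE big1// => j _; have [Aij|Aij] := boolP (A i j); last by rewrite fill_out ?mul0r.
  by rewrite IH ?mulr0//; apply: contra xi => xj; rewrite (connect_trans xj)// connect1.
suff : delta_mx x 0 = 0 :> 'cV[R]_n.
  by move=> /matrixP/(_ x 0)/eqP; rewrite !mxE !eqxx oner_eq0.
apply: obs => t.
have -> : iter t (mulmx (fill (y \o inl))) 0 = 0 :> 'cV[R]_n.
  by elim: t => //= t ->; rewrite mulmx0.
rewrite mulmx0; apply/matrixP => s j; rewrite ord1 mxE [RHS]mxE big1// => i _.
have [is_|is_] := eqVneq i (g s); last by rewrite fill_out ?mul0r// mxE.
by rewrite suppx ?mulr0// is_; apply/negP => xs; apply: ns; exists s.
Qed.

(** This amounts to one vertex from each source component, without mentioning components. For the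
    transposed digraph it describes the sinks. *)
Definition source_basis (T : finType) (e : rel T) (B : seq T) : Prop :=
  [/\ uniq B, forall x, exists2 r, r \in B & connect e r x
    & {in B &, forall r r', connect e r r' -> r = r'}].

(** No vertex reaches two members of [B]: the member that reaches this vertex would reach both and
    so equal both. Hence the sets counted in the hypothesis are disjoint. *)
Lemma source_basis_count (T X : finType) (e : rel T) (B : seq T) (h : X -> T)
    (E : {set X}) q : source_basis e B ->
  (forall r, r \in B -> (q <= #|[set l in E | connect e (h l) r]|)%N) ->
  (q * size B <= #|E|)%N.
Proof.
move=> [uB cov anti] H.
have le1 x : (count (connect e x) B <= 1)%N.
  rewrite leqNgt -size_filter; apply/negP; have := filter_uniq (connect e x) uB.
  case E' : (seq.filter _ B) => [|r [|r' l]]//= /andP[]; rewrite inE negb_or => /andP[rr' _] _ _.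
  have mem t : t \in r :: r' :: l -> connect e x t /\ t \in B.
    by rewrite -E' mem_filter => /andP[].
  have [xr rB] := mem r (mem_head _ _).
  have [|xr' rB'] := mem r'; first by rewrite !inE eqxx orbT.
  have [r0 r0B r0x] := cov x.
  have E1 := anti _ _ r0B rB (connect_trans r0x xr).
  have E2 := anti _ _ r0B rB' (connect_trans r0x xr').
  by rewrite -E1 -E2 eqxx in rr'.
rewrite (@leq_trans (\sum_(r <- B) #|[set l in E | connect e (h l) r]|)%N)//.
  rewrite mulnC -[X in (X <= _)%N](_ : \sum_(r <- B) q = _)%N; last first.
    by rewrite big_const_seq count_predT iter_addn_0 mulnC.
  by rewrite big_seq_cond [X in (_ <= X)%N]big_seq_cond leq_sum// => r /andP[/H].
rewrite (eq_bigr (fun r => \sum_(l in E) connect e (h l) r))%N; last first.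
  move=> r _; rewrite -sum1_card big_mkcond [RHS]big_mkcond /=; apply: eq_bigr => l _.
  by rewrite inE; case: (l \in E) => //=; case: connect.
rewrite exchange_big /= -sum1_card leq_sum// => l _.
by rewrite (leq_trans _ (le1 (h l)))// -sum1_count [X in (_ <= X)%N]big_mkcond leq_sum.
Qed.

Context {n k b c : nat} (A : 'M[bool]_n) (f : 'I_b -> 'I_n) (g : 'I_c -> 'I_n)
  (K : {set 'I_c * 'I_b}).
Hypothesis feas : P2_feasible R A k f g K.

(** If at most [k] actuators reached [r], their failure would leave the ancestors of [r] without
    actuators, hence with fixed modes. The next three bounds vary what fails and the direction of
    the edges. *)
Lemma feasible_actuators B : source_basis (edge A) B ->
  (k.+1 * size B <= b)%N.
Proof.
move=> bB; rewrite -[X in (_ <= X)%N]card_ord -cardsT.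
apply: (source_basis_count (h := f) bB) => r rB; rewrite ltnNge; apply/negP => le_k.
apply: (@feas finset.set0 [set l in [set: 'I_b] | connect (edge A) (f l) r] finset.set0).
- exact: finset.sub0set.
- by rewrite !cards0 add0n addn0.
apply: (@unactuated_fixed_modes _ _ _ _ _ _ _ _ [set y | connect (edge A) y r] r).
- by rewrite inE connect0.
- by move=> i j; rewrite !inE => ir Aij; rewrite (connect_trans _ ir)// connect1.
- move=> [t l] _ _; rewrite !inE /= /subcollection.
  by have := enum_valP l; rewrite !inE.
Qed.

Lemma feasible_sensors B : source_basis (edge A^T) B ->
  (k.+1 * size B <= c)%N.
Proof.
move=> bB; rewrite -[X in (_ <= X)%N]card_ord -cardsT.
apply: (source_basis_count (h := g) bB) => r rB; rewrite ltnNge; apply/negP => le_k.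
apply: (@feas finset.set0 finset.set0 [set l in [set: 'I_c] | connect (edge A^T) (g l) r]).
- exact: finset.sub0set.
- by rewrite !cards0 !add0n.
apply: (@unsensed_fixed_modes _ _ _ _ _ _ _ _ [set y | connect (edge A^T) y r] r).
- by rewrite inE connect0.
- by move=> i j; rewrite !inE => ir Aij; rewrite (connect_trans _ ir)// connect1// /edge mxE.
- move=> [t l] _ _; rewrite !inE /= /subcollection.
  by have := enum_valP t; rewrite !inE.
Qed.

Lemma feasible_links B : source_basis (edge A) B ->
  (k.+1 * size B <= #|K|)%N.
Proof.
move=> bB.
apply: (source_basis_count (h := fun e => f e.2) bB) => r rB; rewrite ltnNge; apply/negP => le_k.
apply: (@feas [set e in K | connect (edge A) (f e.2) r] finset.set0 finset.set0).
- by apply/fintype.subsetP => e; rewrite inE => /andP[].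
- by rewrite !cards0 !addn0.
apply: (@unactuated_fixed_modes _ _ _ _ _ _ _ _ [set y | connect (edge A) y r] r).
- by rewrite inE connect0.
- by move=> i j; rewrite !inE => ir Aij; rewrite (connect_trans _ ir)// connect1.
- by move=> [t l]; rewrite !inE /= /subcollection => ->.
Qed.

Lemma feasible_links_sensors B : source_basis (edge A^T) B ->
  (k.+1 * size B <= #|K|)%N.
Proof.
move=> bB.
apply: (source_basis_count (h := fun e => g e.1) bB) => r rB; rewrite ltnNge; apply/negP => le_k.
apply: (@feas [set e in K | connect (edge A^T) (g e.1) r] finset.set0 finset.set0).
- by apply/fintype.subsetP => e; rewrite inE => /andP[].
- by rewrite !cards0 !addn0.
apply: (@unsensed_fixed_modes _ _ _ _ _ _ _ _ [set y | connect (edge A^T) y r] r).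
- by rewrite inE connect0.
- by move=> i j; rewrite !inE => ir Aij; rewrite (connect_trans _ ir)// connect1// /edge mxE.
- by move=> [t l]; rewrite !inE /= /subcollection => ->.
Qed.

End Necessity.

(** * Representatives of the source components *)

Lemma pairwise_rev (T : Type) (r : rel T) s :
  pairwise r (rev s) = pairwise (fun x y => r y x) s.
Proof.
elim: s => //= x s IH; rewrite rev_cons -cats1 pairwise_cat IH /= andbT allrel1r.
by rewrite all_rev.
Qed.

Lemma connect_hom (T U : finType) (e : rel T) (e' : rel U) (h : T -> U) :
  (forall x y, e x y -> connect e' (h x) (h y)) ->
  forall x y, connect e x y -> connect e' (h x) (h y).
Proof.
move=> H x y /connectP[p]; elim: p x => [|z p IH] x /=; first by move=> _ ->.
by move=> /andP[/H xz pz] yl; exact: connect_trans xz (IH _ pz yl).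
Qed.

Lemma connect_invariant (T : finType) (e : rel T) (P : T -> Prop) :
  (forall x y, P x -> e x y -> P y) -> forall x y, connect e x y -> P x -> P y.
Proof.
move=> H x y /connectP[p]; elim: p x => [|z p IH] x /=; first by move=> _ ->.
by move=> /andP[xz pz] yl Px; exact: IH pz yl (H _ _ Px xz).
Qed.

Section Greedy.
Context {T : finType} (e : rel T).

Definition greedy_add (acc : seq T) (r : T) : seq T :=
  if has (fun s => connect e s r) acc then acc else rcons acc r.

Definition greedy (o : seq T) : seq T := foldl greedy_add [::] o.

Lemma greedy_rcons o r : greedy (rcons o r) = greedy_add (greedy o) r.
Proof. by rewrite /greedy -cats1 foldl_cat. Qed.

Lemma greedy_subseq o : subseq (greedy o) o.
Proof.
elim/last_ind: o => //= o r IH; rewrite greedy_rcons /greedy_add -!cats1.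
case: ifP => _; first exact: subseq_trans IH (prefix_subseq _ _).
exact: cat_subseq.
Qed.

Lemma greedy_cover o r : r \in o -> exists2 s, s \in greedy o & connect e s r.
Proof.
elim/last_ind: o => //= o t IH; rewrite greedy_rcons /greedy_add mem_rcons inE.
case: ifP => [/hasP[s sB st]|_] /orP[/eqP->|/IH[s' s'B s'r]].
- by exists s.
- by exists s'.
- by exists t; rewrite ?connect0// mem_rcons mem_head.
- by exists s'; rewrite // mem_rcons inE s'B orbT.
Qed.

Lemma greedy_pairwise o : pairwise (fun s t => ~~ connect e s t) (greedy o).
Proof.
elim/last_ind: o => //= o t IH; rewrite greedy_rcons /greedy_add.
case: ifP => // /negbT; rewrite -all_predC => H.
by rewrite -cats1 pairwise_cat IH /= allrel1r H.
Qed.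

(* The first pass leaves roots none of which reaches a later one; the second,
   in the opposite order, discards those reached from a later one. *)
Lemma greedy2_source_basis o : (forall x, x \in o) ->
  source_basis e (greedy (rev (greedy o))).
Proof.
move=> oT; set B1 := greedy o; set B2 := greedy (rev B1).
have p2 : pairwise (fun s t => ~~ connect e s t) B2 := greedy_pairwise _.
have p1 : pairwise (fun s t => ~~ connect e t s) B2.
  apply: subseq_pairwise (greedy_subseq _) _.
  by rewrite pairwise_rev; exact: greedy_pairwise.
split.
- rewrite uniq_pairwise; apply: sub_pairwise p2 => s t; apply: contra => /eqP ->.
  exact: connect0.
- move=> x; have [s sB sx] := greedy_cover (oT x).
  have [|t tB ts] := @greedy_cover (rev B1) s; first by rewrite mem_rev.
  by exists t => //; exact: connect_trans ts sx.
- move=> r r'; elim: B2 p1 p2 => //= x B IH /andP[/allP a1 p1] /andP[/allP a2 p2].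
  rewrite !inE => /predU1P[->|rB] /predU1P[->|rB'] // c.
  + by have := a2 _ rB'; rewrite c.
  + by have := a1 _ rB; rewrite c.
  + exact: IH.
Qed.

Lemma source_basis_exists : exists B, source_basis e B.
Proof.
exists (greedy (rev (greedy (enum T)))); apply: greedy2_source_basis => x.
by rewrite mem_enum.
Qed.

End Greedy.

(** * Strong connectivity of the closed loop *)

Section ClosedLoop.
Local Open Scope set_scope.
Context {n b c : nat} (A : 'M[bool]_n) (f : 'I_b -> 'I_n) (g : 'I_c -> 'I_n).

(** The cyclic pairing joins all matched labels. An unmatched actuator enters this core through a
    matched sensor that it reaches, and is itself entered by a link from some sensor, matched or
    not, which the core reaches; dually for unmatched sensors. *)
Lemma closed_loop_strong (K : {set 'I_c * 'I_b}) (SB : {set 'I_b}) (SC : {set 'I_c})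
    (M : seq ('I_b * 'I_c)) :
  (forall x, exists2 i, i \in SB & connect (edge A) (f i) x) ->
  (forall x, exists2 j, j \in SC & connect (edge A) x (g j)) ->
  (forall e, e \in M -> connect (edge A) (f e.1) (g e.2)) ->
  path.cycle (fun e e' : 'I_b * 'I_c => (e.2, e'.1) \in K) M ->
  (forall i, i \in SB -> i \notin unzip1 M ->
     (exists2 e, e \in M & connect (edge A) (f i) (g e.2)) /\
     exists2 j, j \in SC & (j, i) \in K) ->
  (forall j, j \in SC -> j \notin unzip2 M ->
     (exists2 e, e \in M & connect (edge A) (f e.1) (g j)) /\
     exists2 i, i \in SB & (j, i) \in K) ->
  forall x y, connect (closed_loop A f g K) x y.
Proof.
move=> covB covC MA cyc HB HC.
have edgeS x y : connect (edge A) x y -> connect (closed_loop A f g K) x y.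
  by apply: connect_sub => i j ij; apply: connect1; rewrite /closed_loop [A _ _]ij.
have linkS j i : (j, i) \in K -> connect (closed_loop A f g K) (g j) (f i).
  move=> jiK; apply: connect1; apply/orP; right; apply/existsP; exists (j, i).
  by rewrite jiK !eqxx.
have core e e' : e \in M -> e' \in M -> connect (closed_loop A f g K) (f e.1) (f e'.1).
  move=> eM e'M.
  have cyc' : path.cycle [rel e e' : 'I_b * 'I_c | ((e.2, e'.1) \in K) && (e \in M)] M.
    apply: (sub_in_cycle (P := [in M]) _ _ cyc); last by apply/allP.
    by move=> u v /= uM _ ->.
  apply: (connect_hom (h := fun e => f e.1)) (connect_cycle cyc' eM e'M).
  move=> u w /= /andP[uw uM]; exact: connect_trans (edgeS _ _ (MA _ uM)) (linkS _ _ uw).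
have inM1 i : i \in unzip1 M -> exists2 e, e \in M & f i = f e.1.
  by move=> /mapP[e eM ->]; exists e.
have inM2 j : j \in unzip2 M -> exists2 e, e \in M & g j = g e.2.
  by move=> /mapP[e eM ->]; exists e.
have toM i : i \in SB -> exists2 e, e \in M & connect (closed_loop A f g K) (f i) (f e.1).
  move=> iB; have [/inM1[e eM ->]|/(HB _ iB)[[e eM /edgeS ie] _]] := boolP (i \in unzip1 M).
    by exists e.
  have eN : next M e \in M by rewrite mem_next.
  exists (next M e) => //; apply: connect_trans ie (linkS _ _ _).
  exact: (next_cycle cyc eM).
have fromM j : j \in SC -> exists2 e, e \in M & connect (closed_loop A f g K) (f e.1) (g j).
  move=> jC; have [/inM2[e eM ->]|/(HC _ jC)[[e eM /edgeS ej] _]] := boolP (j \in unzip2 M).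
    by exists e => //; apply/edgeS/MA.
  by exists e.
have toB i : i \in SB -> exists2 e, e \in M & connect (closed_loop A f g K) (f e.1) (f i).
  move=> iB; have [/inM1[e eM ->]|/(HB _ iB)[_ [j jC /linkS ji]]] := boolP (i \in unzip1 M).
    by exists e.
  by have [e eM ej] := fromM j jC; exists e => //; exact: connect_trans ej ji.
have fromC j : j \in SC -> exists2 e, e \in M & connect (closed_loop A f g K) (g j) (f e.1).
  move=> jC; have [/inM2[e eM ->]|/(HC _ jC)[_ [i iB /linkS ji]]] := boolP (j \in unzip2 M).
    exists (next M e); first by rewrite mem_next.
    exact/linkS/(next_cycle cyc eM).
  by have [e eM ie] := toM i iB; exists e => //; exact: connect_trans ji ie.
move=> x y; have [j jC /edgeS xj] := covC x; have [i iB /edgeS iy] := covB y.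
have [e eM je] := fromC j jC; have [e' e'M ei] := toB i iB.
exact: connect_trans xj (connect_trans je (connect_trans (core _ _ eM e'M) (connect_trans ei iy))).
Qed.

End ClosedLoop.

(** * Optimality of Procedure 1 *)

Section Feasible.
Context {R : realType}.
Local Open Scope set_scope.

(** As the blocks are disjoint, a failure spoils at most one of them. *)
Lemma hit_blocks_card (X : finType) q (P : 'I_q -> pred X) (J : {set X}) :
  (forall x i i', P i x -> P i' x -> i = i') ->
  (#|[set i | [exists x in J, P i x]]| <= #|J|)%N.
Proof.
move=> disj; case: q P disj => [|q] P disj.
  by rewrite (leq_trans (max_card _))// card_ord.
pose h x := odflt ord0 [pick i | P i x].
apply: leq_trans (leq_imset_card h J); apply/subset_leq_card/fintype.subsetP => i.
rewrite inE => /existsP[x /andP[xJ Px]]; apply/imsetP; exists x => //.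
by rewrite /h; case: pickP => [i' Px'|/(_ i)]; [exact: disj Px Px'|rewrite Px].
Qed.

Lemma feasible_of_blocks n (A : 'M[bool]_n) k b c (f : 'I_b -> 'I_n) (g : 'I_c -> 'I_n)
    (K : {set 'I_c * 'I_b}) (Ki : 'I_k.+1 -> {set 'I_c * 'I_b})
    (SB : 'I_k.+1 -> {set 'I_b}) (SC : 'I_k.+1 -> {set 'I_c}) :
  has_perfect_matching (state_bipartite A) ->
  (forall l i i', l \in SB i -> l \in SB i' -> i = i') ->
  (forall s i i', s \in SC i -> s \in SC i' -> i = i') ->
  (forall i e, e \in Ki i -> [/\ e.1 \in SC i, e.2 \in SB i & e \in K]) ->
  (forall i x y, connect (closed_loop A f g (Ki i)) x y) ->
  ((0 < n)%N -> forall i, exists e, e \in Ki i) ->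
  P2_feasible R A k f g K.
Proof.
move=> PM dB dC KiP conn link J JB JC JK cJ.
pose badJ := [set i | [exists e in J, e \in Ki i]].
pose badB := [set i | [exists l in JB, l \in SB i]].
pose badC := [set i | [exists s in JC, s \in SC i]].
have [i ] : exists i, i \notin badJ :|: badB :|: badC.
  apply/existsP; rewrite -negb_forall; apply/negP => /forallP all_bad.
  have : (k.+1 <= #|badJ :|: badB :|: badC|)%N.
    rewrite -[X in (X <= _)%N]card_ord; apply/subset_leq_card/fintype.subsetP => i _.
    exact: all_bad.
  apply/negP; rewrite -ltnNge ltnS (leq_trans _ cJ)//.
  rewrite (leq_trans (leq_card_setU _ _))// leq_add//; last exact: hit_blocks_card.
  rewrite (leq_trans (leq_card_setU _ _))// leq_add//; last exact: hit_blocks_card.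
  apply: hit_blocks_card => e i i' /KiP[ei _ _] /KiP[ei' _ _]; exact: dC ei ei'.
rewrite !inE !negb_or => /andP[/andP[iJ iB] iC].
have alive e : e \in Ki i -> exists e', [/\ e' \in
    (sublinks (~: JC) (~: JB) K :\: sublinks (~: JC) (~: JB) J),
    enum_val e'.1 = e.1 & enum_val e'.2 = e.2].
  move=> eKi; have [eC eB eK] := KiP _ _ eKi.
  have e1 : e.1 \in ~: JC.
    by rewrite inE; apply: contra iC => e1; apply/existsP; exists e.1; rewrite e1.
  have e2 : e.2 \in ~: JB.
    by rewrite inE; apply: contra iB => e2; apply/existsP; exists e.2; rewrite e2.
  exists (enum_rank_in e1 e.1, enum_rank_in e2 e.2) => /=.
  rewrite !enum_rankK_in//; split=> //.
  rewrite !inE /= !enum_rankK_in// -surjective_pairing eK andbT.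
  by apply: contra iJ => eJ; apply/existsP; exists e; rewrite eJ.
apply: no_resilient_fixed_modes => // [x y|n0].
  apply: connect_sub (conn i x y) => u w; rewrite /closed_loop => /orP[Auw|].
    by apply: connect1; rewrite Auw.
  move=> /existsP[e /and3P[/alive[e' [e'K E1 E2]] /eqP <- /eqP <-]].
  apply/connect1/orP; right; apply/existsP; exists e'.
  by rewrite e'K /subcollection E1 E2 !eqxx.
by have [e /alive[e' [e'K _ _]]] := link n0 i; exists e'.
Qed.

Lemma P2_solution_of_bases n (A : 'M[bool]_n) k b c (f : 'I_b -> 'I_n) (g : 'I_c -> 'I_n)
    (K : {set 'I_c * 'I_b}) BA BC :
  source_basis (edge A) BA -> source_basis (edge A^T) BC ->
  P2_feasible R A k f g K -> (b <= k.+1 * size BA)%N -> (c <= k.+1 * size BC)%N ->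
  (#|K| <= k.+1 * maxn (size BA) (size BC))%N ->
  P2_solution R A k f g K.
Proof.
move=> bA bC feas bb cc KK; split=> // b' c' f' g' K' feas'.
rewrite leq_add ?leq_add//.
- exact: leq_trans bb (feasible_actuators feas' bA).
- exact: leq_trans cc (feasible_sensors feas' bC).
- rewrite (leq_trans KK)// maxnMr geq_max.
  by rewrite (feasible_links feas' bA) (feasible_links_sensors feas' bC).
Qed.

(** No edge enters an actuator vertex and none leaves a sensor vertex, so a path from the one to the
    other runs through states. *)
Lemma connect_system n (A : 'M[bool]_n) b c (f : 'I_b -> 'I_n) (g : 'I_c -> 'I_n) i j :
  connect (system_digraph A (actuator_matrix f) (sensor_matrix g))
    (actuator_vertex i) (sensor_vertex j) = connect (edge A) (f i) (g j).
Proof.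
set D := system_digraph _ _ _; apply/idP/idP => [|ij].
  pose P (v : vertex n b c) : Prop := match v with
    | inl (inl x) => connect (edge A) (f i) x
    | inl (inr l) => l = i
    | inr s => connect (edge A) (f i) (g s) end.
  move=> /(connect_invariant (P := P)); apply=> // v w.
  case: v => [[x|l]|s]; case: w => [[y|l']|s'] //=.
  - by move=> ix xy; exact: connect_trans ix (connect1 (xy : edge A x y)).
  - by move=> ix; rewrite mxE => /eqP <-.
  - by move=> ->; rewrite mxE => /eqP ->; exact: connect0.
have e1 : connect D (actuator_vertex i) (state_vertex (f i)).
  by apply: connect1; rewrite /D /= mxE.
have e2 : connect D (state_vertex (g j)) (sensor_vertex j).
  by apply: connect1; rewrite /D /= mxE.
apply: connect_trans e1 (connect_trans _ e2).
by apply: connect_hom ij => x y xy; apply: connect1.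
Qed.

Lemma zip_rot_cycle (T1 T2 : eqType) (M : seq (T1 * T2)) (K : pred (T2 * T1)) :
  {subset zip (unzip2 M) (rot 1 (unzip1 M)) <= K} ->
  path.cycle (fun e e' : T1 * T2 => (e.2, e'.1) \in K) M.
Proof.
case: M => [//|e M]; rewrite [unzip1 _]/= rot1_cons /path.cycle.
(* Freeing the endpoint [y] of the closed walk makes the induction on [M] possible. *)
suff H : forall x y, {subset zip (unzip2 (x :: M)) (rcons (unzip1 M) y.1) <= K} ->
  path (fun e e' : T1 * T2 => (e.2, e'.1) \in K) x (rcons M y) by exact: H.
elim: M => [|z M IH] x y /= H; first by rewrite H ?mem_head.
rewrite H ?mem_head//=; apply: IH => t tz; apply: H.
by rewrite inE tz orbT.
Qed.

Lemma block_card q p i : (#|block q p i| <= p)%N.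
Proof.
rewrite cardE -(size_map val) -[X in (_ <= X)%N](size_iota (i * p)).
apply: uniq_leq_size; first by rewrite map_inj_uniq ?enum_uniq//; exact: val_inj.
by move=> _ /mapP[l + ->]; rewrite mem_enum inE mem_iota mulSn addnC.
Qed.

Lemma block_disjoint q p (l : 'I_(q * p)) (i i' : 'I_q) :
  l \in block q p i -> l \in block q p i' -> i = i'.
Proof.
rewrite !inE => /andP[a1 a2] /andP[b1 b2].
have H u w : (u * p <= l)%N -> (l < w.+1 * p)%N -> (u <= w)%N.
  by move=> /leq_ltn_trans H /H; rewrite ltn_mul2r ltnS => /andP[].
by apply/eqP; rewrite -val_eqE eqn_leq (H i i' a1 b2) (H i' i b1 a2).
Qed.

End Feasible.

Section Procedure.
Local Open Scope set_scope.
Context {n b c : nat} (A : 'M[bool]_n) (f : 'I_b -> 'I_n) (g : 'I_c -> 'I_n).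
Context (SB : {set 'I_b}) (SC : {set 'I_c}) (K : {set 'I_c * 'I_b}).
Hypothesis proc : procedure1
  (system_digraph A (actuator_matrix f) (sensor_matrix g)) SB SC K.

Lemma procedure1_subset e : e \in K -> e.1 \in SC /\ e.2 \in SB.
Proof.
have [M [K' [[/and3P[/allP MD _ _] _] add ->]]] := proc.
have inM e' : e' \in M -> e'.1 \in SB /\ e'.2 \in SC by move=> /MD/and3P[].
have mem_zip (T1 T2 : eqType) (s : seq T1) (t : seq T2) u :
    u \in zip s t -> u.1 \in s /\ u.2 \in t.
  elim: s t => [|x s IH] [|y t] //=; rewrite !inE => /orP[/eqP ->|/IH[-> ->]] /=.
    by rewrite !eqxx.
  by rewrite !orbT.
rewrite !inE => /orP[/mem_zip[]|].
  by rewrite mem_rot => /mapP[e1 /inM[_ ?] ->] /mapP[e2 /inM[? _] ->].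
move: add; rewrite /additional_links; case: ifP => _ [h [hS _] ->] /imsetP[x xU ->] /=.
  by split; [move: xU; rewrite inE => /andP[]|exact: hS].
by split; [exact: hS|move: xU; rewrite inE => /andP[]].
Qed.

Lemma unmatched_card (T : finType) (S : {set T}) (s : seq T) :
  uniq s -> {subset s <= S} -> (size s + #|[set x in S | x \notin s]| = #|S|)%N.
Proof.
move=> us sS; rewrite -(card_uniqP us) -(cardsID [set x in s] S); congr (_ + _)%N.
  apply: eq_card => x; rewrite !inE; case: (boolP (x \in s)) => [/sS ->//|_].
  by rewrite andbF.
by apply: eq_card => x; rewrite !inE andbC.
Qed.

(** The larger side is what counts: the pairing has at most one link per matched pair, and the
    additional links at most one per unmatched label of that side. *)
Lemma procedure1_card : (#|K| <= maxn #|SB| #|SC|)%N.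
Proof.
have [M [K' [[/and3P[/allP MD u1 u2] _] add ->]]] := proc.
have s1 : {subset unzip1 M <= SB} by move=> _ /mapP[e /MD/and3P[eB _ _] ->].
have s2 : {subset unzip2 M <= SC} by move=> _ /mapP[e /MD/and3P[_ eC _] ->].
have cS : (#|sequential_pairing M| <= size M)%N.
  rewrite (leq_trans (_ : _ <= size (zip (unzip2 M) (rot 1 (unzip1 M)))))%N//.
    rewrite cardsE; exact: card_size.
  by rewrite size_zip size_map geq_minl.
have c1 := unmatched_card u1 s1; have c2 := unmatched_card u2 s2.
rewrite !size_map in c1 c2.
rewrite (leq_trans (leq_card_setU _ _))//.
move: add; rewrite /additional_links; case: ifP => _ [h _ ->].
  rewrite leq_max -c2; apply/orP; right; rewrite leq_add//; exact: leq_imset_card.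
rewrite leq_max -c1; apply/orP; left; rewrite leq_add//; exact: leq_imset_card.
Qed.

Lemma procedure1_strong :
  (forall x, exists2 i, i \in SB & connect (edge A) (f i) x) ->
  (forall x, exists2 j, j \in SC & connect (edge A) x (g j)) ->
  (forall x y, connect (closed_loop A f g K) x y) /\
  ((0 < n)%N -> exists e, e \in K).
Proof.
move=> covB covC.
have [M [K' [[matM maxM] add KE]]] := proc.
have /and3P[/allP MD u1 u2] := matM.
(* Otherwise the pair could be added to the matching. Maximality enters in this form: what an
   unmatched label is connected to is matched. *)
have unmatched i j : i \in SB -> j \in SC -> i \notin unzip1 M -> j \notin unzip2 M ->
    ~~ connect (edge A) (f i) (g j).
  move=> iB jC iM jM; apply/negP => ij; have := maxM ((i, j) :: M).
  rewrite /= ltnn => H; suff : false by []; apply: H.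
  rewrite /matching /= iM jM u1 u2 !andbT; apply/andP; split; last exact/allP.
  by rewrite /pairing_graph iB jC connect_system.
have linkC j : j \in SC -> j \notin unzip2 M -> exists2 i, i \in SB & (j, i) \in K.
  move=> jC jM; move: add; rewrite /additional_links.
  case: ifP => _ [h [hS hU] K'E].
    exists (h j); first by apply: hS; rewrite inE jC.
    by rewrite KE K'E inE; apply/orP; right; apply/imsetP; exists j; rewrite ?inE ?jC.
  have /imsetP[i iU jE] : j \in h @: [set i in SB | i \notin unzip1 M].
    by apply: (fintype.subsetP hU); rewrite inE jC.
  exists i; first by move: iU; rewrite inE => /andP[].
  by rewrite KE K'E inE; apply/orP; right; apply/imsetP; exists i; rewrite ?jE.
have linkB i : i \in SB -> i \notin unzip1 M -> exists2 j, j \in SC & (j, i) \in K.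
  move=> iB iM; move: add; rewrite /additional_links.
  case: ifP => _ [h [hS hU] K'E]; last first.
    exists (h i); first by apply: hS; rewrite inE iB.
    by rewrite KE K'E inE; apply/orP; right; apply/imsetP; exists i; rewrite ?inE ?iB.
  have /imsetP[j jU iE] : i \in h @: [set j in SC | j \notin unzip2 M].
    by apply: (fintype.subsetP hU); rewrite inE iB.
  exists j; first by move: jU; rewrite inE => /andP[].
  by rewrite KE K'E inE; apply/orP; right; apply/imsetP; exists j; rewrite ?iE.
split; last first.
  move=> n0; have [i iB _] := covB (Ordinal n0).
  case: M {maxM MD u1 u2 unmatched add matM} KE linkB linkC => [|e M] KE linkB linkC.
    by have [//|j _ ji] := linkB i iB; exists (j, i).
  case EM : (rot 1 (unzip1 (e :: M))) => [|i' s].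
    by move/(congr1 size): EM; rewrite size_rot.
  by exists (e.2, i'); rewrite KE !inE EM /= inE eqxx.
apply: (closed_loop_strong covB covC (M := M)).
- by move=> e /MD/and3P[_ _]; rewrite connect_system.
- apply: zip_rot_cycle => e eM; rewrite KE inE; apply/orP; left.
  by rewrite /sequential_pairing inE.
- move=> i iB iM; split; last exact: linkB.
  have [j jC ij] := covC (f i).
  have [/mapP[e eM jE]|jM] := boolP (j \in unzip2 M); first by exists e; rewrite -?jE.
  by have := unmatched i j iB jC iM jM; rewrite ij.
- move=> j jC jM; split; last exact: linkC.
  have [i iB ij] := covB (g j).
  have [/mapP[e eM iE]|iM] := boolP (i \in unzip1 M); first by exists e; rewrite -?iE.
  by have := unmatched i j iB jC iM jM; rewrite ij.
Qed.

End Procedure.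

Section Optimality.
Context {R : realType}.
Local Open Scope set_scope.

(** A source basis, read as a collection of indices, already ensures controllability. *)
Lemma ctrl_minimum_le n (A : 'M[bool]_n) p (iota0 : 'I_p -> 'I_n) B :
  has_perfect_matching (state_bipartite A) ->
  minimum_collection (fun q => @ctrl_dedicated R n q A) iota0 ->
  source_basis (edge A) B -> (p <= size B)%N.
Proof.
move=> PM [_ min0] [uB cov _]; apply: (min0 _ (tnth (in_tuple B))).
apply: ctrl_dedicated_reach => // x; have [r rB rx] := cov x.
by have /tnthP[i ri] : r \in in_tuple B := rB; exists i; rewrite -ri.
Qed.

Lemma obs_minimum_le n (A : 'M[bool]_n) m (gamma0 : 'I_m -> 'I_n) B :
  has_perfect_matching (state_bipartite A) ->
  minimum_collection (fun q => @obs_dedicated R n q A) gamma0 ->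
  source_basis (edge A^T) B -> (m <= size B)%N.
Proof.
move=> PM [_ min0] [uB cov _]; apply: (min0 _ (tnth (in_tuple B))).
apply: obs_dedicated_reach => // x; have [r rB rx] := cov x.
have /tnthP[i ri] : r \in in_tuple B := rB; exists i.
by rewrite -ri -edge_tr.
Qed.

Lemma subcollection_cover (T : finType) b (f : 'I_b -> T) (S : {set 'I_b}) (P : T -> Prop) :
  (exists l : 'I_#|S|, P (f (enum_val l))) -> exists2 i, i \in S & P (f i).
Proof. by move=> [l Pl]; exists (enum_val l) => //; exact: enum_valP. Qed.

End Optimality.

(** * Programs with time credits *)

Section Triples.
Local Open Scope nat_scope.
Implicit Types (p q : program) (s : state) (Q : nat -> state -> Prop).

(* [p] halts from [s] with at least [r] of the [c] time credits left over. *)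
Definition tri p s c Q : Prop := exists t s' r, [/\ exec p s t s', t + r <= c & Q r s'].

Lemma tri_mono p s c c' Q Q' : c <= c' -> (forall r s', Q r s' -> Q' r s') ->
  tri p s c Q -> tri p s c' Q'.
Proof.
move=> cc QQ [t [s' [r [ex le q]]]]; exists t, s', r; split; [by []| |exact: QQ].
exact: leq_trans le cc.
Qed.

Lemma tri_step p s s' c Q : exec p s 1 s' -> Q c s' -> tri p s c.+1 Q.
Proof. by exists 1, s', c. Qed.

Lemma tri_seq s c Q p q : tri p s c (fun r s' => tri q s' r Q) -> tri (Seq p q) s c Q.
Proof.
move=> [t [s1 [r [ex le [t' [s2 [r' [ex' le' q']]]]]]]].
exists (t + t'), s2, r'; split=> //; first exact: ExecSeq ex ex'.
by rewrite -addnA (leq_trans _ le)// leq_add2l.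
Qed.

Lemma tri_if s c Q x p q : (reg s x != 0 -> tri p s c Q) -> (reg s x = 0 -> tri q s c Q) ->
  tri (If x p q) s c.+1 Q.
Proof.
move=> H1 H2; have [x0|x0] := eqVneq (reg s x) 0.
  have [t [s' [r [ex le qr]]]] := H2 x0; exists t.+1, s', r; split=> //.
  exact: ExecIfFalse.
have [t [s' [r [ex le qr]]]] := H1 x0; exists t.+1, s', r; split=> //.
exact: ExecIfTrue.
Qed.

(** An over-approximation read off the program text, so that what a loop leaves unchanged is settled
    by computation. *)
Fixpoint wr_reg p : seq nat := match p with
  | Const x _ | Add x _ _ | Monus x _ _ | Get x _ _ => [:: x]
  | Seq p q => wr_reg p ++ wr_reg q
  | If _ p q => wr_reg p ++ wr_reg q
  | While _ p => wr_reg p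
  | _ => [::] end.

Fixpoint wr_arr p : seq nat := match p with
  | Put a _ _ => [:: a]
  | Seq p q => wr_arr p ++ wr_arr q
  | If _ p q => wr_arr p ++ wr_arr q
  | While _ p => wr_arr p
  | _ => [::] end.

Definition frame p s s' : Prop :=
  (forall x, x \notin wr_reg p -> reg s' x = reg s x) /\
  (forall a, a \notin wr_arr p -> arr s' a = arr s a).

Lemma frame_refl p s : frame p s s. Proof. by split. Qed.

Lemma frame_trans p s1 s2 s3 : frame p s1 s2 -> frame p s2 s3 -> frame p s1 s3.
Proof.
move=> [r1 a1] [r2 a2]; split=> [x xp|a ap]; first by rewrite r2// r1.
by rewrite a2// a1.
Qed.

Lemma exec_frame p s t s' : exec p s t s' -> frame p s s'.
Proof.
elim=> {p s t s'}.
- by move=> s; split.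
- by move=> x v s; split=> //= y; rewrite inE => /negbTE ->.
- by move=> x y z s; split=> //= w; rewrite inE => /negbTE ->.
- by move=> x y z s; split=> //= w; rewrite inE => /negbTE ->.
- by move=> x a y s; split=> //= w; rewrite inE => /negbTE ->.
- move=> a x y s; split=> //= b; rewrite inE => /negbTE ab.
  by apply/funext => i; rewrite ab.
- move=> p q s1 t1 s2 t2 s3 _ [r1 a1] _ [r2 a2]; split=> /= x; rewrite mem_cat negb_or.
    by move=> /andP[x1 x2]; rewrite r2// r1.
  by move=> /andP[x1 x2]; rewrite a2// a1.
- move=> x p q s t s' _ _ [r1 a1]; split=> /= y; rewrite mem_cat negb_or.
    by move=> /andP[y1 _]; rewrite r1.
  by move=> /andP[y1 _]; rewrite a1.
- move=> x p q s t s' _ _ [r1 a1]; split=> /= y; rewrite mem_cat negb_or.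
    by move=> /andP[_ y1]; rewrite r1.
  by move=> /andP[_ y1]; rewrite a1.
- by move=> x p s1 t1 s2 t2 s3 _ _ f1 _ f2; exact: frame_trans f1 f2.
- by move=> x p s _; split.
Qed.

Lemma tri_frame p s c Q : tri p s c Q -> tri p s c (fun r s' => Q r s' /\ frame p s s').
Proof.
move=> [t [s' [r [ex le q]]]]; exists t, s', r; split=> //; split=> //.
exact: exec_frame ex.
Qed.

(** The test consumes a credit, so credits decrease at each turn, and induction on them replaces a
    separate termination argument. *)
Lemma tri_while x p s c (I Q : nat -> state -> Prop) :
  (forall r s', frame p s s' -> I r s' -> reg s' x != 0 -> exists2 r0, r = r0.+1 & tri p s' r0 I) ->
  (forall r s', frame p s s' -> I r s' -> reg s' x = 0 -> exists2 r0, r = r0.+1 & Q r0 s') ->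
  I c s -> tri (While x p) s c Q.
Proof.
move=> H1 H2; have := frame_refl p s; move: {2 3 4}s.
have [m] := ubnP c; elim: m c => // m IH c cm s1 fs1 Ic.
have [x0|x0] := eqVneq (reg s1 x) 0.
  have [r0 cE q] := H2 _ _ fs1 Ic x0; exists 1, s1, r0; split=> //; last by rewrite cE.
  exact: ExecWhileFalse.
have [r0 cE [t [s2 [r [ex le Ir]]]]] := H1 _ _ fs1 Ic x0.
have rm : r < m by move: cm le; rewrite cE; lia.
have [t' [s3 [r' [ex' le' q']]]] := IH _ rm _ (frame_trans fs1 (exec_frame ex)) Ir.
exists (t + t').+1, s3, r'; split=> //; last by move: le le'; rewrite cE; lia.
exact: ExecWhileTrue x0 ex ex'.
Qed.

End Triples.

Definition seqs (ps : seq program) : program := foldr Seq Skip ps.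

(** Symbolic execution of one instruction, descending into sequences. A test leaves two goals, and
    loops are left to their own lemmas. *)
Ltac vstep := rewrite /=;
  first [ eapply tri_step; [solve [constructor]|]
        | apply: tri_if; [let H := fresh "Hx" in move=> /= H|let H := fresh "Hx" in move=> /= H]
        | apply: tri_seq; vstep ]; rewrite /=.

(** * Linear-time search *)

Section Search.
Local Open Scope nat_scope.

(* The list [l] is stored from cell [h] on, with entries [tg] and next cells
   [nx]. Cells are numbered from 1 to [m], and 0 stands for the empty list. *)
Fixpoint islist (m : nat) (tg nx : nat -> nat) (h : nat) (l : seq nat) : Prop :=
  if l is y :: l' then [/\ 0 < h <= m, tg h = y & islist m tg nx (nx h) l'] else h = 0.

Variables (aH aN aT aL : nat).

(* In all programs registers 12 and 13 hold 1 and 0, so that [Add x y 13] copies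
   and [Monus x x 12] decrements. Here array 21 is a stack of height register
   19, register 24 is the current cell in the list of the top of the stack, and
   register 18 is the label given to newly found vertices. *)
Definition search_loop : program :=
  While 25 (seqs
    [:: If 24
          (seqs [:: Get 26 aT 24; Get 24 aN 24; Get 27 aL 26;
             If 27 Skip (seqs [:: Put aL 26 18; Put 21 19 26; Add 19 19 12])])
          (seqs [:: Monus 19 19 12; Get 26 21 19; Get 24 aH 26]);
        Add 25 24 19]).

Hypothesis arrays_neq : uniq [:: aH; aN; aT; aL; 21].

Context {n : nat} (e : rel 'I_n) (adj : 'I_n -> seq 'I_n) (m : nat).
Hypothesis adjP : forall v y, (y \in adj v) = e v y.

Definition graph_at (s : state) : Prop :=
  forall v : 'I_n, islist m (arr s aT) (arr s aN) (arr s aH v) (map val (adj v)).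

(* Potential for the amortised cost of the search. *)
Definition unmarked_weight (lab : 'I_n -> nat) : nat :=
  \sum_(v | lab v == 0) (size (adj v)).+2.

Definition stack_at (st : seq 'I_n) (s : state) : Prop :=
  reg s 19 = size st /\ forall i, i < size st -> arr s 21 i = nth 0 (map val st) i.

Lemma unmarked_weight_mark (lab lab' : 'I_n -> nat) y : lab y = 0 -> lab' y <> 0 ->
  (forall v, v != y -> lab' v = lab v) ->
  unmarked_weight lab = unmarked_weight lab' + (size (adj y)).+2.
Proof.
move=> l0 l1 lE; rewrite /unmarked_weight (bigD1 y) ?l0//= addnC; congr (_ + _).
apply: eq_bigl => v; case: (eqVneq v y) => [->|vy]; last by rewrite andbT lE.
by rewrite andbF; apply/esym/eqP.
Qed.

(** The vertices labelled earlier are closed under successors, so the search need not pass through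
    them: what it labels is the remainder of what [r] reaches. [R] stands for the credits of the
    continuation. *)
Lemma search_ok (r : 'I_n) (lab0 : 'I_n -> nat) c s q R :
  graph_at s -> c <> 0 -> lab0 r = 0 -> reg s 12 = 1 -> reg s 18 = c ->
  (forall v, arr s aL (val v) = if v == r then c else lab0 v) ->
  stack_at [:: r] s -> reg s 24 = 0 -> reg s 25 = 1 ->
  (forall v y, lab0 v <> 0 -> e v y -> lab0 y <> 0) ->
  20 * unmarked_weight lab0 + R <= q ->
  tri search_loop s q (fun q' s' =>
    [/\ forall v : 'I_n, arr s' aL v =
          if lab0 v != 0 then lab0 v else if connect e r v then c else 0,
        reg s' 24 = 0
      & 20 * unmarked_weight (fun v => arr s' aL (val v)) + R <= q']).
Proof.
move=> gs c0 lr r12 r18 labs st0 r24 r25 clos qR.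
pose lab (s' : state) (v : 'I_n) := arr s' aL (val v).
(* [st] holds the vertices whose lists are still to be scanned, and [cl] the unread part of the
   current list. Any other newly labelled vertex has all its successors labelled or in [cl]. *)
pose I q' s' := exists (st cl : seq 'I_n),
  [/\ [/\ stack_at st s', islist m (arr s aT) (arr s aN) (reg s' 24) (map val cl)
        & reg s' 25 = reg s' 24 + reg s' 19],
      forall v, (lab0 v <> 0 -> lab s' v = lab0 v) /\
        (lab0 v = 0 -> lab s' v = 0 \/ lab s' v = c /\ connect e r v),
      lab s' r <> 0 /\ (forall v, v \in st \/ v \in cl -> connect e r v),
      forall v, lab0 v = 0 -> lab s' v <> 0 -> v \in st \/
        forall y, e v y -> lab s' y <> 0 \/ y \in cl
    (* Reading an entry, with or without a push, and popping a vertex each lower the bracket by at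
       least 1. This releases 20 credits, more than one turn costs. *)
    & 20 * (unmarked_weight (lab s') + \sum_(v <- st) (size (adj v)).+1 + size cl)
      + R < q'].
have [[HN HT HL Hst] [NT NL Nst] [TL Tst] Lst] :
    [/\ [/\ aH != aN, aH != aT, aH != aL & aH != 21],
        [/\ aN != aT, aN != aL & aN != 21],
        (aT != aL) /\ (aT != 21) & aL != 21].
  move: arrays_neq; rewrite /= !inE !negb_or.
  by move=> /and5P[/and4P[-> -> -> ->] /and3P[-> -> ->] /andP[-> ->] -> _].
apply: (tri_while (I := I)); last first.
- exists [:: r], [::]; split.
  + by split=> //; rewrite r24 r25//; case: st0 => ->.
  + move=> v; rewrite /lab labs; case: eqVneq => [->|_]; last by split=> // ->; left.
    by split=> [|_]; [rewrite lr|right; split=> //; exact: connect0].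
  + rewrite /lab labs eqxx; split=> // v [|//]; rewrite inE => /eqP ->.
    exact: connect0.
  + move=> v v0; rewrite /lab labs; case: eqVneq => [-> _|_]; last by rewrite v0.
    by left; rewrite inE.
  + rewrite (@unmarked_weight_mark lab0 (lab s) r) in qR; first by rewrite big_seq1; move: qR => /=; lia.
    * by [].
    * by rewrite /lab labs eqxx.
    * by move=> v /negbTE vr; rewrite /lab labs vr.
- move=> q' s' fr [st [cl [[[sz _] isl r25'] labP [lr' conn] front pot]]] r25z.
  have r24z : reg s' 24 = 0 by move: r25' r25z; lia.
  have stn : st = [::] by apply: size0nil; move: r25' r25z; lia.
  have cl0 : cl = [::].
    by case: cl isl {conn front pot} => //= y cl [/andP[h _] _ _]; rewrite r24z in h.
  rewrite {}stn {}cl0 big_nil !addn0 in front pot.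
  exists q'.-1; first by move: pot; lia.
  split=> //; last by rewrite -ltnS prednK//; move: pot; lia.
  (* With nothing left to scan, the labelled vertices are closed under successors, so everything
     that [r] reaches is labelled. *)
  have clos' v y : lab s' v <> 0 -> e v y -> lab s' y <> 0.
    move=> lv vy; have [l0|/eqP l0] := eqVneq (lab0 v) 0.
      by have [//|/(_ y vy)[]] := front v l0 lv.
    by have l1 := clos _ _ l0 vy; have [H _] := labP y; rewrite H.
  move=> v; have [l1 l2] := labP v; case: eqP => [l0|l0] /=; last exact: l1.
  case: ifP => [rv|/negP rv]; last by have [//|[]] := l2 l0.
  have [lv|[]//] := l2 l0.
  by case: (connect_invariant (P := fun x => lab s' x <> 0) clos' rv lr').
- move=> q' s' [frr fra] [st [cl [[sts isl r25'] labP [lr' conn] front pot]]] r25n0.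
  have pos : 0 < \sum_(v <- st) (size (adj v)).+1 + size cl.
    rewrite addn_gt0; case: cl isl {conn front pot} => [|y cl] isl; last by rewrite orbT.
    have [sz _] := sts; rewrite r25' isl sz add0n in r25n0.
    by case: st r25n0 {sts sz} => //= v st _; rewrite big_cons.
  have [q0 q0E] : exists q0, q' = q0.+4.+4.+4.+4 by exists (q' - 16); move: pot pos; lia.
  have Tfr : arr s' aT = arr s aT by apply: fra; rewrite /= !inE negb_or TL.
  have Nfr : arr s' aN = arr s aN by apply: fra; rewrite /= !inE negb_or NL.
  have Hfr : arr s' aH = arr s aH by apply: fra; rewrite /= !inE negb_or HL.
  have r12' : reg s' 12 = 1 by rewrite frr.
  have r18' : reg s' 18 = c by rewrite frr.
  have [sz stE] := sts.
  rewrite q0E in pot *; exists (q0.+4.+4.+4.+3) => //; rewrite /seqs /=.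
  vstep; [|].
  + case: cl isl conn front pot pos => [/= E|y cl [h yE isl] conn front pot _].
      by rewrite E in Hx.
    do 7 vstep.
    * rewrite Tfr yE in Hx0 *; vstep.
      exists st, cl; split.
      - by split=> //=; rewrite Nfr.
      - exact: labP.
      - split; first exact: lr'.
        by move=> v [vst|vcl]; apply: conn; [left|right; rewrite inE vcl orbT].
      - move=> v l0 lv; have [|H] := front v l0 lv; first by left.
        right=> x /H[|]; first by left.
        rewrite inE => /orP[/eqP ->|]; last by right.
        by left; apply/eqP.
      - by move: pot => /=; rewrite /lab /=; lia.
    * rewrite Tfr yE r18' r12' in Hx0 *; do 4 vstep.
      have y0 : lab0 y = 0.
        apply/eqP/negPn/negP => /eqP l0; have [/(_ l0) E _] := labP y.
        by apply: l0; rewrite -E /lab Hx0.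
      have conny : connect e r y by apply: conn; right; rewrite mem_head.
      pose s'' := set_reg (set_reg (set_arr (set_arr (set_reg (set_reg (set_reg s' 26 y) 24
          (arr s' aN (reg s' 24))) 27 (arr s' aL y)) aL y c) 21 (reg s' 19) y) 19 (reg s' 19 + 1))
          25 (arr s' aN (reg s' 24) + (reg s' 19 + 1)).
      have labE v : lab s'' v = if v == y then c else lab s' v.
        by rewrite /lab /= (negbTE Lst) eqxx /= (inj_eq val_inj).
      rewrite -/s''; exists (rcons st y), cl; split.
      - split=> //=; last by rewrite Nfr.
        split=> /=; first by rewrite size_rcons sz addn1.
        move=> i; rewrite size_rcons ltnS leq_eqVlt map_rcons nth_rcons size_map sz.
        case: eqVneq => [->|ist /= ilt]; first by rewrite ltnn.
        by rewrite eq_sym (negbTE Lst) /= ilt stE.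
      - move=> v; rewrite labE; case: eqVneq => [->|_]; last exact: labP.
        by split=> [|_]; [rewrite y0|right].
      - split=> [|v]; first by rewrite labE; case: eqP.
        rewrite mem_rcons inE => -[/orP[/eqP ->//|vst]|vcl]; apply: conn; first by left.
        by right; rewrite inE vcl orbT.
      - move=> v l0; rewrite labE mem_rcons inE; case: eqVneq => [_ _|_ lv]; first by left.
        have [->|H] := front v l0 lv; first by left.
        right=> x /H; rewrite labE inE; case: eqP => [|_]; first by left.
        by [].
      - move: pot; rewrite (@unmarked_weight_mark (lab s') (lab s'') y)//; first last.
          by move=> v /negbTE vy; rewrite labE vy.
          by rewrite labE eqxx.
        by rewrite -cats1 big_cat big_seq1 /=; lia.
  + have cl0 : cl = [::].
      by case: cl isl {conn front pot pos} => //= x cl [/andP[h _] _ _]; rewrite Hx in h.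
    subst cl; rewrite addn0 in pos.
    case/lastP: st sts sz stE conn front pot pos => [|st v] sts sz stE conn front pot pos.
      by rewrite big_nil in pos.
    rewrite size_rcons in sz.
    have vE : arr s' 21 (reg s' 19 - reg s' 12) = v.
      by rewrite r12' sz subn1 /= stE ?size_rcons// map_rcons nth_rcons size_map ltnn eqxx.
    do 6 vstep.
    rewrite vE Hfr; exists st, (adj v); split.
    - split=> //=.
      split=> /=; first by rewrite r12' sz subn1.
      by move=> i ist; rewrite stE ?size_rcons ?ltnS ?(ltnW ist)// map_rcons nth_rcons size_map ist.
    - exact: labP.
    - split; first exact: lr'.
      move=> w [wst|]; first by apply: conn; left; rewrite mem_rcons inE wst orbT.
      rewrite adjP => vw; apply: connect_trans (connect1 vw); apply: conn; left.
      by rewrite mem_rcons mem_head.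
    - move=> w l0 lw; have [|H] := front w l0 lw; last first.
        by right=> x /H[|//]; left.
      rewrite mem_rcons inE => /orP[/eqP ->|]; last by left.
      by right=> x vx; right; rewrite adjP.
    - by move: pot; rewrite -cats1 big_cat big_seq1 /= /lab /=; lia.
Qed.

End Search.

Definition list_at (n : nat) (a : nat -> nat) (l : seq 'I_n) : Prop :=
  forall i, (i < size l)%N -> a i = nth 0%N (map val l) i.

Ltac split_neqs := repeat (move=> /andP[]); intros; repeat match goal with
  | H : is_true (_ && _) |- _ => move/andP: H => [? ?] end;
  repeat match goal with |- and _ _ => split | |- and3 _ _ _ => split end;
  try assumption; rewrite eq_sym; assumption.

Section Pass.
Local Open Scope nat_scope.
Variables (aH aN aT aL aO aX : nat).

(* The vertices found in the search from [r] are labelled [r.+1]. *)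
Definition pass_loop : program :=
  While 14 (seqs [:: Monus 14 14 12; Get 16 aO 14; Get 17 aL 16;
    If 17 Skip (seqs [:: Put aX 15 16; Add 15 15 12; Add 18 16 12; Put aL 16 18;
      Put 21 13 16; Const 19 1; Const 24 0; Const 25 1; search_loop aH aN aT aL])]).

Hypothesis arrays_neq : uniq [:: aH; aN; aT; aL; 21; aO; aX].

Context {n : nat} (e : rel 'I_n) (adj : 'I_n -> seq 'I_n) (m : nat).
Hypothesis adjP : forall v y, (y \in adj v) = e v y.

Lemma list_at_rcons (a a' : nat -> nat) (l : seq 'I_n) (v : 'I_n) : list_at a l ->
  (forall i, i < size l -> a' i = a i) -> a' (size l) = v -> list_at a' (rcons l v).
Proof.
move=> al aa av i; rewrite size_rcons ltnS leq_eqVlt map_rcons nth_rcons size_map.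
case: eqVneq => [->|_ /= il]; first by rewrite ltnn.
by rewrite il aa// al.
Qed.

Lemma list_at_nth (a : nat -> nat) (l : seq 'I_n) j : list_at a l -> j < size l ->
  exists r, a j = val r /\ drop j l = r :: drop j.+1 l.
Proof.
move=> al; case: l al => // x l al jl; exists (nth x (x :: l) j).
by rewrite al// (nth_map x)// -drop_nth.
Qed.

(** The counter runs downwards, so the pass treats [rev o]. A vertex is labelled exactly if a root
    chosen before reaches it, which is the test of [greedy_add]; the shift of labels by 1 keeps 0
    for unlabelled vertices. *)
Lemma pass_ok (o : seq 'I_n) s q R : graph_at aH aN aT adj m s ->
  reg s 12 = 1 -> reg s 13 = 0 -> reg s 14 = size o -> reg s 15 = 0 ->
  list_at (arr s aO) o -> (forall v : 'I_n, arr s aL v = 0) ->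
  20 * size o + 20 * \sum_(v : 'I_n) (size (adj v)).+2 + R < q ->
  tri pass_loop s q (fun q' s' =>
    [/\ reg s' 15 = size (greedy e (rev o)), list_at (arr s' aX) (greedy e (rev o)),
        forall v : 'I_n, arr s' aL v != 0 -> exists r : 'I_n,
          [/\ r \in greedy e (rev o), arr s' aL v = r.+1 & connect e r v],
        forall v : 'I_n, (arr s' aL v != 0) = has (fun r => connect e r v) (greedy e (rev o))
      & R <= q']).
Proof.
move=> gs r12 r13 r14 r15 lo lab0 qR.
have search_neq : uniq [:: aH; aN; aT; aL; 21].
  by move: arrays_neq; rewrite -[[:: aH; _; _; _; _; _; _]]/([:: aH; aN; aT; aL; 21] ++ [:: aO; aX]) cat_uniq => /andP[].
have [[HX HL Hst] [NX NL Nst] [TX TL Tst]] : [/\ [/\ aH != aX, aH != aL & aH != 21],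
    [/\ aN != aX, aN != aL & aN != 21] & [/\ aT != aX, aT != aL & aT != 21]].
  by move: arrays_neq; rewrite /= !inE !negb_or; split_neqs.
have [[OX OL Ost] [LX Lst Xst]] : [/\ aO != aX, aL != aO & 21 != aO] /\
    [/\ aL != aX, aL != 21 & 21 != aX].
  by move: arrays_neq; rewrite /= !inE !negb_or; split_neqs.
pose B (s' : state) := greedy e (rev (drop (reg s' 14) o)).
pose lab (s' : state) (v : 'I_n) := arr s' aL (val v).
pose I q' s' := [/\ reg s' 14 <= size o,
  reg s' 15 = size (B s') /\ list_at (arr s' aX) (B s'),
  forall v, lab s' v != 0 -> exists r : 'I_n,
    [/\ r \in B s', lab s' v = r.+1 & connect e r v],
  forall v, (lab s' v != 0) = has (fun r => connect e r v) (B s')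
  & 20 * reg s' 14 + 20 * unmarked_weight adj (lab s') + R < q'].
apply: (tri_while (I := I)); last first.
- rewrite /I /B r14 drop_size /= r15; split=> //.
  + by move=> v; rewrite /lab lab0.
  + by move=> v; rewrite /lab lab0.
  + rewrite (_ : unmarked_weight _ _ = \sum_(v : 'I_n) (size (adj v)).+2)//.
    by apply: eq_bigl => v; rewrite /lab lab0.
- move=> q' s' _ [_ [b1 b2] l1 l2 pot] r14z.
  exists q'.-1; first by move: pot; clear; lia.
  rewrite /B r14z drop0 in b1 b2 l1 l2; split=> //.
  by move: pot; rewrite r14z; clear; lia.
- move=> q' s' [frr fra] [j14 [b1 b2] l1 l2 pot] r14n0.
  have [q0 q0E] : exists q0, q' = q0.+4.+4.+4.+4 by exists (q' - 16); move: pot r14n0; clear; lia.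
  rewrite q0E in pot *; exists (q0.+4.+4.+4.+3) => //; rewrite /seqs /=.
  have r12' : reg s' 12 = 1 by rewrite frr// r12.
  have r13' : reg s' 13 = 0 by rewrite frr// r13.
  have Ofr : arr s' aO = arr s aO.
    by apply: fra; rewrite /= !inE !negb_or OX [aO == aL]eq_sym OL [aO == 21]eq_sym Ost.
  have Hfr : arr s' aH = arr s aH by apply: fra; rewrite /= !inE !negb_or HX HL Hst.
  have Nfr : arr s' aN = arr s aN by apply: fra; rewrite /= !inE !negb_or NX NL Nst.
  have Tfr : arr s' aT = arr s aT by apply: fra; rewrite /= !inE !negb_or TX TL Tst.
  have gs' : graph_at aH aN aT adj m s' by move=> v; rewrite Hfr Nfr Tfr; exact: gs.
  have [j jE] : exists j, reg s' 14 = j.+1 by exists (reg s' 14).-1; move: r14n0; clear; lia.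
  rewrite jE in j14 pot.
  have [r [rE dE]] := list_at_nth lo j14.
  have BE s'' : reg s'' 14 = j -> B s'' = greedy_add e (B s') r.
    by move=> E; rewrite /B E jE dE rev_cons greedy_rcons.
  do 3 vstep; rewrite Ofr jE r12' subn1 /= rE.
  have hasE : has (fun t => connect e t r) (B s') = (arr s' aL r != 0) by rewrite -l2.
  vstep.
  + do 2 vstep; set s'' := set_reg _ 17 _.
    have B'' : B s'' = B s' by rewrite BE// /greedy_add hasE Hx.
    by split; rewrite ?B''//= ?(ltnW j14)//; move: pot; rewrite /lab /=; clear; lia.
  + do 8 vstep; apply: tri_seq.
    set s2 := set_reg _ 25 1.
    have lab2 (v : 'I_n) : arr s2 aL v = if v == r then r.+1 else lab s' v.
      rewrite /lab /= eqxx (negbTE Lst) (negbTE LX) /= (inj_eq val_inj) r12' addn1.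
      by [].
    have H2 : tri (search_loop aH aN aT aL) s2 q0.+3 (fun q' s3 => [/\ forall v : 'I_n, arr s3 aL v =
          if lab s' v != 0 then lab s' v else if connect e r v then r.+1 else 0,
        reg s3 24 = 0
      & 20 * unmarked_weight adj (fun v => arr s3 aL (val v)) + (20 * j + R).+3 <= q']).
      apply: (search_ok search_neq adjP (m := m) (r := r) (lab0 := lab s')) => //.
      - move=> v; rewrite /=.
        rewrite (negbTE HX) (negbTE HL) (negbTE Hst) (negbTE NX) (negbTE NL) (negbTE Nst).
        by rewrite (negbTE TX) (negbTE TL) (negbTE Tst); exact: gs'.
      - by rewrite /= r12' addn1.
      - by split=> // -[|//] _ /=; rewrite r13' !eqxx.
      - move=> v y /eqP; rewrite l2 => /hasP[t tB tv] vy; apply/eqP; rewrite l2.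
        by apply/hasP; exists t => //; apply: connect_trans tv (connect1 vy).
      - by move: pot; clear; lia.
    have BE2 s3 : reg s3 14 = j -> B s3 = rcons (B s') r.
      by move=> /BE ->; rewrite /greedy_add hasE Hx.
    apply: (tri_mono (leqnn _) _ (tri_frame H2)) => q1 s3 [[lab3 _ q1E] [fr3 fa3]].
    case: q1 q1E => [|[|q2]] q1E; [by rewrite !addnS in q1E|by rewrite !addnS in q1E|].
    do 2 vstep.
    have r14' : reg s3 14 = j by rewrite fr3.
    have B3 := BE2 _ r14'.
    split; rewrite ?B3 ?r14' ?(ltnW j14)//.
    - split; first by rewrite fr3//= size_rcons b1 r12' addn1.
      have Xfr : arr s3 aX = arr s2 aX.
        by apply: fa3; rewrite /= !inE !negb_or [aX == aL]eq_sym LX eq_sym Xst.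
      apply: (list_at_rcons b2).
        move=> i il; rewrite Xfr /= [aX == 21]eq_sym (negbTE Xst) [aX == aL]eq_sym (negbTE LX).
        by rewrite eqxx /= b1 ltn_eqF.
      rewrite Xfr /= [aX == 21]eq_sym (negbTE Xst) [aX == aL]eq_sym (negbTE LX) eqxx /= b1.
      by rewrite eqxx.
    - move=> v; rewrite /lab lab3; case: ifP => [lv _|lv].
        have [t [tB E tv]] := l1 v lv; exists t; split=> //.
        by rewrite mem_rcons inE tB orbT.
      case: ifP => // rv _; exists r; split=> //; first by rewrite mem_rcons mem_head.
    - move=> v; rewrite /lab lab3 -cats1 has_cat -l2 /= orbF.
      by case: ifP => //= _; case: connect.
    - by move: q1E; clear; rewrite /lab; lia.
Qed.
End Pass.

(** * Adjacency lists in both directions *)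

Section Build.
Local Open Scope nat_scope.

(* Out-neighbours go to arrays 6 to 8, in-neighbours to arrays 9 to 11, and
   array 12 becomes the identity. *)
Definition build_loop : program :=
  While 21 (seqs [:: Add 23 20 12; Get 24 0 23; Monus 24 24 22;
    If 24
      (seqs [:: Get 25 1 22; Add 22 22 12;
        Get 26 6 20; Put 7 22 26; Put 6 20 22; Put 8 22 25;
        Get 26 9 25; Put 10 22 26; Put 9 25 22; Put 11 22 20])
      (seqs [:: Put 12 20 20; Add 20 20 12; Monus 21 21 12])]).

Lemma islist_sub m m' tg nx tg' nx' h l : islist m tg nx h l -> m <= m' ->
  (forall c, 0 < c <= m -> tg' c = tg c /\ nx' c = nx c) -> islist m' tg' nx' h l.
Proof.
move=> + mm H; elim: l h => //= y l IH h [/andP[h0 hm] ty ll].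
have [t' n'] := H h (introT andP (conj h0 hm)).
by rewrite t' n' h0 (leq_trans hm mm); split=> //; exact: IH.
Qed.

Context {n : nat} (A : 'M[bool]_n).

Definition column (j : 'I_n) : seq 'I_n := [seq i <- enum 'I_n | A i j].

Definition edges_of (js : seq 'I_n) : seq ('I_n * 'I_n) :=
  flatten [seq [seq (j, i) | i <- column j] | j <- js].

Definition edge_list : seq ('I_n * 'I_n) := edges_of (enum 'I_n).

(** Reversed because [build_loop] pushes new cells at the front. *)
Definition out_list (P : seq ('I_n * 'I_n)) (v : 'I_n) : seq 'I_n :=
  rev [seq p.2 | p <- P & p.1 == v].

Definition in_list (P : seq ('I_n * 'I_n)) (v : 'I_n) : seq 'I_n :=
  rev [seq p.1 | p <- P & p.2 == v].

Lemma out_list_rcons P x i v :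
  out_list (rcons P (x, i)) v = if x == v then i :: out_list P v else out_list P v.
Proof. by rewrite /out_list filter_rcons /=; case: eqP => _ //; rewrite map_rcons rev_rcons. Qed.

Lemma in_list_rcons P x i v :
  in_list (rcons P (x, i)) v = if i == v then x :: in_list P v else in_list P v.
Proof. by rewrite /in_list filter_rcons /=; case: eqP => _ //; rewrite map_rcons rev_rcons. Qed.

Lemma mem_edge_list x i : ((x, i) \in edge_list) = A i x.
Proof.
apply/flatten_mapP/idP => [[j _ /mapP[i' + [-> ->]]]|Aix].
  by rewrite mem_filter => /andP[].
exists x; rewrite ?mem_enum//; apply/mapP; exists i => //.
by rewrite mem_filter Aix mem_enum.
Qed.

Lemma mem_out_list v y : (y \in out_list edge_list v) = edge A v y.
Proof.
rewrite mem_rev -[RHS]/(A y v) -mem_edge_list; apply/mapP/idP => [[[a b]]|vy].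
  by rewrite mem_filter => /andP[/eqP /= <- ab] ->.
by exists (v, y) => //; rewrite mem_filter eqxx.
Qed.

Lemma mem_in_list v y : (y \in in_list edge_list v) = edge A^T v y.
Proof.
rewrite mem_rev /edge mxE -mem_edge_list; apply/mapP/idP => [[[a b]]|vy].
  by rewrite mem_filter => /andP[/eqP /= <- ab] ->.
by exists (y, v) => //; rewrite mem_filter eqxx.
Qed.

Lemma sum_count_eq (T : finType) (X : Type) (h : X -> T) (P : seq X) :
  \sum_v count (fun p => h p == v) P = size P.
Proof.
elim: P => [|p P IH] /=; first by rewrite big1.
rewrite big_split /= IH (bigD1 (h p))//= eqxx big1 ?addn0// => v.
by rewrite eq_sym => /negbTE ->.
Qed.

Lemma sum_out_list P : \sum_v size (out_list P v) = size P.
Proof.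
rewrite -[RHS](sum_count_eq (fun p : 'I_n * 'I_n => p.1)); apply: eq_bigr => v _.
by rewrite size_rev size_map size_filter.
Qed.

Lemma sum_in_list P : \sum_v size (in_list P v) = size P.
Proof.
rewrite -[RHS](sum_count_eq (fun p : 'I_n * 'I_n => p.2)); apply: eq_bigr => v _.
by rewrite size_rev size_map size_filter.
Qed.

Lemma columnsE : columns A = [seq [seq val i | i <- column j] | j <- enum 'I_n].
Proof. by []. Qed.

Lemma flatten_columns : flatten (columns A) = [seq val p.2 | p <- edge_list].
Proof.
rewrite columnsE /edge_list /edges_of map_flatten -!map_comp; congr flatten.
by apply: eq_map => j /=; rewrite -map_comp.
Qed.

Lemma nth_column_starts j : j <= n ->
  nth 0 (column_starts A) j = size (edges_of (take j (enum 'I_n))).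
Proof.
move=> jn; rewrite (nth_map 0) ?size_iota// nth_iota// add0n columnsE /shape -map_comp.
rewrite -map_take size_flatten /shape -map_comp; congr sumn.
by apply: eq_map => i /=; rewrite !size_map.
Qed.

Lemma drop_enum_ord j : j < n -> exists x : 'I_n, val x = j /\
  drop j (enum 'I_n) = x :: drop j.+1 (enum 'I_n).
Proof.
move=> jn; exists (Ordinal jn); split=> //.
have jE : nth (Ordinal jn) (enum 'I_n) j = Ordinal jn.
  by apply: val_inj => /=; rewrite nth_enum_ord.
by rewrite -{1}jE -drop_nth// size_enum_ord.
Qed.

Lemma edges_of_cat js js' : edges_of (js ++ js') = edges_of js ++ edges_of js'.
Proof. by rewrite /edges_of map_cat flatten_cat. Qed.

Lemma islist_push k tg nx tg' nx' h l y : islist k tg nx h l ->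
  (forall c, 0 < c <= k -> tg' c = tg c /\ nx' c = nx c) ->
  tg' k.+1 = y -> nx' k.+1 = h -> islist k.+1 tg' nx' k.+1 (y :: l).
Proof. by move=> H K ty nh /=; split; rewrite ?leqnn// nh; exact: islist_sub H _ K. Qed.

Lemma next_column P j : j <= n ->
  edge_list = P ++ edges_of (drop j (enum 'I_n)) ->
  exists rest, [/\ edge_list = P ++ rest ++ edges_of (drop j.+1 (enum 'I_n)),
    size P + size rest = nth 0 (column_starts A) (minn j.+1 n)
    & forall x i, (x, i) \in rest -> val x = j].
Proof.
move=> jn EE; exists (edges_of (take 1 (drop j (enum 'I_n)))); split.
- by rewrite -edges_of_cat -[j.+1]/(1 + j) -drop_drop cat_take_drop.
- rewrite nth_column_starts ?geq_minr//.
  have -> : take (minn j.+1 n) (enum 'I_n) = take (j + 1) (enum 'I_n).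
    rewrite addn1; case: (leqP j.+1 n) => // nj.
    by rewrite !take_oversize ?size_enum_ord// ltnW.
  rewrite takeD edges_of_cat size_cat; congr (_ + _).
  have := EE; rewrite /edge_list -{1}(cat_take_drop j (enum 'I_n)) edges_of_cat.
  by move/(congr1 size); rewrite !size_cat => /addIn.
- move=> x i; case: (ltnP j n) => [/drop_enum_ord[y [<- ->]]|nj].
    by rewrite /= take0 /edges_of /= cats0 => /mapP[i' _ [-> _]].
  by rewrite drop_oversize ?size_enum_ord.
Qed.

Lemma build_ok s q R :
  (forall j, j <= n -> arr s 0 j = nth 0 (column_starts A) j) ->
  (forall c, arr s 1 c = nth 0 (flatten (columns A)) c) ->
  (forall a i, 6 <= a -> arr s a i = 0) ->
  reg s 12 = 1 -> reg s 20 = 0 -> reg s 21 = n -> reg s 22 = 0 ->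
  20 * n + 20 * size edge_list + R < q ->
  tri build_loop s q (fun q' s' =>
    [/\ graph_at 6 7 8 (out_list edge_list) (size edge_list) s',
        graph_at 9 10 11 (in_list edge_list) (size edge_list) s',
        forall i, i < n -> arr s' 12 i = i & R <= q']).
Proof.
move=> a0 a1 az r12 r20 r21 r22 qR.
(* [P] contains the edges already stored, whose number is also the last cell in use, and [rest]
   those left in the current column. The [minn] covers the situation after the last column, where
   there is no further start. *)
pose I q' s' := exists P rest : seq ('I_n * 'I_n),
  [/\ [/\ reg s' 20 <= n, reg s' 21 = n - reg s' 20 & reg s' 22 = size P],
      [/\ edge_list = P ++ rest ++ edges_of (drop (reg s' 20).+1 (enum 'I_n)),
        size P + size rest = nth 0 (column_starts A) (minn (reg s' 20).+1 n)
        & forall x i, (x, i) \in rest -> val x = reg s' 20],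
      graph_at 6 7 8 (out_list P) (size P) s' /\ graph_at 9 10 11 (in_list P) (size P) s',
      forall i, i < reg s' 20 -> arr s' 12 i = i
    & 20 * (n - reg s' 20) + 20 * (size edge_list - size P) + R < q'].
apply: (tri_while (I := I)); last first.
- have [rest [EE sz restP]] := @next_column [::] 0 (leq0n n) (esym (congr1 edges_of (drop0 _))).
  exists [::], rest; rewrite r20 r22; split=> //.
  + by rewrite subn0.
  + by split=> v; rewrite az.
  + by rewrite !subn0.
- move=> q' s' _ [P [rest [[jn r21' r22'] [EE sz restP] [gf gb] idn pot]]] r21z.
  have jE : reg s' 20 = n by move: jn r21' r21z; clear; lia.
  case: q' pot => // q' pot; exists q' => //.
  have rest0 : rest = [::].
    case: rest restP {EE sz} => // -[x i] rest /(_ x i (mem_head _ _)) xE.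
    by have := ltn_ord x; rewrite xE jE ltnn.
  rewrite {}rest0 jE drop_oversize ?size_enum_ord// !cats0 in EE *.
  rewrite EE; split=> //; first by rewrite jE in idn.
  by rewrite -ltnS; apply: leq_ltn_trans pot; rewrite leq_addl.
- move=> q' s' [frr fra] [P [rest [[jn r21' r22'] [EE sz restP] [gf gb] idn pot]]] r21n.
  have [q0 q0E] : exists q0, q' = q0.+4.+4.+4.+4.+4 by exists (q' - 20); move: pot r21n; rewrite r21'; clear; lia.
  rewrite q0E in pot *; exists (q0.+4.+4.+4.+4.+3) => //; rewrite /seqs /=.
  have r12' : reg s' 12 = 1 by rewrite frr// r12.
  do 3 vstep; vstep.
  + have jn' : reg s' 20 < n by move: r21n r21'; clear; lia.
    have stE : arr s' 0 (reg s' 20 + reg s' 12) = size P + size rest.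
      by rewrite fra// r12' addn1 a0// sz; congr nth; apply/esym/minn_idPl.
    rewrite stE r22' in Hx.
    case: rest EE sz restP stE Hx => [|[x i] rest] EE sz restP stE Hx.
      by rewrite addn0 subnn in Hx.
    have xE : val x = reg s' 20 by apply: (restP x i); rewrite mem_head.
    have iE : arr s' 1 (reg s' 22) = i.
      rewrite fra// a1 r22' flatten_columns EE map_cat nth_cat size_map ltnn subnn.
      by [].
    have old c : 0 < c <= size P -> (c == (size P).+1) = false.
      by move=> /andP[_ cP]; rewrite ltn_eqF.
    do 12 vstep; rewrite r12' iE r22' -xE !addn1; set s'' := set_arr _ 11 _ _.
    exists (rcons P (x, i)), rest; split.
    * split=> //=; first by rewrite size_rcons.
    * split=> /=.
      - by rewrite cat_rcons.
      - by rewrite size_rcons addSnnS.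
      - by move=> x' i' xi; apply: (restP x' i'); rewrite inE xi orbT.
    * split=> v; rewrite size_rcons.
      - rewrite out_list_rcons; case: (eqVneq x v) => [<-|xv].
          rewrite /s'' /= eqxx.
          apply: (islist_push (gf x)) => [c /old cP| |] /=; rewrite ?cP ?eqxx//.
        rewrite /s'' /= eq_sym (inj_eq val_inj) (negbTE xv).
        by apply: (islist_sub (gf v)) => // c /old /= ->.
      - rewrite in_list_rcons; case: (eqVneq i v) => [<-|iv].
          rewrite /s'' /= eqxx.
          apply: (islist_push (gb i)) => [c /old cP| |] /=; rewrite ?cP ?eqxx//.
        rewrite /s'' /= eq_sym (inj_eq val_inj) (negbTE iv).
        by apply: (islist_sub (gb v)) => // c /old /= ->.
    * by [].
    * have szE : size P < size edge_list by rewrite EE !size_cat /= addnS ltnS leq_addr.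
      by rewrite size_rcons /=; move: pot szE; clear; lia.
  + have jn' : reg s' 20 < n by move: r21n r21'; clear; lia.
    have stE : arr s' 0 (reg s' 20 + reg s' 12) = size P + size rest.
      by rewrite fra// r12' addn1 a0// sz; congr nth; apply/esym/minn_idPl.
    rewrite stE r22' addKn in Hx.
    rewrite (size0nil Hx) /= in EE.
    have [rest' [EE' sz' restP']] := next_column jn' EE.
    do 5 vstep; rewrite r12' addn1; exists P, rest'; split=> //=.
    * by split=> //; rewrite r21' -subnDA addn1.
    * move=> i; rewrite ltnS leq_eqVlt; case: eqVneq => //= _; exact: idn.
    * by move: pot jn'; clear; lia.
Qed.

End Build.

(** * Matching and links *)

Section Loops.
Local Open Scope nat_scope.
Context {n : nat}.

Section Half.
Variables (aX aL aF1 aF2 aM1 aM2 : nat).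

Definition half_loop : program :=
  While 14 (seqs [:: Monus 14 14 12; Get 16 aX 14; Get 17 aL 16; Monus 17 17 12;
    Get 18 aF1 16; Get 19 aF2 17; Add 18 18 19;
    If 18 Skip (seqs [:: Put aF1 16 12; Put aF2 17 12; Put aM1 42 16; Put aM2 42 17;
      Add 42 42 12])]).

Hypothesis arrays_neq : uniq [:: aX; aL; aF1; aF2; aM1; aM2].

Definition matched_at (M : seq ('I_n * 'I_n)) (s : state) : Prop :=
  [/\ reg s 42 = size M,
      list_at (arr s aM1) (unzip1 M) /\ list_at (arr s aM2) (unzip2 M),
      forall x : 'I_n, (arr s aF1 x != 0) = (x \in unzip1 M),
      forall y : 'I_n, (arr s aF2 y != 0) = (y \in unzip2 M)
    & uniq (unzip1 M) /\ uniq (unzip2 M)].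

(** A pair [(x, h x)] is refused only if one of its ends is already matched, and matched ends stay
    matched. *)
Lemma half_ok (X : seq 'I_n) (h : 'I_n -> 'I_n) (M : seq ('I_n * 'I_n)) s q R :
  reg s 12 = 1 -> reg s 14 = size X -> list_at (arr s aX) X ->
  (forall x, x \in X -> arr s aL (val x) = (h x).+1) -> matched_at M s ->
  20 * size X + R < q ->
  tri half_loop s q (fun q' s' => R <= q' /\ exists M', [/\ matched_at M' s',
    {subset M <= M'},
    forall e, e \in M' -> e \in M \/ e.1 \in X /\ e.2 = h e.1
    & forall x, x \in X -> x \in unzip1 M' \/ h x \in unzip2 M']).
Proof.
move=> r12 r14 lX labE M0 qR.
have [[XF1 XF2 XM1 XM2] [LF1 LF2 LM1 LM2] [F12 F1M1 F1M2 F2M1 F2M2] M12] :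
    [/\ [/\ aX != aF1, aX != aF2, aX != aM1 & aX != aM2],
    [/\ aL != aF1, aL != aF2, aL != aM1 & aL != aM2],
    [/\ aF1 != aF2, aF1 != aM1, aF1 != aM2, aF2 != aM1 & aF2 != aM2] & aM1 != aM2].
  by move: arrays_neq; rewrite /= !inE !negb_or => /and5P[/and5P[_ -> -> -> ->]
    /and4P[-> -> -> ->] /and3P[-> -> ->] /andP[-> ->] /andP[-> _]].
pose I q' s' := [/\ reg s' 14 <= size X, 20 * reg s' 14 + R < q' & exists M', [/\ matched_at M' s',
    {subset M <= M'},
    forall e, e \in M' -> e \in M \/ e.1 \in X /\ e.2 = h e.1
    & forall x, x \in drop (reg s' 14) X -> x \in unzip1 M' \/ h x \in unzip2 M']].
apply: (tri_while (I := I)); last first.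
- rewrite /I r14; split=> //; exists M; split=> //; first by move=> e eM; left.
  by rewrite drop_size.
- move=> q' s' _ [_ pot [M' [M'1 M'2 M'3 M'4]]] r14z.
  rewrite r14z drop0 in M'4 pot.
  by case: q' pot => // q' pot; exists q' => //; split=> //; exists M'.
- move=> q' s' [frr fra] [j14 pot [M' [[M'q [l1 l2] f1 f2 [u1 u2]] MM' M'3 M'4]]] r14n0.
  have [q0 q0E] : exists q0, q' = q0.+4.+4.+4.+4.+4 by exists (q' - 20); move: pot r14n0; clear; lia.
  rewrite q0E in pot *; exists (q0.+4.+4.+4.+4.+3) => //; rewrite /seqs /=.
  have r12' : reg s' 12 = 1 by rewrite frr// r12.
  have [j jE] : exists j, reg s' 14 = j.+1 by exists (reg s' 14).-1; move: r14n0; clear; lia.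
  rewrite jE in j14 pot M'4.
  have Xfr : arr s' aX = arr s aX by apply: fra; rewrite /= !inE !negb_or XF1 XF2 XM1 XM2.
  have Lfr : arr s' aL = arr s aL by apply: fra; rewrite /= !inE !negb_or LF1 LF2 LM1 LM2.
  have [x [xE dE]] := list_at_nth lX j14.
  have xX : x \in X by rewrite -(cat_take_drop j X) mem_cat dE mem_head orbT.
  do 7 vstep; rewrite Xfr Lfr jE r12' subn1 /= xE labE// subn1 /=.
  have F0 : (arr s' aF1 x + arr s' aF2 (h x) != 0) = (x \in unzip1 M') || (h x \in unzip2 M').
    by rewrite addn_eq0 negb_and f1 f2.
  vstep.
  + do 2 vstep; split=> /=; first exact: ltnW.
      by move: pot; clear; lia.
    exists M'; split=> // y; rewrite dE inE => /orP[/eqP ->|]; last exact: M'4.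
    by move: Hx; rewrite F0 => /orP[->|->]; [left|right].
  + have /norP[xM hM] : ~~ ((x \in unzip1 M') || (h x \in unzip2 M')) by rewrite -F0 Hx.
    do 7 vstep; set s'' := set_reg _ 42 _; split; first exact: ltnW.
      by rewrite /=; move: pot; clear; lia.
    have A1 i : arr s'' aM1 i = if i == size M' then val x else arr s' aM1 i.
      rewrite /s'' /= (negbTE M12) eqxx M'q [aM1 == aF2]eq_sym (negbTE F2M1).
      by rewrite [aM1 == aF1]eq_sym (negbTE F1M1).
    have A2 i : arr s'' aM2 i = if i == size M' then val (h x) else arr s' aM2 i.
      rewrite /s'' /= eqxx M'q [aM2 == aF2]eq_sym (negbTE F2M2).
      by rewrite [aM2 == aF1]eq_sym (negbTE F1M2) [aM2 == aM1]eq_sym (negbTE M12).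
    have B1 (y : 'I_n) : arr s'' aF1 y = if y == x then 1 else arr s' aF1 y.
      by rewrite /s'' /= (negbTE F1M2) (negbTE F1M1) (negbTE F12) eqxx r12' (inj_eq val_inj).
    have B2 (y : 'I_n) : arr s'' aF2 y = if y == h x then 1 else arr s' aF2 y.
      rewrite /s'' /= (negbTE F2M2) (negbTE F2M1) eqxx r12' (inj_eq val_inj).
      by rewrite [aF2 == aF1]eq_sym (negbTE F12).
    exists (rcons M' (x, h x)); split.
    * rewrite /matched_at /unzip1 /unzip2 !map_rcons; split.
      - by rewrite /s'' /= r12' size_rcons M'q addn1.
      - split.
          apply: (list_at_rcons l1); rewrite size_map; last by rewrite A1 eqxx.
          by move=> i ilt; rewrite A1 ltn_eqF.
        apply: (list_at_rcons l2); rewrite size_map; last by rewrite A2 eqxx.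
        by move=> i ilt; rewrite A2 ltn_eqF.
      - by move=> y; rewrite mem_rcons inE B1 -f1 /=; case: (y == x).
      - by move=> y; rewrite mem_rcons inE B2 -f2 /=; case: (y == h x).
      - by rewrite !rcons_uniq xM hM u1 u2.
    * by move=> e eM; rewrite mem_rcons inE (MM' _ eM) orbT.
    * move=> e; rewrite mem_rcons inE => /orP[/eqP ->|]; [by right|exact: M'3].
    * move=> y; rewrite dE inE /unzip1 /unzip2 !map_rcons !mem_rcons !inE.
      move=> /orP[/eqP ->|]; first by left; rewrite eqxx.
      by move=> /M'4[->|->]; rewrite orbT; [left|right].
Qed.

End Half.

Section Rest.
Variables (aX aF aM : nat).

Definition rest_loop : program :=
  While 14 (seqs [:: Monus 14 14 12; Get 16 aX 14; Get 17 aF 16;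
    If 17 Skip (seqs [:: Put aM 43 16; Add 43 43 12])]).

Hypothesis (XM : aX != aM) (FM : aF != aM).

Lemma rest_ok (X l : seq 'I_n) (f : pred 'I_n) s q R :
  reg s 12 = 1 -> reg s 14 = size X -> list_at (arr s aX) X ->
  (forall x : 'I_n, (arr s aF x != 0) = f x) ->
  reg s 43 = size l -> list_at (arr s aM) l -> 20 * size X + R < q ->
  tri rest_loop s q (fun q' s' => R <= q' /\
    list_at (arr s' aM) (l ++ [seq x <- rev X | ~~ f x])).
Proof.
move=> r12 r14 lX fE r43 ll qR.
pose L (s' : state) := l ++ [seq x <- rev (drop (reg s' 14) X) | ~~ f x].
pose I q' s' := [/\ reg s' 14 <= size X, 20 * reg s' 14 + R < q',
  reg s' 43 = size (L s') & list_at (arr s' aM) (L s')].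
apply: (tri_while (I := I)); last first.
- by rewrite /I /L r14 drop_size /= cats0.
- move=> q' s' _ [_ pot _ lL] r14z; rewrite /L r14z drop0 in lL pot.
  by case: q' pot => // q' pot; exists q'.
- move=> q' s' [frr fra] [j14 pot r43' lL] r14n0.
  have [q0 q0E] : exists q0, q' = q0.+4.+4.+4.+4.+4 by exists (q' - 20); move: pot r14n0; clear; lia.
  rewrite q0E in pot *; exists (q0.+4.+4.+4.+4.+3) => //; rewrite /seqs /=.
  have r12' : reg s' 12 = 1 by rewrite frr// r12.
  have [j jE] : exists j, reg s' 14 = j.+1 by exists (reg s' 14).-1; move: r14n0; clear; lia.
  rewrite jE in j14 pot.
  have Xfr : arr s' aX = arr s aX by apply: fra; rewrite /= !inE XM.
  have Ffr : arr s' aF = arr s aF by apply: fra; rewrite /= !inE FM.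
  have [x [xE dE]] := list_at_nth lX j14.
  have LE s'' : reg s'' 14 = j -> L s'' = if f x then L s' else rcons (L s') x.
    move=> E; rewrite /L E jE dE rev_cons filter_rcons; case: (f x) => //=.
    by rewrite rcons_cat.
  do 3 vstep; rewrite Xfr Ffr jE r12' subn1 /= xE; vstep.
  + rewrite fE in Hx; do 2 vstep; set s'' := set_reg _ 17 _.
    have LE' : L s'' = L s' by rewrite LE// Hx.
    split; rewrite ?LE'//; [exact: ltnW|by rewrite /s'' /=; move: pot; clear; lia].
  + have fx : f x = false by rewrite -fE Hx.
    do 4 vstep; set s'' := set_reg _ 43 _.
    have LE' : L s'' = rcons (L s') x by rewrite LE// fx.
    split; rewrite ?LE' ?size_rcons; first exact: ltnW.
    * by rewrite /s'' /=; move: pot; clear; lia.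
    * by rewrite /s'' /= r12' r43' addn1.
    * apply: (list_at_rcons lL); last by rewrite /s'' /= eqxx r43' eqxx.
      by move=> i il; rewrite /s'' /= eqxx r43' ltn_eqF.
Qed.

End Rest.

Section Copy.
Variables (aX aY : nat).

Definition copy_loop : program :=
  While 15 (seqs [:: Get 16 aX 14; Add 16 16 21; Put aY 20 16; Add 20 20 12;
    Add 14 14 12; Monus 15 15 12]).

Hypothesis XY : aX != aY.

Lemma copy_ok s q R (len off w : nat) :
  reg s 12 = 1 -> reg s 14 = 0 -> reg s 15 = len -> reg s 21 = off -> reg s 20 = w ->
  20 * len + R < q ->
  tri copy_loop s q (fun q' s' => [/\ R <= q', reg s' 20 = w + len,
    forall i, i < len -> arr s' aY (w + i) = arr s aX i + off
    & forall i, i < w -> arr s' aY i = arr s aY i]).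
Proof.
move=> r12 r14 r15 r21 r20 qR.
pose I q' s' := [/\ reg s' 14 + reg s' 15 = len, reg s' 20 = w + reg s' 14, 20 * reg s' 15 + R < q',
  forall i, i < reg s' 14 -> arr s' aY (w + i) = arr s aX i + off
  & forall i, i < w -> arr s' aY i = arr s aY i].
apply: (tri_while (I := I)); last first.
- by split=> //; rewrite ?r14 ?r15 ?addn0.
- move=> q' s' _ [e1 e2 pot c1 c2] r15z.
  rewrite r15z addn0 in e1 pot; rewrite e1 in c1 e2.
  by case: q' pot => // q' pot; exists q'.
- move=> q' s' [frr fra] [e1 e2 pot c1 c2] r15n0.
  have [q0 q0E] : exists q0, q' = q0.+4.+4.+4.+4.+4 by exists (q' - 20); move: pot r15n0; clear; lia.
  rewrite q0E in pot *; exists (q0.+4.+4.+4.+4.+3) => //; rewrite /seqs /=.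
  have r12' : reg s' 12 = 1 by rewrite frr// r12.
  have r21' : reg s' 21 = off by rewrite frr// r21.
  have Xfr : arr s' aX = arr s aX by apply: fra; rewrite /= !inE XY.
  do 7 vstep; split=> /=.
  + by rewrite r12'; move: e1 r15n0; clear; lia.
  + by rewrite e2 addnA.
  + by rewrite r12'; move: pot r15n0; clear; lia.
  + move=> i; rewrite r12' addn1 ltnS leq_eqVlt eqxx e2 r21' Xfr eqn_add2l.
    by case: eqVneq => [->|_] //= /c1.
  + by move=> i iw; rewrite eqxx e2 /= ltn_eqF ?c2// ltn_addr.
Qed.

End Copy.

(* The links of a block, when its [m] sensors and [p] actuators are listed with
   the [q] matched ones first, in the order of the matching: the first [q] links
   are its sequential pairing, and the others join unmatched sensors and
   actuators, completed by those of index 0. *)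
Definition sensor_index (m l : nat) : nat := if l < m then l else 0.

Definition actuator_index (q p l : nat) : nat :=
  if l < q then if l.+1 < q then l.+1 else 0 else if l < p then l else 0.

Definition link_loop : program :=
  While 15 (seqs [:: Add 16 14 12; Monus 17 41 14;
    If 17 (Add 18 14 13) (Const 18 0); Put 26 14 18; Monus 17 42 14;
    If 17 (seqs [:: Monus 17 42 16; If 17 (Add 18 16 13) (Const 18 0)])
          (seqs [:: Monus 17 40 14; If 17 (Add 18 14 13) (Const 18 0)]);
    Put 27 14 18; Add 14 16 13; Monus 15 15 12]).

Lemma link_ok s c R (p m q len : nat) :
  reg s 12 = 1 -> reg s 13 = 0 -> reg s 14 = 0 -> reg s 15 = len ->
  reg s 40 = p -> reg s 41 = m -> reg s 42 = q -> 20 * len + R < c ->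
  tri link_loop s c (fun c' s' => [/\ R <= c',
    forall l, l < len -> arr s' 26 l = sensor_index m l
    & forall l, l < len -> arr s' 27 l = actuator_index q p l]).
Proof.
move=> r12 r13 r14 r15 r40 r41 r42 cR.
pose I c' s' := [/\ reg s' 14 + reg s' 15 = len, 20 * reg s' 15 + R < c',
  forall l, l < reg s' 14 -> arr s' 26 l = sensor_index m l
  & forall l, l < reg s' 14 -> arr s' 27 l = actuator_index q p l].
apply: (tri_while (I := I)); last first.
- by split=> //; rewrite ?r14 ?r15.
- move=> c' s' _ [e1 pot c1 c2] r15z.
  rewrite r15z addn0 in e1 pot; rewrite e1 in c1 c2.
  by case: c' pot => // c' pot; exists c'.
- move=> c' s' [frr fra] [e1 pot c1 c2] r15n0.
  have [c0 c0E] : exists c0, c' = c0.+4.+4.+4.+4.+4 by exists (c' - 20); move: pot r15n0; clear; lia.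
  rewrite c0E in pot *; exists (c0.+4.+4.+4.+4.+3) => //; rewrite /seqs /=.
  have r12' : reg s' 12 = 1 by rewrite frr// r12.
  have r13' : reg s' 13 = 0 by rewrite frr// r13.
  have r40' : reg s' 40 = p by rewrite frr// r40.
  have r41' : reg s' 41 = m by rewrite frr// r41.
  have r42' : reg s' 42 = q by rewrite frr// r42.
  (* All branches of the body end alike, up to the two entries written. *)
  have fin (s1 : state) c1' : reg s1 14 = (reg s' 14).+1 -> reg s1 15 = (reg s' 15).-1 ->
      c0 <= c1' ->
      (forall l, arr s1 26 l = if l == reg s' 14 then sensor_index m l else arr s' 26 l) ->
      (forall l, arr s1 27 l = if l == reg s' 14 then actuator_index q p l else arr s' 27 l) ->
      I c1' s1.
    move=> E14 E15 cc A26 A27; split; rewrite ?E14 ?E15.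
    - by move: e1 r15n0; clear; lia.
    - by move: pot r15n0 cc; clear; lia.
    - by move=> l; rewrite ltnS leq_eqVlt A26; case: eqVneq => //= _ /c1.
    - by move=> l; rewrite ltnS leq_eqVlt A27; case: eqVneq => //= _ /c2.
  have sub0 a b : (a - b != 0) = (b < a) by rewrite subn_eq0 ltnNge.
  do 2 vstep; rewrite r12' r41' addn1; vstep; do 3 vstep; rewrite ?r13' ?addn0 ?r42';
    vstep; vstep; rewrite ?r42' ?r40' /=; vstep.
  all: do 6 vstep; rewrite ?r12' ?r13' ?addn0 ?subn1; (apply: fin => //=; [by clear; lia| |]).
  all: move=> l; case: eqVneq => // ->; rewrite /sensor_index /actuator_index -!sub0.
  all: by rewrite ?Hx ?Hx0 ?Hx1.
Qed.

End Loops.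

(** * Representatives and matching as program stages *)

Section Stages.
Local Open Scope nat_scope.

Definition two_pass (aH aN aT L1 L2 X1 X2 : nat) : program :=
  seqs [:: Add 14 10 13; Const 15 0; pass_loop aH aN aT L1 12 X1;
           Add 14 15 13; Const 15 0; pass_loop aH aN aT L2 X1 X2].

Definition consts_at (s : state) : Prop := reg s 12 = 1 /\ reg s 13 = 0.

(** Each pass reads its list backwards. Run on all states and then on its own output, it performs
    the two greedy passes in opposite orders, and the labels of the second one send every state to a
    representative that reaches it. *)
Lemma two_pass_ok (aH aN aT L1 L2 X1 X2 n : nat) (e : rel 'I_n) (adj : 'I_n -> seq 'I_n) m s q R :
  uniq [:: aH; aN; aT; L1; 21; 12; X1] -> uniq [:: aH; aN; aT; L2; 21; X1; X2] ->
  all (fun a => a \notin [:: X1; L1; 21]) [:: aH; aN; aT; L2] ->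
  (forall v y, (y \in adj v) = e v y) ->
  consts_at s -> reg s 10 = n -> graph_at aH aN aT adj m s ->
  list_at (arr s 12) (enum 'I_n) ->
  (forall v : 'I_n, arr s L1 v = 0) -> (forall v : 'I_n, arr s L2 v = 0) ->
  20 * n + 20 * n + 40 * \sum_(v : 'I_n) (size (adj v)).+2 + 20 + R < q ->
  tri (two_pass aH aN aT L1 L2 X1 X2) s q (fun q' s' => R <= q' /\ exists B,
    [/\ source_basis e B, reg s' 15 = size B, list_at (arr s' X2) B
      & forall v : 'I_n, exists r : 'I_n, [/\ r \in B, arr s' L2 v = r.+1 & connect e r v]]).
Proof.
move=> U1 U2 U3 adjE [r12 r13] r10 gs id12 z1 z2.
set W := \sum_(v : 'I_n) _ => qR.
have WE : \sum_(v < n) (size (adj v)).+2 = W by [].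
have [q0 q0E] : exists q0, q = q0.+4.+4 by exists (q - 8); move: qR; clear; lia.
rewrite q0E in qR *; rewrite /two_pass /seqs /=; do 2 vstep; apply: tri_seq.
set s1 := set_reg _ 15 0.
have szo : size (enum 'I_n) = n by rewrite size_enum_ord.
have H1 := @pass_ok aH aN aT L1 12 X1 U1 n e adj m adjE (enum 'I_n) s1 q0.+2.+4
  (20 * n + 20 * W + 10 + R) gs r12 r13 _ erefl id12 z1 _.
apply: (tri_mono (leqnn _) _ (tri_frame (H1 _ _))).
- move=> q1 s2 [[E15 lX _ _ q1E] [fr fa]].
  have [q2 q2E] : exists q2, q1 = q2.+4.+4 by exists (q1 - 8); move: q1E; clear; lia.
  rewrite q2E in q1E *; do 2 vstep; apply: tri_seq.
  set B1 := greedy e (rev (enum 'I_n)) in E15 lX.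
  set s3 := set_reg _ 15 0.
  have r12' : reg s3 12 = 1 by rewrite /= fr.
  have r13' : reg s3 13 = 0 by rewrite /= fr.
  have keep a : a \in [:: aH; aN; aT; L2] -> arr s3 a = arr s a.
    move=> /(allP U3); rewrite !inE !negb_or => /and3P[h1 h2 h3].
    by rewrite /= fa//= !inE !negb_or h1 h2 h3.
  have gs3 : graph_at aH aN aT adj m s3.
    by move=> v; rewrite !keep ?inE ?eqxx ?orbT//; exact: gs.
  have r14' : reg s3 14 = size B1 by rewrite /= E15 fr//= r13 addn0.
  have zL : forall v : 'I_n, arr s3 L2 v = 0 by move=> v; rewrite keep ?inE ?eqxx ?orbT.
  have szB : size B1 <= n by rewrite (leq_trans (size_subseq (greedy_subseq _ _)))// size_rev szo.
  have H2 := @pass_ok aH aN aT L2 X1 X2 U2 n e adj m adjE B1 s3 q2.+2.+4 R.+2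
    gs3 r12' r13' r14' erefl lX zL.
  apply: (tri_mono (leqnn _) _ (H2 _)).
  + move=> q3 s4 [E15' lX' lab labP q3E].
    case: q3 q3E => // q3 q3E; vstep; split; first by move: q3E; clear; lia.
    exists (greedy e (rev B1)).
    have bB : source_basis e (greedy e (rev B1)).
      by apply: greedy2_source_basis => x; rewrite mem_rev mem_enum.
    split=> // v; apply: lab; rewrite labP.
    by have [_ cov _] := bB; have [t tB tv] := cov v; apply/hasP; exists t.
  + rewrite WE; move: q1E szB; clear; move: (size B1) W => b W; lia.
- by rewrite /= r13 r10 addn0 szo.
- by rewrite WE szo; move: qR; clear; lia.
Qed.

Definition match_prog : program :=
  seqs [:: Add 14 40 13; Const 42 0; half_loop 16 19 22 23 24 25;
           Add 14 41 13; half_loop 20 15 23 22 25 24;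
           Add 14 40 13; Add 43 42 13; rest_loop 16 22 24;
           Add 14 41 13; Add 43 42 13; rest_loop 20 23 25].

(* What is needed of a maximum matching, and can be had in linear time. *)
Definition pairing_ok (n : nat) (c : rel 'I_n) (S T : seq 'I_n) (M : seq ('I_n * 'I_n)) : Prop :=
  [/\ uniq (unzip1 M) /\ uniq (unzip2 M),
      forall e, e \in M -> [/\ e.1 \in S, e.2 \in T & c e.1 e.2],
      forall x, x \in S -> x \in unzip1 M \/ exists2 y, y \in unzip2 M & c x y
    & forall y, y \in T -> y \in unzip2 M \/ exists2 x, x \in unzip1 M & c x y].

Definition with_unmatched (n : nat) (l S : seq 'I_n) : seq 'I_n :=
  l ++ [seq x <- rev S | x \notin l].

(** The second half of the matching proposes pairs from the side of the sinks, with the arrays of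
    the two ends exchanged. *)
Definition swap_pairs (n : nat) (M : seq ('I_n * 'I_n)) : seq ('I_n * 'I_n) :=
  [seq (e.2, e.1) | e <- M].

Lemma unzip1_swap n (M : seq ('I_n * 'I_n)) : unzip1 (swap_pairs M) = unzip2 M.
Proof. by rewrite /unzip1 /unzip2 -map_comp. Qed.

Lemma unzip2_swap n (M : seq ('I_n * 'I_n)) : unzip2 (swap_pairs M) = unzip1 M.
Proof. by rewrite /unzip1 /unzip2 -map_comp. Qed.

Lemma mem_swap n (M : seq ('I_n * 'I_n)) x y : ((x, y) \in swap_pairs M) = ((y, x) \in M).
Proof.
apply/mapP/idP => [[[a b] abM [-> ->]]//|yxM]; by exists (y, x).
Qed.

(** Array 19 gives each state a sink representative that it reaches, and array 15 a source
    representative that reaches it. These are the partners proposed in the two halves. *)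
Lemma match_ok n (c : rel 'I_n) (S T : seq 'I_n) s q R :
  consts_at s -> reg s 40 = size S -> reg s 41 = size T ->
  list_at (arr s 16) S -> list_at (arr s 20) T ->
  (forall v : 'I_n, exists t : 'I_n, [/\ t \in T, arr s 19 v = t.+1 & c v t]) ->
  (forall v : 'I_n, exists r : 'I_n, [/\ r \in S, arr s 15 v = r.+1 & c r v]) ->
  (forall i, arr s 22 i = 0) -> (forall i, arr s 23 i = 0) ->
  40 * size S + 40 * size T + 50 + R < q ->
  tri match_prog s q (fun q' s' => R <= q' /\ exists M, [/\ pairing_ok c S T M,
    reg s' 42 = size M, list_at (arr s' 24) (with_unmatched (unzip1 M) S)
    & list_at (arr s' 25) (with_unmatched (unzip2 M) T)]).
Proof.
move=> [r12 r13] r40 r41 lS lT /choice[h hP] /choice[g gP] z22 z23 qR.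
have [q0 q0E] : exists q0, q = q0.+4.+4 by exists (q - 8); move: qR; clear; lia.
rewrite q0E in qR *; rewrite /match_prog /seqs /=; do 2 vstep; apply: tri_seq.
set s1 := set_reg _ 42 0.
have m1 : matched_at 22 23 24 25 ([::] : seq ('I_n * 'I_n)) s1.
  split=> [//|//|x|x|//]; first by rewrite -[LHS]/(arr s 22 x != 0) z22.
  by rewrite -[LHS]/(arr s 23 x != 0) z23.
have H1 := @half_ok n 16 19 22 23 24 25 isT S h [::] s1 q0.+2.+4
  (20 * size S + 40 * size T + 40 + R) r12 _ lS _ m1 _.
apply: (tri_mono (leqnn _) _ (tri_frame (H1 _ _ _))).
- move=> q1 s2 [[q1E [M1 [m2 _ M1P SP]]] [fr fa]].
  have [q2 q2E] : exists q2, q1 = q2.+4.+4 by exists (q1 - 8); move: q1E; clear; lia.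
  rewrite q2E in q1E *; vstep; apply: tri_seq.
  set s3 := set_reg _ 14 _.
  have m3 : matched_at 23 22 25 24 (swap_pairs M1) s3.
    case: m2 => r42 [l1 l2] f1 f2 [u1 u2].
    by split; rewrite ?unzip1_swap ?unzip2_swap//= ?size_map.
  have H2 := @half_ok n 20 15 23 22 25 24 isT T g (swap_pairs M1) s3 q2.+3.+4
    (20 * size S + 20 * size T + 30 + R) _ _ _ _ m3 _.
  apply: (tri_mono (leqnn _) _ (tri_frame (H2 _ _ _ _ _))).
  + move=> q3 s4 [[q3E [M2 [m4 M12 M2P TP]]] [fr4 fa4]].
    have [q4 q4E] : exists q4, q3 = q4.+4.+4 by exists (q3 - 8); move: q3E; clear; lia.
    rewrite q4E in q3E *; do 2 vstep; apply: tri_seq.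
    have pr : pairing_ok c S T (swap_pairs M2).
      case: m4 => _ _ _ _ [u1 u2]; split.
      - by rewrite unzip1_swap unzip2_swap.
      - move=> [x y]; rewrite mem_swap => /M2P[|/= [yT ->]].
          rewrite mem_swap => /M1P[//|/= [xS ->]].
          by have [] := hP x.
        by have [] := gP y.
      - have sub e : e \in M1 -> (e.2, e.1) \in M2.
          by move=> eM; apply: M12; rewrite mem_swap -surjective_pairing.
        rewrite unzip1_swap unzip2_swap => x xS.
        have [/mapP[e /sub eM ->]|/mapP[e /sub eM hx]] := SP x xS.
          by left; apply/mapP; exists (e.2, e.1).
        right; exists (h x); last by have [] := hP x.
        by apply/mapP; exists (e.2, e.1).
      - rewrite unzip1_swap unzip2_swap => y yT.
        by have [yM|gM] := TP y yT; [left|right; exists (g y) => //; have [] := gP y].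
    case: m4 => r42 [l1 l2] f1 f2 _.
    set s5 := set_reg _ 43 _.
    have r13' : reg s4 13 = 0 by rewrite fr4//= fr.
    have r12' : reg s5 12 = 1 by rewrite /= fr4//= fr.
    have r40' : reg s4 40 = size S by rewrite fr4//= fr//= r40.
    have r41' : reg s4 41 = size T by rewrite fr4//= fr//= r41.
    have lS5 : list_at (arr s5 16) S by rewrite /= fa4//= fa.
    have lT5 : list_at (arr s5 20) T by rewrite /= fa4//= fa.
    have H3 := @rest_ok n 16 22 24 isT isT S (unzip2 M2) [in unzip2 M2] s5 q4.+2.+4
      (20 * size T + 20 + R) r12' _ lS5 f2 _ l2 _.
    apply: (tri_mono (leqnn _) _ (tri_frame (H3 _ _ _))).
    * move=> q5 s6 [[q5E l24] [fr6 fa6]].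
      have [q6 q6E] : exists q6, q5 = q6.+4.+4 by exists (q5 - 8); move: q5E; clear; lia.
      rewrite q6E in q5E *; do 2 vstep; apply: tri_seq.
      set s7 := set_reg _ 43 _.
      have r12'' : reg s7 12 = 1 by rewrite /= fr6.
      have lT7 : list_at (arr s7 20) T by rewrite /= fa6.
      have f17 (x : 'I_n) : (arr s7 23 x != 0) = (x \in unzip1 M2) by rewrite /= fa6 //; exact: f1.
      have l17 : list_at (arr s7 25) (unzip1 M2) by rewrite /= fa6.
      have H4 := @rest_ok n 20 23 25 isT isT T (unzip1 M2) [in unzip1 M2] s7 q6.+2.+4
        (10 + R) r12'' _ lT7 f17 _ l17 _.
      apply: (tri_mono (leqnn _) _ (tri_frame (H4 _ _ _))).
      - move=> q7 s8 [[q7E l25] [fr8 fa8]].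
        case: q7 q7E => // q7 q7E; vstep; split; first by move: q7E; clear; lia.
        exists (swap_pairs M2); split=> //.
        + by rewrite fr8//= fr6//= r42 size_map.
        + by rewrite fa8//= unzip1_swap.
        + by rewrite unzip2_swap.
      - by rewrite /= fr6//= r41' fr6//= r13' addn0.
      - by rewrite /= fr6//= r42 fr6//= r13' addn0 size_map.
      - by move: q5E; clear; move: (size T) => t; lia.
    * by rewrite /= r40' r13' addn0.
    * by rewrite /= r42 r13' addn0 size_map.
    * by move: q3E; clear; move: (size T) (size S) => t t'; lia.
  + by rewrite /= fr.
  + by rewrite /= fr//= r41 fr//= r13 addn0.
  + by rewrite /= fa.
  + by move=> x _; rewrite /= fa//=; have [] := gP x.
  + by move: q1E; clear; move: (size T) (size S) => t t'; lia.
- by rewrite /= r40 r13 addn0.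
- by move=> x _; have [] := hP x.
- by move: qR; clear; move: (size T) (size S) => t t'; lia.
Qed.

End Stages.

(** * Writing out the blocks *)

Section Output.
Local Open Scope nat_scope.

Definition emit (aX aY len w off : nat) : program :=
  seqs [:: Const 14 0; Add 15 len 13; Add 20 w 13; Add 21 off 13; copy_loop aX aY].

Lemma emit_ok aX aY len w off s q R (L W O : nat) : aX != aY ->
  all (fun x => x \notin [:: 14; 15; 20; 21]) [:: len; w; off] ->
  consts_at s -> reg s len = L -> reg s w = W -> reg s off = O ->
  20 * L + 10 + R < q ->
  tri (emit aX aY len w off) s q (fun q' s' => [/\ R <= q', reg s' 20 = W + L,
    forall i, i < L -> arr s' aY (W + i) = arr s aX i + O,
    forall i, i < W -> arr s' aY i = arr s aY i & frame (emit aX aY len w off) s s']).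
Proof.
move=> XY /and4P[lenN wN offN _] [r12 r13] rlen rw roff qR.
have [q0 q0E] : exists q0, q = q0.+4.+4 by exists (q - 8); move: qR; clear; lia.
move: lenN wN offN; rewrite !inE !negb_or.
move=> /and4P[/negbTE l14 _ _ _] /and4P[/negbTE w14 /negbTE w15 _ _].
move=> /and4P[/negbTE o14 /negbTE o15 /negbTE o20 _].
apply: (tri_mono (leqnn _) _ (tri_frame (Q := fun q' s' => [/\ R <= q', reg s' 20 = W + L,
    forall i, i < L -> arr s' aY (W + i) = arr s aX i + O
    & forall i, i < W -> arr s' aY i = arr s aY i]) _)).
  by move=> r s' [[? ? ? ?] ?]; split.
rewrite q0E in qR *; rewrite /emit /seqs /=; do 4 vstep; apply: tri_seq.
rewrite l14 w15 w14 o20 o15 o14 r13 !addn0 rlen rw roff.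
apply: (tri_mono (leqnn _) _ (@copy_ok aX aY XY _ _ R.+1 L O W _ _ _ _ _ _)) => //.
- by move=> r s' [rE h1 h2 h3]; case: r rE => // r rE; vstep; split.
- by move: qR; clear; lia.
Qed.

(** Registers 50 and 51 keep the numbers of actuators and sensors written before the current block,
    which are the offsets of its labels in the links. *)
Definition out_loop : program :=
  While 28 (seqs [:: Add 50 0 13; Add 51 1 13;
    emit 24 2 40 0 13; Add 0 20 13;
    emit 25 3 41 1 13; Add 1 20 13;
    emit 26 4 44 2 51;
    emit 27 5 44 2 50; Add 2 20 13;
    Monus 28 28 12]).

Definition blocks_at (f : nat -> nat) (p i : nat) (g h : nat -> nat) : Prop :=
  forall j l, j < i -> l < p -> f (j * p + l) = g l + h j.

Lemma blocks_at_step f f' p i g h : blocks_at f p i g h ->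
  (forall l, l < p -> f' (i * p + l) = g l + h i) ->
  (forall l, l < i * p -> f' l = f l) -> blocks_at f' p i.+1 g h.
Proof.
move=> B new old j l; rewrite ltnS leq_eqVlt => /orP[/eqP -> lp|ji lp]; first exact: new.
rewrite old ?B//; have : j.+1 * p <= i * p by rewrite leq_mul2r ji orbT.
by apply: leq_trans; rewrite mulSn addnC ltn_add2r.
Qed.

Lemma out_ok s q R (k p m x : nat) :
  consts_at s -> reg s 28 = k -> reg s 0 = 0 -> reg s 1 = 0 -> reg s 2 = 0 ->
  reg s 40 = p -> reg s 41 = m -> reg s 44 = x ->
  k * (20 * p + 20 * m + 40 * x + 100) + R < q ->
  tri out_loop s q (fun q' s' => [/\ R <= q',
    [/\ reg s' 0 = k * p, reg s' 1 = k * m & reg s' 2 = k * x],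
    blocks_at (arr s' 2) p k (arr s 24) (fun=> 0) /\ blocks_at (arr s' 3) m k (arr s 25) (fun=> 0),
    blocks_at (arr s' 4) x k (arr s 26) (fun i => i * m)
    & blocks_at (arr s' 5) x k (arr s 27) (fun i => i * p)]).
Proof.
move=> [r12 r13] r28 r0 r1 r2 r40 r41 r44 qR.
pose I q' s' := exists i, [/\ i + reg s' 28 = k,
    [/\ reg s' 0 = i * p, reg s' 1 = i * m & reg s' 2 = i * x],
    blocks_at (arr s' 2) p i (arr s 24) (fun=> 0) /\ blocks_at (arr s' 3) m i (arr s 25) (fun=> 0),
    blocks_at (arr s' 4) x i (arr s 26) (fun i => i * m) /\
    blocks_at (arr s' 5) x i (arr s 27) (fun i => i * p)
    & reg s' 28 * (20 * p + 20 * m + 40 * x + 100) + R < q'].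
apply: (tri_while (I := I)); last first.
- by exists 0; rewrite r28 r0 r1 r2; split.
- move=> q' s' _ [i [iE rE [B2 B3] [B4 B5] pot]] r28z.
  rewrite r28z addn0 in iE pot; subst i.
  by case: q' pot => // q' pot; exists q'.
- move=> q' s' [frr fra] [i [iE [r0' r1' r2'] [B2 B3] [B4 B5] pot]] r28n.
  have [j jE] : exists j, reg s' 28 = j.+1 by exists (reg s' 28).-1; move: r28n; clear; lia.
  have c' : consts_at s' by split; rewrite frr.
  have r12' : reg s' 12 = 1 by case: c'.
  have r13' : reg s' 13 = 0 by case: c'.
  have r40' : reg s' 40 = p by rewrite frr.
  have r41' : reg s' 41 = m by rewrite frr.
  have r44' : reg s' 44 = x by rewrite frr.
  have A24 : arr s' 24 = arr s 24 by rewrite fra.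
  have A25 : arr s' 25 = arr s 25 by rewrite fra.
  have A26 : arr s' 26 = arr s 26 by rewrite fra.
  have A27 : arr s' 27 = arr s 27 by rewrite fra.
  rewrite jE in iE pot.
  set cost := 20 * p + 20 * m + 40 * x + 100 in pot.
  have {}pot : j * cost + cost + R < q' by move: pot; rewrite mulSn [cost + _]addnC.
  have [q0 q0E] : exists q0, q' = q0.+4.+4 by exists (q' - 8); move: pot; rewrite /cost; clear; lia.
  rewrite q0E in pot *; exists (q0.+4.+3) => //; rewrite /seqs /=; do 2 vstep; apply: tri_seq.
  set s1 := set_reg _ 51 _.
  apply: (tri_mono (leqnn _) _ (@emit_ok 24 2 40 0 13 s1 _
    (j * cost + 20 * m + 40 * x + 80 + R) p (i * p) 0 isT isT _ _ _ _ _)) => //; last first.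
    by move: pot; rewrite /cost; clear; move: (j * _) => jc; lia.
  move=> q2 s2 [q2E w2 N2 O2 [fr2 fa2]].
  have [q2' q2'E] : exists q2', q2 = q2'.+4 by exists (q2 - 4); move: q2E; clear; move: (j * _) => jc; lia.
  rewrite q2'E in q2E *; vstep; apply: tri_seq.
  rewrite w2 fr2//= r13' addn0.
  set s3 := set_reg _ 0 _.
  apply: (tri_mono (leqnn _) _ (@emit_ok 25 3 41 1 13 s3 _
    (j * cost + 40 * x + 60 + R) m (i * m) 0 isT isT _ _ _ _ _)); last first.
  all: try by rewrite /s3 /= fr2.
  all: try by split; rewrite /s3 /= fr2.
    by move: q2E; clear; move: (j * _) => jc; lia.
  move=> q4 s4 [q4E w4 N4 O4 [fr4 fa4]].
  have [q4' q4'E] : exists q4', q4 = q4'.+4 by exists (q4 - 4); move: q4E; clear; move: (j * _) => jc; lia.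
  rewrite q4'E in q4E *; vstep; apply: tri_seq.
  rewrite w4 fr4//= fr2//= r13' addn0.
  set s5 := set_reg _ 1 _.
  apply: (tri_mono (leqnn _) _ (@emit_ok 26 4 44 2 51 s5 _
    (j * cost + 20 * x + 40 + R) x (i * x) (i * m) isT isT _ _ _ _ _)); last first.
  all: try by rewrite /s5 /= fr4//= fr2.
  all: try by split; rewrite /s5 /= fr4//= fr2.
    by move: q4E; clear; move: (j * _) => jc; lia.
    by rewrite /s5 /= fr4//= fr2//= r1' r13' addn0.
  move=> q6 s6 [q6E w6 N6 O6 [fr6 fa6]].
  apply: tri_seq.
  apply: (tri_mono (leqnn _) _ (@emit_ok 27 5 44 2 50 s6 _
    (j * cost + 20 + R) x (i * x) (i * p) isT isT _ _ _ _ _)); last first.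
  all: try by rewrite fr6//= fr4//= fr2.
  all: try by split; rewrite fr6//= fr4//= fr2.
    by move: q6E; clear; move: (j * _) => jc; lia.
    by rewrite fr6//= fr4//= fr2//= r0' r13' addn0.
  move=> q8 s8 [q8E w8 N8 O8 [fr8 fa8]].
  have [q8' q8'E] : exists q8', q8 = q8'.+4 by exists (q8 - 4); move: q8E; clear; move: (j * _) => jc; lia.
  rewrite q8'E in q8E *; do 3 vstep.
  have e28 : reg s8 28 = j.+1 by rewrite fr8//= fr6//= fr4//= fr2.
  have e12 : reg s8 12 = 1 by rewrite fr8//= fr6//= fr4//= fr2.
  have e13 : reg s8 13 = 0 by rewrite fr8//= fr6//= fr4//= fr2.
  rewrite e28 e12 e13 w8 subn1 addn0 /=.
  exists i.+1; split=> /=.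
  + by rewrite addSnnS.
  + split; rewrite ?mulSn ?[_ + i * _]addnC//.
      by rewrite fr8//= fr6//= fr4.
    by rewrite fr8//= fr6.
  + split.
      rewrite fa8// fa6// fa4//; apply: (blocks_at_step B2) => [l lp|l lp].
        by rewrite N2//= A24.
      by rewrite O2.
    rewrite fa8// fa6//; apply: (blocks_at_step B3) => [l lp|l lp].
      by rewrite N4//= fa2//= A25.
    by rewrite O4//= fa2.
  + split.
      rewrite fa8//; apply: (blocks_at_step B4) => [l lp|l lp].
        by rewrite N6//= fa4//= fa2//= A26.
      by rewrite O6//= fa4//= fa2.
    apply: (blocks_at_step B5) => [l lp|l lp].
      by rewrite N8//= fa6//= fa4//= fa2//= A27.
    by rewrite O8//= fa6//= fa4//= fa2.
  + by move: q8E; clear; move: (j * _) => jc; lia.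
Qed.

End Output.

(** * The whole program and its cost *)

Section Program.
Local Open Scope nat_scope.

(* Registers 40, 41, 42 and 44 receive the numbers of source components, of sink
   components, of matched pairs and of links per block; the search labels that
   drive the matching are in arrays 15 and 19. *)
Definition design_program : program :=
  seqs [:: Const 12 1; Add 10 0 13; Add 28 1 12; Add 21 10 13; build_loop;
    two_pass 6 7 8 13 15 14 16; Add 40 15 13;
    two_pass 9 10 11 17 19 18 20; Add 41 15 13;
    match_prog;
    Monus 44 40 41; Add 44 44 41; Const 14 0; Add 15 44 13; link_loop;
    Const 0 0; Const 1 0; Const 2 0; out_loop].

Context {n : nat} (A : 'M[bool]_n) (k : nat).

Lemma source_basis_size (e : rel 'I_n) B : source_basis e B -> size B <= n.
Proof. by move=> [/card_uniqP <- _ _]; rewrite -[X in _ <= X]card_ord max_card. Qed.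

Lemma with_unmatched_perm (l S : seq 'I_n) : uniq l -> uniq S -> {subset l <= S} ->
  perm_eq (with_unmatched l S) S.
Proof.
move=> ul uS lS; apply: uniq_perm => //.
  rewrite cat_uniq ul filter_uniq ?rev_uniq// andbT /=.
  by apply/hasPn => x; rewrite mem_filter => /andP[].
move=> x; rewrite mem_cat mem_filter mem_rev.
by case: (boolP (x \in l)) => //= xl; rewrite lS.
Qed.

Lemma pairing_perm (c : rel 'I_n) S T M : uniq S -> uniq T -> pairing_ok c S T M ->
  perm_eq (with_unmatched (unzip1 M) S) S /\ perm_eq (with_unmatched (unzip2 M) T) T.
Proof.
move=> uS uT [[u1 u2] MP _ _].
by split; apply: with_unmatched_perm => // _ /mapP[e /MP[? ? _] ->].
Qed.

(** With truncated subtraction [p - m + m] is the maximum of [p] and [m]. The constants 1000 and 600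
    are generous totals over the stages. *)
Lemma design_program_ok c :
  1000 * (k.+1 * (n + size (edge_list A))) + 600 * k.+1 < c ->
  tri design_program (input_state A k) c (fun _ s' => exists S T M,
    let p := size S in let m := size T in let x := p - m + m in
    [/\ source_basis (edge A) S /\ source_basis (edge A^T) T,
      pairing_ok (connect (edge A)) S T M,
      [/\ reg s' 0 = k.+1 * p, reg s' 1 = k.+1 * m & reg s' 2 = k.+1 * x],
      (forall j l, j < k.+1 -> l < p ->
         arr s' 2 (j * p + l) = nth 0 (map val (with_unmatched (unzip1 M) S)) l) /\
      (forall j l, j < k.+1 -> l < m ->
         arr s' 3 (j * m + l) = nth 0 (map val (with_unmatched (unzip2 M) T)) l)
    & forall j l, j < k.+1 -> l < x -> arr s' 4 (j * x + l) = sensor_index m l + j * m /\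
         arr s' 5 (j * x + l) = actuator_index (size M) p l + j * p]).
Proof.
set E := size _ => cE.
pose N := k.+1 * (n + E).
have NE : n + E <= N by rewrite leq_pmull.
have {cE} [c0 c0E cN] : exists2 c0, c = c0.+4.+4 & 900 * (n + E) + (100 * (k.+1 * n) + 500 * k.+1) < c0.
  exists (c - 8); move: cE; rewrite -/N; have := NE; have : k.+1 * n <= N by rewrite leq_mul2l leq_addr orbT.
    by clear; move: N (k.+1 * n) => N N'; lia.
  by clear; move: N (k.+1 * n) => N N'; lia.
rewrite c0E; rewrite /design_program /seqs /=; do 4 vstep; apply: tri_seq.
pose s0 := input_state A k.
have az a i : 2 <= a -> arr s0 a i = 0.
  by case: a => [|[|a]] // _; rewrite /= nth_nil nth_nil.
set s1 := set_reg _ 21 _.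
(* Reserve for the output loop: [p], [m] and their maximum are at most [n], so one block costs at
   most [80 * n + 100]. *)
pose O := k.+1 * (80 * n + 100).
have OE : O <= 100 * (k.+1 * n) + 100 * k.+1.
  by rewrite /O mulnDr mulnCA [_ * 100]mulnC leq_add2r leq_mul2r orbT.
have O100 : 100 <= O by rewrite /O mulnDr (leq_trans _ (leq_addl _ _))// leq_pmull.
have H1 := @build_ok n A s1 c0.+4 (860 * (n + E) + O + 300).
apply: (tri_mono (leqnn _) _ (tri_frame (H1 _ _ _ _ _ _ _ _))).
- move=> q2 s2 [[gf gb id12 q2E] [fr2 fa2]].
  apply: tri_seq.
  have c2 : consts_at s2 by split; rewrite fr2.
  have n2 : reg s2 10 = n by rewrite fr2//= addn0.
  have z2 a i : 13 <= a -> arr s2 a i = 0.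
    move=> a13; rewrite fa2; first by rewrite -[LHS]/(arr s0 a i) az// (leq_trans _ a13).
    by rewrite /= !inE !negb_or; do ?[apply/andP; split]; rewrite gtn_eqF// (leq_trans _ a13).
  have l2 : list_at (arr s2 12) (enum 'I_n).
    by move=> i; rewrite size_enum_ord => ilt; rewrite id12// val_enum_ord nth_iota.
  have WE f : \sum_v size (f v) = E -> \sum_(v < n) (size (f v : seq 'I_n)).+2 = E + 2 * n.
    move=> <-; rewrite -(eq_bigr _ (fun v _ => addn2 _)) big_split /= sum_nat_const card_ord.
    by rewrite mulnC.
  have W1 := WE _ (sum_out_list (edge_list A)); have W2 := WE _ (sum_in_list (edge_list A)).
  have H2 := @two_pass_ok 6 7 8 13 15 14 16 n (edge A) _ E s2 q2
    (680 * (n + E) + O + 200) isT isT isT (@mem_out_list n A) c2 n2 gf l2.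
  apply: (tri_mono (leqnn _) _ (tri_frame (H2 _ _ _))) => {H2}.
  + move=> q3 s3 [[q3E [S [bS pS lS labS]]] [fr3 fa3]].
    case: q3 q3E => [|q3] q3E; first by move: q3E; clear; lia.
    vstep; apply: tri_seq; set s4 := set_reg _ 40 _.
    have c4 : consts_at s4 by case: c2 => h1 h2; split; rewrite /= fr3.
    have n4 : reg s4 10 = n by rewrite /= fr3.
    have l4 : list_at (arr s4 12) (enum 'I_n) by rewrite /= fa3.
    have z4 a i : 17 <= a -> a != 21 -> arr s4 a i = 0.
      move=> a17 a21; rewrite /= fa3; first by rewrite z2// (leq_trans _ a17).
      by rewrite /= !inE !negb_or a21; do ?[apply/andP; split] => //; rewrite gtn_eqF// (leq_trans _ a17).
    have gb4 : graph_at 9 10 11 (in_list (edge_list A)) E s4.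
      by move=> v; rewrite /= !fa3//; exact: gb.
    have H3 := @two_pass_ok 9 10 11 17 19 18 20 n (edge A^T) _ E s4 q3
      (500 * (n + E) + O + 100) isT isT isT (@mem_in_list n A) c4 n4 gb4 l4.
    apply: (tri_mono (leqnn _) _ (tri_frame (H3 _ _ _))) => {H3}.
    * move=> q5 s5 [[q5E [T [bT mT lT labT]]] [fr5 fa5]].
      case: q5 q5E => [|q5] q5E; first by move: q5E; clear; lia.
      vstep; apply: tri_seq; set s6 := set_reg _ 41 _.
      have c6 : consts_at s6 by case: c4 => h1 h2; split; rewrite /= fr5.
      have r13 : reg s5 13 = 0 by case: c6.
      have r40 : reg s6 40 = size S.
        by rewrite /= fr5//= pS fr3//=; case: c2 => _ ->; rewrite addn0.
      have r41 : reg s6 41 = size T by rewrite /= mT r13 addn0.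
      have lS6 : list_at (arr s6 16) S by rewrite /= fa5.
      have z6 a i : 22 <= a -> arr s6 a i = 0.
        move=> a22; rewrite /= fa5; first by rewrite z4 ?(leq_trans _ a22)// gtn_eqF.
        by rewrite /= !inE !negb_or; do ?[apply/andP; split] => //; rewrite gtn_eqF// (leq_trans _ a22).
      have Sn := source_basis_size bS; have Tn := source_basis_size bT.
      have H4 := @match_ok n (connect (edge A)) S T s6 q5 (400 * (n + E) + O + 20) c6 r40 r41 lS6 lT.
      apply: (tri_mono (leqnn _) _ (tri_frame (H4 _ _ _ _ _))) => {H4}.
      - move=> q7 s7 [[q7E [M [pM rM l24 l25]]] [fr7 fa7]].
        have [q8 q8E] : exists q8, q7 = q8.+4.+4 by exists (q7 - 8); move: q7E O100; clear; lia.
        rewrite q8E in q7E *; do 4 vstep; apply: tri_seq; set s8 := set_reg _ 15 _.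
        have c8 : consts_at s8 by case: c6 => h1 h2; split; rewrite /= fr7.
        have e13 : reg s7 13 = 0 by case: c8.
        have e40 : reg s7 40 = size S by rewrite fr7.
        have e41 : reg s7 41 = size T by rewrite fr7.
        have e44 : reg s8 44 = size S - size T + size T.
          by rewrite /s8 /= e40 e41.
        have e15 : reg s8 15 = size S - size T + size T by rewrite /s8 /= e13 addn0 e40 e41.
        have H5 := @link_ok s8 q8.+4 (300 * (n + E) + O + 10) (size S) (size T) (size M) _
          (proj1 c8) (proj2 c8) erefl e15 e40 e41 rM.
        apply: (tri_mono (leqnn _) _ (tri_frame (H5 _))) => {H5}.
          move=> q9 s9 [[q9E l26 l27] [fr9 fa9]].
          have [q10 q10E] : exists q10, q9 = q10.+4.
            by exists (q9 - 4); move: q9E O100; clear; lia.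
          rewrite q10E in q9E *; do 3 vstep; apply: tri_seq; set s10 := set_reg _ 2 0.
          have e28 : reg s10 28 = k.+1.
            by rewrite /s10 /= fr9//= fr7//= fr5//= fr3//= fr2//= addn1.
          have c10 : consts_at s10 by case: c8 => h1 h2; split; rewrite /s10 /= fr9.
          have f40 : reg s10 40 = size S by rewrite /s10 /= fr9.
          have f41 : reg s10 41 = size T by rewrite /s10 /= fr9.
          have f44 : reg s10 44 = size S - size T + size T by rewrite /s10 /= fr9.
          have H6 := @out_ok s10 q10.+1 1 k.+1 (size S) (size T) _ c10 e28 erefl erefl erefl
            f40 f41 f44.
          apply: (tri_mono (leqnn _) _ (H6 _)) => {H6}.
            move=> q11 s11 [q11E rE [B2 B3] B4 B5].
            case: q11 q11E => // q11 _; vstep; exists S, T, M => /=.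
            have keep a : a \notin [:: 26; 27] -> arr s10 a = arr s7 a.
              by move=> aN; rewrite /s10 /= fa9.
            have [[uS _ _] [uT _ _]] := (bS, bT).
            have [/perm_size szS /perm_size szT] := pairing_perm uS uT pM.
            split=> //.
            - split=> j l jk lp.
                by rewrite B2// keep// addn0 l24// szS.
              by rewrite B3// keep// addn0 l25// szT.
            - by move=> j l jk lx; rewrite B4// B5// -l26// -l27.
          rewrite ltnS; apply: leq_trans (_ : O.+1 <= _); last first.
            by move: q9E; clear; lia.
          rewrite addn1 ltnS leq_mul2l; apply/orP; right.
          by move: Sn Tn; clear; move: (size S) (size T) => a b; lia.
        by move: q7E Sn Tn; clear; move: (size S) (size T) => a b; lia.
      - by move=> v; have [t [tT E' tv]] := labT v; exists t; split=> //; rewrite -edge_tr.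
      - by move=> v; have [r [rS E' rv]] := labS v; exists r; split=> //; rewrite /= fa5.
      - by move=> i; exact: z6.
      - by move=> i; exact: z6.
      - by move: q5E Sn Tn; clear; move: (size S) (size T) => a b; lia.
    * by move=> v; rewrite z4.
    * by move=> v; rewrite z4.
    * by rewrite W2; move: q3E; clear; lia.
  + by move=> v; rewrite z2.
  + by move=> v; rewrite z2.
  + by rewrite W1; move: q2E; clear; lia.
- by move=> j _.
- by move=> i.
- by move=> a i a6; rewrite -[LHS]/(arr s0 a i) az// (leq_trans _ a6).
- by [].
- by [].
- by rewrite /s1 /= !addn0.
- by [].
- by move: cN OE; rewrite -/E; clear; move: (k.+1 * n) => kn; lia.
Qed.
End Program.

(** * The computed design *)

Section Design.
Local Open Scope nat_scope.

(** Of two different links with the same sensor, one has [l >= m]. Then [p > m], and this link ends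
    in actuator [l] itself, which no other link from that sensor shares. *)
Lemma link_index_inj p m q l l' : 0 < q -> q <= m -> q <= p ->
  l < p - m + m -> l' < p - m + m ->
  sensor_index m l = sensor_index m l' ->
  actuator_index q p l = actuator_index q p l' -> l = l'.
Proof.
rewrite /sensor_index /actuator_index => q0 qm qp lx lx'.
case: (ltnP l m) => lm; case: (ltnP l' m) => lm' // E; case: (ltnP l q) => lq;
  case: (ltnP l' q) => lq'; case: (ltnP l.+1 q) => lq1; case: (ltnP l'.+1 q) => lq1';
  case: (ltnP l p) => lp; case: (ltnP l' p) => lp'; move=> E'; clear -q0 qm qp lx lx' lm lm' E lq lq' lq1 lq1' lp lp' E'; lia.
Qed.

Lemma sensor_index_lt m l : 0 < m -> sensor_index m l < m.
Proof. by rewrite /sensor_index; case: ifP. Qed.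

Lemma actuator_index_lt q p l : 0 < p -> q <= p -> actuator_index q p l < p.
Proof.
rewrite /actuator_index => p0 qp; case: ifP => lq; case: ifP => // lq1.
exact: leq_trans lq1 qp.
Qed.

Lemma block_index k p i l : i < k.+1 -> l < p -> i * p + l < k.+1 * p.
Proof.
move=> ik lp; rewrite (@leq_trans (i.+1 * p))//; last by rewrite leq_mul2r ik orbT.
by rewrite mulSn addnC ltn_add2r.
Qed.

Definition block_label k p (p0 : 0 < p) (i l : nat) : 'I_(k.+1 * p) :=
  insubd (Ordinal (etrans (muln_gt0 k.+1 p) p0)) (i * p + l).

Section BlockLabel.
Context (k p : nat) (p0 : 0 < p).

Lemma val_block_label i l : i < k.+1 -> l < p -> val (block_label k p0 i l) = i * p + l.
Proof. by move=> ik lp; rewrite val_insubd block_index. Qed.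

Lemma mem_block_label i l : i < k.+1 -> l < p -> block_label k p0 i l \in block k.+1 p i.
Proof.
move=> ik lp; rewrite inE val_block_label// leq_addr /=.
by rewrite mulSn addnC ltn_add2r.
Qed.

Lemma block_labelP (i : 'I_k.+1) (l : 'I_(k.+1 * p)) : l \in block k.+1 p i ->
  exists2 j, j < p & l = block_label k p0 i j.
Proof.
rewrite inE => /andP[il li]; have lj : l - i * p < p.
  by rewrite ltn_subLR// addnC -mulSn.
by exists (l - i * p) => //; apply: val_inj; rewrite val_block_label// subnKC.
Qed.

End BlockLabel.

Lemma cycle_map_iota (T : Type) (r : rel T) (F : nat -> T) q :
  (forall l, l.+1 < q -> r (F l) (F l.+1)) -> (0 < q -> r (F q.-1) (F 0)) ->
  path.cycle r [seq F l | l <- iota 0 q].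
Proof.
case: q => // q H Hq; rewrite /= -cats1.
have -> : [seq F l | l <- iota 1 q] ++ [:: F 0] =
    [seq F (if l == q.+1 then 0 else l) | l <- iota 1 q.+1].
  rewrite -(addn1 q) iotaD map_cat /= addn1 eqxx; congr (_ ++ _).
  by apply/eq_in_map => l; rewrite mem_iota add1n => /andP[_ lq]; rewrite ltn_eqF.
set L := map _ _; have nthL i : i < q.+1 -> nth (F 0) L i = F (if i == q then 0 else i.+1).
  by move=> iq; rewrite (nth_map 0) ?size_iota// nth_iota.
have sL : size L = q.+1 by rewrite size_map size_iota.
apply/(pathP (F 0)) => i; rewrite sL => iq; rewrite nthL//.
case: i iq => [|i] iq /=.
  by case: eqVneq => [E|q0]; [have := Hq isT; rewrite /= -E|apply: H; rewrite ltnS lt0n eq_sym].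
rewrite nthL ?(ltnW iq)// ltn_eqF//.
case: eqVneq => [->|iq']; first exact: Hq.
by apply: H; rewrite ltnS ltn_neqAle iq'.
Qed.

Context {R : realType} {n : nat} (A : 'M[bool]_n) (k : nat) (n0 : 0 < n).
Context (S T : seq 'I_n) (M : seq ('I_n * 'I_n)).
Hypothesis PM : has_perfect_matching (state_bipartite A).
Hypothesis bS : source_basis (edge A) S.
Hypothesis bT : source_basis (edge A^T) T.
Hypothesis pM : pairing_ok (connect (edge A)) S T M.

Local Notation p := (size S).
Local Notation m := (size T).
Local Notation q := (size M).
Local Notation x := (p - m + m).
Local Notation MS := (with_unmatched (unzip1 M) S).
Local Notation MT := (with_unmatched (unzip2 M) T).
Let z0 : 'I_n := Ordinal n0.

Lemma perm_MS : perm_eq MS S.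
Proof. by case: bS bT => uS _ _ [uT _ _]; have [] := pairing_perm uS uT pM. Qed.

Lemma perm_MT : perm_eq MT T.
Proof. by case: bS bT => uS _ _ [uT _ _]; have [] := pairing_perm uS uT pM. Qed.

Lemma size_MS : size MS = p. Proof. exact: perm_size perm_MS. Qed.
Lemma size_MT : size MT = m. Proof. exact: perm_size perm_MT. Qed.

Lemma nth_with_unmatched (l S' : seq 'I_n) j : size l <= j -> j < size (with_unmatched l S') ->
  (nth z0 (with_unmatched l S') j \in S') && (nth z0 (with_unmatched l S') j \notin l).
Proof.
move=> lj js; rewrite nth_cat ltnNge lj /=.
have : nth z0 [seq x <- rev S' | x \notin l] (j - size l) \in [seq x <- rev S' | x \notin l].
  by rewrite mem_nth// ltn_subLR// -size_cat.
by rewrite mem_filter mem_rev andbC.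
Qed.

Lemma p_gt0 : 0 < p.
Proof. by case: bS => _ /(_ z0)[r]; case: (S). Qed.

Lemma m_gt0 : 0 < m.
Proof. by case: bT => _ /(_ z0)[r]; case: (T). Qed.

Lemma q_le_p : q <= p.
Proof. by rewrite -size_MS size_cat size_map leq_addr. Qed.

Lemma q_le_m : q <= m.
Proof. by rewrite -size_MT size_cat size_map leq_addr. Qed.

(** A source representative is matched or reaches a matched sink, so some pair exists. *)
Lemma q_gt0 : 0 < q.
Proof.
case: pM => _ _ H _; case: bS => _ /(_ z0)[r rS _] _.
by case: (M) (H r rS) => //= -[|[]].
Qed.

Local Notation actuator_label := (block_label k p_gt0).
Local Notation sensor_label := (block_label k m_gt0).

(** Labels are reduced modulo the size of a block: all blocks repeat the same states, as collections
    with repetitions allow. *)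
Definition design_actuators (l : 'I_(k.+1 * p)) : 'I_n := nth z0 MS (l %% p).
Definition design_sensors (l : 'I_(k.+1 * m)) : 'I_n := nth z0 MT (l %% m).

Definition design_link (il : 'I_k.+1 * 'I_x) : 'I_(k.+1 * m) * 'I_(k.+1 * p) :=
  (sensor_label il.1 (sensor_index m il.2), actuator_label il.1 (actuator_index q p il.2)).

Definition design_links : {set 'I_(k.+1 * m) * 'I_(k.+1 * p)} :=
  [set design_link il | il : 'I_k.+1 * 'I_x]%SET.

Lemma design_actuatorsE i l : i < k.+1 -> l < p -> design_actuators (actuator_label i l) = nth z0 MS l.
Proof. by move=> ik lp; rewrite /design_actuators val_block_label// modnMDl modn_small. Qed.

Lemma design_sensorsE i l : i < k.+1 -> l < m -> design_sensors (sensor_label i l) = nth z0 MT l.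
Proof. by move=> ik lm; rewrite /design_sensors val_block_label// modnMDl modn_small. Qed.

Lemma val_design_link il : val (design_link il).1 = il.1 * m + sensor_index m il.2 /\
  val (design_link il).2 = il.1 * p + actuator_index q p il.2.
Proof.
by rewrite !val_block_label ?sensor_index_lt ?actuator_index_lt
  ?m_gt0 ?p_gt0 ?q_le_p.
Qed.

Lemma design_link_inj : injective design_link.
Proof.
move=> [i l] [i' l'] E.
have [v1 v2] := val_design_link (i, l); have [v1' v2'] := val_design_link (i', l').
rewrite E v1' in v1; rewrite E v2' in v2; rewrite /= in v1 v2.
have ii' : val i = val i'.
  have := congr1 (fun t => t %/ m) v1.
  by rewrite !divnMDl ?m_gt0// !divn_small ?sensor_index_lt ?m_gt0// !addn0.
rewrite -ii' in v1 v2; move: v1 v2 => /addnI s1 /addnI s2.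
congr (_, _); first exact: val_inj.
apply: val_inj; exact: (link_index_inj q_gt0 q_le_m q_le_p (ltn_ord l) (ltn_ord l')).
Qed.

Lemma card_design_links : #|design_links| = k.+1 * x.
Proof. by rewrite card_imset; [rewrite card_prod !card_ord|exact: design_link_inj]. Qed.

Lemma design_feasible : P2_feasible R A k design_actuators design_sensors design_links.
Proof.
pose Ki (i : 'I_k.+1) := [set design_link (i, l) | l : 'I_x]%SET.
have [u12 MP MS1 MT1] := pM.
have xE : x = maxn p m by rewrite maxnC maxnE addnC.
have px : p <= x by rewrite xE leq_maxl.
have mx : m <= x by rewrite xE leq_maxr.
have linkK (i : 'I_k.+1) l : l < x ->
    (sensor_label i (sensor_index m l), actuator_label i (actuator_index q p l)) \in Ki i.
  by move=> lx; apply/imsetP; exists (Ordinal lx).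
apply: (feasible_of_blocks (Ki := Ki) (SB := fun i => block k.+1 p i)
    (SC := fun i => block k.+1 m i)) => //.
- exact: block_disjoint.
- exact: block_disjoint.
- move=> i e /imsetP[l _ ->]; split=> /=.
  + by rewrite mem_block_label ?sensor_index_lt ?m_gt0.
  + by rewrite mem_block_label ?actuator_index_lt ?p_gt0 ?q_le_p.
  + by apply/imsetP; exists (i, l).
- move=> i.
  have nthMS l : l < q -> nth z0 MS l = (nth (z0, z0) M l).1.
    by move=> lq; rewrite nth_cat size_map lq (nth_map (z0, z0)).
  have nthMT l : l < q -> nth z0 MT l = (nth (z0, z0) M l).2.
    by move=> lq; rewrite nth_cat size_map lq (nth_map (z0, z0)).
  apply: (closed_loop_strong (SB := block k.+1 p i) (SC := block k.+1 m i)
    (M := [seq (actuator_label i l, sensor_label i l) | l <- iota 0 q])).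
  + move=> y; case: bS => _ /(_ y)[r rS ry] _.
    have /(nthP z0)[l ls E] : r \in MS by rewrite (perm_mem perm_MS).
    rewrite size_MS in ls; exists (actuator_label i l); first exact: mem_block_label.
    by rewrite design_actuatorsE// E.
  + move=> y; case: bT => _ /(_ y)[r rT]; rewrite edge_tr => yr _.
    have /(nthP z0)[l ls E] : r \in MT by rewrite (perm_mem perm_MT).
    rewrite size_MT in ls; exists (sensor_label i l); first exact: mem_block_label.
    by rewrite design_sensorsE// E.
  + move=> e /mapP[l]; rewrite mem_iota add0n => /andP[_ lq] -> /=.
    have lp := leq_trans lq q_le_p; have lm := leq_trans lq q_le_m.
    rewrite design_actuatorsE// design_sensorsE// nthMS// nthMT//.
    by have [|_ _] := MP (nth (z0, z0) M l); rewrite ?mem_nth.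
  + apply: cycle_map_iota => [l lq|_] /=.
      have lx : l < x by rewrite (leq_trans _ mx)// (leq_trans (ltnW lq))// q_le_m.
      have := linkK i l lx; rewrite /sensor_index /actuator_index.
      by rewrite (leq_trans (ltnW lq) q_le_m) (ltnW lq) lq.
    have qq : q.-1 < q by rewrite prednK ?q_gt0.
    have lx : q.-1 < x by rewrite (leq_trans _ mx)// (leq_trans qq)// q_le_m.
    have := linkK i q.-1 lx; rewrite /sensor_index /actuator_index.
    by rewrite (leq_trans qq q_le_m) qq prednK ?q_gt0// ltnn.
  + move=> l /(block_labelP p_gt0)[j jp ->] jM.
    have qj : q <= j.
      rewrite leqNgt; apply: contra jM => jq; rewrite /unzip1 -map_comp.
      by apply/mapP; exists j => //; rewrite mem_iota.
    split; last first.
      exists (sensor_label i (sensor_index m j)).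
        by rewrite mem_block_label ?sensor_index_lt ?m_gt0.
      have := linkK i j (leq_trans jp px); rewrite /actuator_index ltnNge qj /= jp.
      by [].
    have /andP[/MS1 + rM] : (nth z0 MS j \in S) && (nth z0 MS j \notin unzip1 M).
      by rewrite nth_with_unmatched ?size_map ?size_MS.
    case=> [|[y /(nthP z0)[l' lq E] ry]]; first by rewrite (negPf rM).
    rewrite size_map in lq.
    exists (actuator_label i l', sensor_label i l').
      by apply/mapP; exists l'; rewrite ?mem_iota.
    rewrite /= design_actuatorsE// design_sensorsE ?(leq_trans lq q_le_m)//.
    by rewrite [nth z0 MT _]nth_cat size_map lq E.
  + move=> l /(block_labelP m_gt0)[j jm ->] jM.
    have qj : q <= j.
      rewrite leqNgt; apply: contra jM => jq; rewrite /unzip2 -map_comp.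
      by apply/mapP; exists j => //; rewrite mem_iota.
    split; last first.
      exists (actuator_label i (actuator_index q p j)).
        by rewrite mem_block_label ?actuator_index_lt ?p_gt0 ?q_le_p.
      by have := linkK i j (leq_trans jm mx); rewrite /sensor_index jm.
    have /andP[/MT1 + rM] : (nth z0 MT j \in T) && (nth z0 MT j \notin unzip2 M).
      by rewrite nth_with_unmatched ?size_map ?size_MT.
    case=> [|[y /(nthP z0)[l' lq E] ry]]; first by rewrite (negPf rM).
    rewrite size_map in lq.
    exists (actuator_label i l', sensor_label i l').
      by apply/mapP; exists l'; rewrite ?mem_iota.
    rewrite /= design_sensorsE// design_actuatorsE ?(leq_trans lq q_le_p)//.
    by rewrite [nth z0 MS _]nth_cat size_map lq E.
- move=> _ i; exists (design_link (i, Ordinal (leq_trans p_gt0 px))).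
  by apply/imsetP; exists (Ordinal (leq_trans p_gt0 px)).
Qed.

Lemma design_P2_solution : P2_solution R A k design_actuators design_sensors design_links.
Proof.
apply: (P2_solution_of_bases bS bT design_feasible) => //.
by rewrite card_design_links maxnC maxnE addnC.
Qed.

Lemma design_output s :
  [/\ reg s 0 = k.+1 * p, reg s 1 = k.+1 * m & reg s 2 = k.+1 * x] ->
  (forall j l, j < k.+1 -> l < p -> arr s 2 (j * p + l) = nth 0 (map val MS) l) ->
  (forall j l, j < k.+1 -> l < m -> arr s 3 (j * m + l) = nth 0 (map val MT) l) ->
  (forall j l, j < k.+1 -> l < x -> arr s 4 (j * x + l) = sensor_index m l + j * m /\
         arr s 5 (j * x + l) = actuator_index q p l + j * p) ->
  output_state design_actuators design_sensors design_links s.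
Proof.
move=> [r0 r1 r2] a2 a3 a45; split.
- by rewrite card_design_links.
- move=> l; rewrite {1}(divn_eq l p) a2 ?ltn_mod ?p_gt0//; last first.
    by rewrite ltn_divLR ?p_gt0.
  by rewrite (nth_map z0)// size_MS ltn_mod p_gt0.
- move=> l; rewrite {1}(divn_eq l m) a3 ?ltn_mod ?m_gt0//; last first.
    by rewrite ltn_divLR ?m_gt0.
  by rewrite (nth_map z0)// size_MT ltn_mod m_gt0.
- rewrite card_design_links.
  have x_gt0 : 0 < x by rewrite (leq_trans m_gt0)// leq_addl.
  have dec t : t < k.+1 * x -> exists il : 'I_k.+1 * 'I_x, t = il.1 * x + il.2 /\
      (arr s 4 t, arr s 5 t) = (val (design_link il).1, val (design_link il).2).
    move=> tk; have ik : t %/ x < k.+1 by rewrite ltn_divLR.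
    have lx : t %% x < x by rewrite ltn_mod.
    exists (Ordinal ik, Ordinal lx); split; first exact: divn_eq.
    have [-> ->] := val_design_link (Ordinal ik, Ordinal lx).
    rewrite {1 2}(divn_eq t x) /=; have [-> ->] := a45 _ _ ik lx.
    by rewrite ![_ + _ * _]addnC.
  apply: uniq_perm.
  + rewrite map_inj_in_uniq ?iota_uniq// => t t'; rewrite !mem_iota /= !add0n.
    move=> /dec[il [tE ->]] /dec[il' [tE' ->]] E.
    have : design_link il = design_link il'.
      by move: E; case: (design_link il) (design_link il') => [a b] [a' b'] [/val_inj -> /val_inj ->].
    by move=> /design_link_inj ilE; rewrite tE tE' ilE.
  + rewrite map_inj_uniq ?enum_uniq// => -[a b] [a' b'] /= [/val_inj -> /val_inj ->].
    by [].
  + move=> u; apply/mapP/mapP => -[t].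
      rewrite mem_iota /= add0n => /dec[il [_ E]] ->; exists (design_link il) => //.
      by rewrite mem_enum; apply/imsetP; exists il.
    rewrite mem_enum => /imsetP[[i l] _ ->] ->; exists (i * x + l).
      by rewrite mem_iota /= add0n block_index.
    have [-> ->] := val_design_link (i, l); have [-> ->] := a45 i l (ltn_ord i) (ltn_ord l).
    by rewrite ![_ + _ * _]addnC.
Qed.

End Design.

(** * The cost in terms of the system digraph, and the theorem *)

Lemma size_edge_list n (A : 'M[bool]_n) :
  size (edge_list A) = #|[set u : 'I_n * 'I_n | A u.2 u.1]%SET|.
Proof.
rewrite /edge_list /edges_of size_flatten /shape -map_comp sumnE big_map big_enum /=.
rewrite (eq_bigr (fun j => \sum_i (A i j : nat))%N) => [|j _]; last first.
  rewrite size_map size_filter -sum1_count big_mkcond big_enum /=.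
  by apply: eq_bigr => i _; case: (A i j).
rewrite pair_big /= -sum1_card [RHS]big_mkcond /=; apply: eq_bigr => u _.
by rewrite inE; case: (A _ _).
Qed.

(** The states and the edges among them occur in the system digraph, whatever the actuators and
    sensors. *)
Lemma system_digraph_size n b c (A : 'M[bool]_n) (f : 'I_b -> 'I_n) (g : 'I_c -> 'I_n) :
  (n + size (edge_list A) <= #|vertex n b c| +
     num_edges (system_digraph A (actuator_matrix f) (sensor_matrix g)))%N.
Proof.
apply: leq_add; first by rewrite !card_sum !card_ord -addnA leq_addr.
pose h (u : 'I_n * 'I_n) : vertex n b c * vertex n b c := (state_vertex u.1, state_vertex u.2).
have hinj : injective h by move=> [a a'] [d d'] [-> ->].
rewrite size_edge_list -(card_imset _ hinj); apply/subset_leq_card/fintype.subsetP => w.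
by move=> /imsetP[u]; rewrite !inE => Au ->.
Qed.

Theorem theorem4 (R : realType) :
  (forall (n : nat) (A : 'M[bool]_n) (k p m : nat)
      (iota0 : 'I_p -> 'I_n) (gamma0 : 'I_m -> 'I_n)
      (iota : 'I_(k.+1 * p) -> 'I_n) (gamma : 'I_(k.+1 * m) -> 'I_n)
      (K : 'I_k.+1 -> {set 'I_(k.+1 * m) * 'I_(k.+1 * p)}),
    has_perfect_matching (state_bipartite A) ->
    minimum_collection (fun q => @ctrl_dedicated R n q A) iota0 ->
    minimum_collection (fun q => @obs_dedicated R n q A) gamma0 ->
    minimum_collection (fun q => @ctrl_resilient R n A k q) iota ->
    minimum_collection (fun q => @obs_resilient R n A k q) gamma ->
    (forall i : 'I_k.+1,
      ctrl_dedicated R A (subcollection iota (block k.+1 p i)) /\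
      obs_dedicated R A (subcollection gamma (block k.+1 m i))) ->
    (forall i : 'I_k.+1,
      procedure1 (system_digraph A (actuator_matrix iota) (sensor_matrix gamma))
        (block k.+1 p i) (block k.+1 m i) (K i)) ->
    P2_solution R A k iota gamma (\bigcup_(i < k.+1) K i)%SET)
  /\
  (exists (prog : program) (a : nat),
    forall (n : nat) (A : 'M[bool]_n) (k b c : nat)
      (iota : 'I_b -> 'I_n) (gamma : 'I_c -> 'I_n),
    (0 < n)%N ->
    has_perfect_matching (state_bipartite A) ->
    minimum_collection (fun q => @ctrl_resilient R n A k q) iota ->
    minimum_collection (fun q => @obs_resilient R n A k q) gamma ->
    let D := system_digraph A (actuator_matrix iota) (sensor_matrix gamma) in
    exists (t : nat) (s : state) (b' c' : nat)
      (iota' : 'I_b' -> 'I_n) (gamma' : 'I_c' -> 'I_n) (K' : {set 'I_c' * 'I_b'}),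
      [/\ exec prog (input_state A k) t s,
          output_state iota' gamma' K' s,
          P2_solution R A k iota' gamma' K'
        & t%:R <= a%:R * k.+1%:R *
            Num.max (#|vertex n b c| + num_edges D)%:R
                    ((b + c)%:R `^ (5%:R / 2%:R)) :> R]).
Proof.
split.
  move=> n A k p m iota0 gamma0 iota gamma K PM min1 min2 _ _ ded proc.
  have [BA bA] := source_basis_exists (edge A).
  have [BC bC] := source_basis_exists (edge A^T).
  (* Minimality bounds [p] and [m] by the sizes of the bases, in terms of which the lower bounds for
     all designs are stated. *)
  have pB := ctrl_minimum_le PM min1 bA; have mB := obs_minimum_le PM min2 bC.
  have covB (i : 'I_k.+1) x : exists2 l, l \in block k.+1 p i & connect (edge A) (iota l) x.
    apply: (subcollection_cover (P := fun y => connect (edge A) y x)).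
    by have [/ctrl_dedicated_cover/(_ x)] := ded i.
  have covC (i : 'I_k.+1) x : exists2 s, s \in block k.+1 m i & connect (edge A) x (gamma s).
    apply: (subcollection_cover (P := fun y => connect (edge A) x y)).
    by have [_ /obs_dedicated_cover/(_ x)] := ded i.
  apply: (P2_solution_of_bases bA bC).
  - apply: (feasible_of_blocks (Ki := K) (SB := fun i => block k.+1 p i)
      (SC := fun i => block k.+1 m i)) => //.
    + exact: block_disjoint.
    + exact: block_disjoint.
    + move=> i e eK; have [] := procedure1_subset (proc i) eK; split=> //.
      by apply/bigcupP; exists i.
    + by move=> i; have [] := procedure1_strong (proc i) (covB i) (covC i).
    + by move=> n0 i; have [_ /(_ n0)] := procedure1_strong (proc i) (covB i) (covC i).
  - by rewrite leq_mul2l pB orbT.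
  - by rewrite leq_mul2l mB orbT.
  - apply: (@leq_trans (\sum_(i < k.+1) #|K i|)%N).
      elim/big_ind2: _ => [|S a S' a' Sa Sa'|//]; first by rewrite cards0.
      by rewrite (leq_trans (leq_card_setU _ _))// leq_add.
    rewrite -[k.+1 in X in (_ <= X)%N]card_ord -sum_nat_const leq_sum// => i _.
    rewrite (leq_trans (procedure1_card (proc i)))// geq_max !leq_max.
    by rewrite (leq_trans (block_card _ _ _) pB) (leq_trans (block_card _ _ _) mB) orbT.
(* 1601 is 1000 + 600 + 1: as [n] is positive, both [k.+1] and the one extra credit are at most
   [k.+1 * (n + size (edge_list A))]. *)
exists design_program, 1601%N => n A k b c iota gamma n0 PM _ _ D.
have [t [s [r [ex tle [S [T [M [[bS bT] pM rE [a2 a3] a45]]]]]]]] :=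
  design_program_ok (A := A) (ltnSn (1000 * (k.+1 * (n + size (edge_list A))) + 600 * k.+1)).
have O := design_output n0 bS bT pM rE a2 a3 a45.
have P := @design_P2_solution R n A k n0 S T M PM bS bT pM.
exists t, s; do 5 eexists; split; [exact: ex|exact: O|exact: P|].
have {tle} : (t <= 1601 * k.+1 * (n + size (edge_list A)))%N.
  have : (k.+1 <= k.+1 * (n + size (edge_list A)))%N by rewrite leq_pmulr ?addn_gt0 ?n0.
  rewrite -mulnA; move: (k.+1 * _)%N tle; clear => X tle kX; lia.
move: (system_digraph_size A iota gamma) 1601%N; rewrite -/D.
move: (size (edge_list A)) (num_edges D) (#|_|) => E d v nE a ta.
(* The bound, linear in vertices and edges, is compared with the first argument of the maximum. *)
apply: (@le_trans _ _ (a%:R * k.+1%:R * (v + d)%:R)); last first.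
  by apply: ler_wpM2l; rewrite ?le_max ?lexx// -natrM ler0n.
rewrite -!natrM ler_nat (leq_trans ta)//.
by rewrite leq_mul2l nE orbT.
Qed.
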